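(* Let $F$ be a fullerene graph that is not isomorphic to $F_{24}$, the (unique) fullerene graph on $24$ vertices. Then $f(F)\geq 3$.
   Context: A fullerene graph is a cubic $3$-connected plane graph all of whose faces are pentagons or hexagons. For a graph $G$ with a perfect matching $M$, a set $S\subseteq M$ is a forcing set of $M$ if $S$ is contained in no perfect matching of $G$ other than $M$; the forcing number $f(G,M)$ is the minimum size of a forcing set of $M$, and the minimum forcing number $f(G)$ is the minimum of $f(G,M)$ over all perfect matchings $M$ of $G$. There is exactly one fullerene graph with $24$ vertices, denoted $F_{24}$. *)

(* Defs.v *)
From HB Require Import structures.
From mathcomp Require Import all_boot all_fingroup.

Set Implicit Arguments.
Unset Strict Implicit.
Unset Printing Implicit Defensive.

Record sgraph := SGraph {
  vertex :> finType;
  adj : rel vertex;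
  adj_sym : symmetric adj;
  adj_irr : irreflexive adj }.

Arguments adj {G} : rename.

Definition edges (G : sgraph) : {set {set G}} :=
  [set [set d.1; d.2] | d in [pred d : G * G | adj d.1 d.2]].

Definition isomorphic (G H : sgraph) : Prop :=
  exists2 f : G -> H, bijective f & forall x y, adj (f x) (f y) = adj x y.

Definition cubic (G : sgraph) : Prop :=
  forall x : G, #|[set y | adj x y]| = 3.

Definition del_adj (G : sgraph) (X : {set G}) : rel G :=
  [rel x y | [&& x \notin X, y \notin X & adj x y]].

Definition k_connected (k : nat) (G : sgraph) : Prop :=
  k < #|G| /\
  forall X : {set G}, #|X| < k ->
  forall x y : G, x \notin X -> y \notin X -> connect (del_adj X) x y.

(* An embedding of a connected graph in the sphere (equivalently, in the      *)
(* plane, the unbounded face counting like any other) is encoded by its       *)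
(* combinatorial map: at every vertex, the cyclic order of the outgoing       *)
(* darts; the facial walks are then the orbits of a permutation of the darts, *)
(* and the surface is a sphere exactly when V - E + F = 2.                    *)
Notation dart G := {d : vertex G * vertex G | adj d.1 d.2}.

Definition source (G : sgraph) (d : dart G) : G := (val d).1.

Fact flip_subproof (G : sgraph) (d : dart G) : adj (val d).2 (val d).1.
Proof. by rewrite adj_sym (valP d). Qed.

Definition flip (G : sgraph) (d : dart G) : dart G :=
  exist (fun d => adj d.1 d.2) ((val d).2, (val d).1) (flip_subproof d).

(* The r-orbit of a dart consists of all the darts with the same source.      *)
Definition rotation_system (G : sgraph) (r : {perm dart G}) : Prop :=
  forall d d' : dart G, (d' \in porbit r d) = (source d' == source d).

(* The dart following d = (u, v) on its facial walk is the successor, in the  *)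
(* cyclic order around v, of the reversed dart (v, u).                        *)
Definition face_step (G : sgraph) (r : {perm dart G}) (d : dart G) : dart G :=
  r (flip d).

Definition num_faces (G : sgraph) (r : {perm dart G}) : nat :=
  fcard (face_step r) {: dart G}.

Definition face_length (G : sgraph) (r : {perm dart G}) (d : dart G) : nat :=
  fingraph.order (face_step r) d.

Definition plane_embedding (G : sgraph) (r : {perm dart G}) : Prop :=
  rotation_system r /\ #|G| + num_faces r = #|edges G| + 2.

Definition fullerene (G : sgraph) : Prop :=
  [/\ cubic G, k_connected 3 G &
      exists2 r : {perm dart G}, plane_embedding r &
        forall d : dart G, face_length r d = 5 \/ face_length r d = 6].

Definition perfect_matching (G : sgraph) (M : {set {set G}}) : bool :=
  (M \subset edges G) && partition M [set: G].

Definition forcing_set (G : sgraph) (M S : {set {set G}}) : bool :=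
  (S \subset M) &&
  [forall M' : {set {set G}},
     perfect_matching M' && (S \subset M') ==> (M' == M)].

(* A perfect matching M is a forcing set of itself, so that M is a legitimate *)
(* starting point for the search of a minimum.                                *)
Definition forcing_number (G : sgraph) (M : {set {set G}}) : nat :=
  #|[arg min_(S < M | forcing_set M S) #|S|]|.

(* The value 0 for a graph without a perfect matching is a convention: there  *)
(* the minimum is over the empty set.                                         *)
Definition min_forcing_number (G : sgraph) : nat :=
  if [pick M : {set {set G}} | perfect_matching M] is Some M0 then
    forcing_number [arg min_(M < M0 | perfect_matching M) forcing_number M]
  else 0.

(* F24 consists of three concentric cycles: the boundary of a hexagon         *)
(* a_i = i (i < 6), a 12-cycle b_j = 6 + j (j < 12) and the boundary of the   *)
(* other hexagon c_i = 18 + i (i < 6), with the spokes a_i b_(2i) and         *)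
(* c_i b_(2i+1); between consecutive cycles lie six pentagons.                *)
Definition F24_edges : seq (nat * nat) :=
  [seq (i, i.+1 %% 6) | i <- iota 0 6] ++
  [seq (6 + j, 6 + j.+1 %% 12) | j <- iota 0 12] ++
  [seq (18 + i, 18 + i.+1 %% 6) | i <- iota 0 6] ++
  [seq (i, 6 + i.*2) | i <- iota 0 6] ++
  [seq (18 + i, 6 + i.*2.+1) | i <- iota 0 6].

Definition F24_adj : rel 'I_24 :=
  [rel x y : 'I_24 | ((x : nat, y : nat) \in F24_edges)
                  || ((y : nat, x : nat) \in F24_edges)].

Fact F24_sym : symmetric F24_adj.
Proof. by move=> x y; rewrite /F24_adj /= orbC. Qed.

Fact F24_irr : irreflexive F24_adj.
Proof.
move=> x; rewrite /F24_adj [LHS]/= orbb.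
have /allP/(_ x) : all (fun n => (n, n) \notin F24_edges) (iota 0 24) by [].
by rewrite mem_iota ltn_ord => /(_ isT)/negbTE.
Qed.

Definition F24 : sgraph := SGraph F24_sym F24_irr.

(* Main.v *)
Require Import Defs.
From mathcomp Require Import all_boot all_fingroup zify.

(* Let S be a forcing set with at most two edges; enlarging it, assume that it has exactly two. Then the
   other vertices induce a subgraph X with a unique perfect matching, and at most 8 edges leave X. By
   Kotzig's theorem, obtained here from a largest tight Tutte barrier, such a subgraph has a bridge that
   belongs to the matching. Euler's formula, applied to the faces inside a bond, shows that an edge cut
   with at most 4 edges isolates a tree, so that X has a vertex of degree 1 unless the bridge separates
   two parts A and B with exactly 5 leaving edges each. Removing leaves with their partners as long as
   possible, the removed leaves form an independent set.
   If everything can be removed, this yields a set of n/2 - 1 vertices that spans a single edge, so that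
   deleting 5 edges makes the graph bipartite. But each of the 12 pentagons must lose an edge.
   Otherwise A and B contain few pentagons by the same count, hence are facial pentagons themselves.
   Outside of them the graph is bipartite up to the two edges of S, at most one of the 8 faces crossing
   the boundary of A and B is a hexagon, and following the faces leaves F24 only. *)

(** On a side A of a bond, Euler's formula becomes [#|arcs A| + 6 = 3 * cut A + #|pentagons A|]:
    hexagons cancel, so the boundary ring is governed by the cut and the pentagons inside. With at
    most four leaving edges and at most six pentagons the ring can be stripped off; since there are
    twelve pentagons, one side always qualifies. With five leaving edges and at most five pentagons,
    the balance forces two adjacent boundary vertices. Failure of bipartiteness is measured by darts
    with both ends of one colour; an odd face carries an odd number of them. When peeling stops at
    two pentagons, some colouring has only 18 such darts. The twelve pentagons use 12, the two
    central ones 2 more each, and each hexagon across the boundary 2, so two such hexagons would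
    need 20. Tracing faces cannot appeal to a picture, because vertices named along different faces
    may coincide. It only yields a locally faithful labelling by the vertices of F24; counting
    vertices makes it injective. *)

Set Implicit Arguments.
Unset Strict Implicit.
Unset Printing Implicit Defensive.

(* Abstracting the cardinals identifies those that differ only by the path of their finite structure. *)
Ltac card_lia := clear; repeat (let c := fresh "c" in move: #|_| => c); lia.

(** * Matchings *)

Section Hall.
Variables (I J : finType) (j0 : J).
Implicit Types (A B : {set I}) (N : I -> {set J}).

(** Induction on A: a tight proper subset is matched first and the rest avoids its neighbourhood;
    without tight subsets Hall's condition has slack one, so any neighbour of any element may be
    spent. [j0] provides a function when A is empty. *)
Lemma hall N A :
  (forall B, B \subset A -> #|B| <= #|\bigcup_(i in B) N i|) ->
  exists2 f : I -> J, {in A &, injective f} & {in A, forall i, f i \in N i}.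
Proof.
have [n] := ubnP #|A|; elim: n => // n IHn in N A *; rewrite ltnS => leAn hallA.
have [->|/set0Pn[a Aa]] := eqVneq A set0.
  by exists (fun=> j0) => i; rewrite ?inE.
have [/existsP[B /and4P[B0 BA nBA eqB]] | /existsPn tight] :=
  boolP [exists B : {set I}, [&& B != set0, B \subset A, B != A &
                             #|\bigcup_(i in B) N i| == #|B|]].
  have ltBA : #|B| < #|A| by rewrite proper_card // properEneq nBA.
  have [f1 inj1 N1] : exists2 f : I -> J, {in B &, injective f} & {in B, forall i, f i \in N i}.
    apply: IHn => [|C CB]; first exact: leq_trans ltBA _.
    by apply: hallA; apply: subset_trans CB BA.
  pose NB := \bigcup_(i in B) N i.
  have [f2 inj2 N2] : exists2 f : I -> J, {in A :\: B &, injective f} &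
      {in A :\: B, forall i, f i \in N i :\: NB}.
    apply: (IHn (fun i => N i :\: NB)) => [|C CAB].
      have := cardsID B A; rewrite (setIidPr BA) => cA.
      have : 0 < #|B| by rewrite card_gt0.
      lia.
    have CB0 : C :&: B = set0.
      apply/setP=> i; rewrite !inE; apply/negP=> /andP[Ci Bi].
      by have := subsetP CAB i Ci; rewrite inE Bi.
    have := hallA (C :|: B); rewrite subUset BA andbT.
    rewrite (subset_trans CAB (subsetDl _ _)) => /(_ isT).
    rewrite cardsU CB0 cards0 subn0 bigcup_setU -/NB.
    have -> : \bigcup_(i in C) (N i :\: NB) = (\bigcup_(i in C) N i) :\: NB.
      by rewrite !setDE big_distrl /=; apply: eq_bigr => i _; rewrite setDE.
    have := cardsUI (\bigcup_(i in C) N i) NB; have := cardsID NB (\bigcup_(i in C) N i).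
    have -> : #|NB| = #|B| by rewrite (eqP eqB).
    lia.
  exists (fun i => if i \in B then f1 i else f2 i) => [i k Ai Ak|i Ai].
    have f2N l : l \in A -> l \notin B -> f2 l \notin NB.
      by move=> Al Bl; have := N2 l; rewrite !inE Al Bl => /(_ isT)/andP[].
    have f1N l : l \in B -> f1 l \in NB.
      by move=> Bl; apply/bigcupP; exists l => //; apply: N1.
    case: ifPn => Bi; case: ifPn => Bk.
    - exact: inj1.
    - by move=> e; have := f2N k Ak Bk; rewrite -e f1N.
    - by move=> e; have := f2N i Ai Bi; rewrite e f1N.
    - by apply: inj2; rewrite inE ?Bi ?Bk.
  case: ifPn => Bi; first exact: N1.
  by have := N2 i; rewrite !inE Ai Bi => /(_ isT)/andP[].
have [j Nj] : exists j, j \in N a.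
  have := hallA [set a]; rewrite sub1set Aa big_set1 cards1 => /(_ isT).
  by rewrite card_gt0 => /set0Pn.
have [f injf Nf] : exists2 f : I -> J, {in A :\ a &, injective f} &
    {in A :\ a, forall i, f i \in N i :\ j}.
  apply: (IHn (fun i => N i :\ j)) => [|C CA].
    by move: leAn; rewrite (cardsD1 a A) Aa.
  have [->|C0] := eqVneq C set0; first by rewrite cards0.
  have CA' : C \subset A by apply: subset_trans CA (subsetDl _ _).
  have nCA : C != A.
    by apply: contraTneq CA => ->; rewrite subsetD1 Aa andbF.
  have := tight C; rewrite C0 CA' nCA /= => neq.
  have := hallA C CA'; rewrite leq_eqVlt eq_sym (negPf neq) /=.
  have -> : \bigcup_(i in C) (N i :\ j) = (\bigcup_(i in C) N i) :\ j.
    by rewrite !setDE big_distrl /=; apply: eq_bigr => i _; rewrite setDE.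
  rewrite (cardsD1 j (\bigcup_(i in C) N i)); lia.
exists (fun i => if i == a then j else f i) => [i k Ai Ak|i Ai].
  have fj l : l \in A -> l != a -> f l != j.
    by move=> Al la; have := Nf l; rewrite !inE la Al => /(_ isT)/andP[].
  case: eqVneq => [->|ia]; case: eqVneq => [->|ka] //.
  - by move=> e; have := fj k Ak ka; rewrite -e eqxx.
  - by move=> e; have := fj i Ai ia; rewrite e eqxx.
  - by apply: injf; rewrite !inE ?ia ?ka.
case: eqVneq => [->|ia] //.
by have := Nf i; rewrite !inE ia Ai => /(_ isT)/andP[].
Qed.
End Hall.

(** * Tutte's theorem, and Kotzig's theorem on unique perfect matchings *)

Section Matching.
Variables (T : finType) (e : rel T).
Hypothesis e_sym : symmetric e.
Implicit Types (A B K Q : {set T}) (P : {set {set T}}) (m : T -> T).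

(** As a function, so that uniqueness is pointwise equality on A and matchings can be modified by
    cases. *)
Definition matching A m :=
  forall x, x \in A -> [/\ m x \in A, m (m x) = x & e x (m x)].

Definition matchable A := exists m, matching A m.

(** The cells in P are unions of components of A minus Q and need not exhaust it; enlarging a
    barrier is then purely set-theoretic. *)
Definition barrier A Q P :=
  [&& Q \subset A, trivIset P &
   [forall K in P, [&& K \subset A :\: Q, odd #|K| &
     [forall x in K, forall y in A, e x y ==> (y \in K :|: Q)]]]].

Definition tutte A := forall Q P, barrier A Q P -> #|P| <= #|Q|.

Lemma barrierP A Q P :
  reflect [/\ Q \subset A, trivIset P & forall K, K \in P ->
     [/\ K \subset A :\: Q, odd #|K| &
       forall x y, x \in K -> y \in A -> e x y -> y \in K :|: Q]]
   (barrier A Q P).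
Proof.
apply: (iffP and3P) => [[QA tP /forall_inP barP]|[QA tP barP]]; split=> //.
  move=> K /barP/and3P[KA oK /forall_inP clK]; split=> // x y Kx Ay exy.
  by have /forall_inP/(_ y Ay)/implyP/(_ exy) := clK x Kx.
apply/forall_inP=> K /barP[KA oK clK]; rewrite KA oK /=.
by apply/forall_inP=> x Kx; apply/forall_inP=> y Ay; apply/implyP; apply: clK.
Qed.

(** Each cell K gives [x K] to the barrier vertex [q K] and matches the rest internally. The values
    returned on the [x K] serve to tell two such matchings apart. *)
Lemma matchable_cover A Q P (x q : {set T} -> T) :
  trivIset P -> cover P = A :\: Q -> Q \subset A ->
  (forall K, K \in P -> x K \in K /\ matchable (K :\ x K)) ->
  {in P &, injective q} -> (q @: P = Q) ->
  (forall K, K \in P -> e (x K) (q K)) ->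
  exists2 m, matching A m & {in P, forall K, m (x K) = q K}.
Proof.
move=> tP cP QA xP injq imq exq.
have [mK mKP] : exists mK : {set T} -> T -> T, forall K, K \in P -> matching (K :\ x K) (mK K).
  apply: (fin_all_exists (P := fun K m => K \in P -> matching (K :\ x K) m)) => K.
  by have [/xP[_ [m mP]]|] := boolP (K \in P); [exists m | exists id].
pose own y := odflt set0 [pick K in P | q K == y].
have ownq K : K \in P -> own (q K) = K.
  move=> PK; rewrite /own; case: pickP => [L /andP[PL /eqP qL]|/(_ K)]; first exact: injq.
  by rewrite PK eqxx.
pose m y := if y \in Q then x (own y) else
            let K := pblock P y in if y == x K then q K else mK K y.
have PA K y : K \in P -> y \in K -> (y \in A) && (y \notin Q).
  move=> PK Ky; have : y \in cover P by apply/bigcupP; exists K.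
  by rewrite cP inE andbC.
have mx K : K \in P -> m (x K) = q K.
  move=> PK; have [Kx _] := xP K PK; have /andP[_ xQ] := PA K _ PK Kx.
  by rewrite /m (negPf xQ) (def_pblock tP PK Kx) eqxx.
have qQ K : K \in P -> q K \in Q by move=> PK; rewrite -imq imset_f.
have mq K : K \in P -> m (q K) = x K by move=> PK; rewrite /m qQ // ownq.
exists m => // y Ay.
have [Qy|nQy] := boolP (y \in Q).
  move: Qy; rewrite -imq => /imsetP[K PK ->]; rewrite mq // mx // e_sym exq //.
  by split=> //; have [Kx _] := xP K PK; have /andP[] := PA K _ PK Kx.
have : y \in cover P by rewrite cP inE nQy.
case/bigcupP=> K PK Ky; have [->|nyx] := eqVneq y (x K).
  by rewrite mx // mq // exq //; split=> //; rewrite (subsetP QA) ?qQ.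
have my z : z \in K -> z != x K -> m z = mK K z.
  move=> Kz nz; have /andP[_ zQ] := PA K _ PK Kz.
  by rewrite /m (negPf zQ) (def_pblock tP PK Kz) (negPf nz).
have [] := mKP K PK y; first by rewrite !inE nyx.
rewrite !inE => /andP[nx Km] mm em; rewrite my // my //; split=> //.
by have /andP[] := PA K _ PK Km.
Qed.

Lemma tutte_even A : tutte A -> ~~ odd #|A|.
Proof.
move=> tA; apply/negP=> oA; have := tA set0 [set A]; rewrite cards0 cards1 ltnn.
suff -> : barrier A set0 [set A] by move/(_ isT).
apply/barrierP; split; rewrite ?sub0set //.
  by apply/trivIsetP=> B C; rewrite !inE => /eqP-> /eqP->; rewrite eqxx.
by move=> K /set1P->; rewrite setD0; split=> // x y _ Ay _; rewrite inE Ay.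
Qed.

Lemma barrier_cover A Q P : barrier A Q P -> cover P \subset A :\: Q.
Proof. by case/barrierP=> _ _ bP; apply/bigcupsP=> K /bP[]. Qed.

Lemma barrier_parity A Q P : barrier A Q P ->
  odd #|A| = odd #|Q| (+) odd #|P| (+) odd #|A :\: Q :\: cover P|.
Proof.
move=> bP; have /barrierP[QA tP bK] := bP; have cA := barrier_cover bP.
have oc : odd #|cover P| = odd #|P|.
  rewrite -(eqP tP) -sum1_card !(big_morph odd oddD (id1 := false)) //.
  by apply: eq_bigr => K /bK[_ ->].
have := cardsID Q A; rewrite (setIidPr QA).
have := cardsID (cover P) (A :\: Q); rewrite (setIidPr cA).
by move=> <- <-; rewrite !oddD oc addbA.
Qed.

Lemma trivIsetU1s P B : trivIset P -> {in P, forall K, [disjoint B & K]} -> trivIset (B |: P).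
Proof.
move=> /trivIsetP tP dB; apply/trivIsetP=> K L.
case/setU1P=> [->|PK] /setU1P[->|PL]; rewrite ?eqxx // => neq; last exact: tP.
  exact: dB.
by rewrite disjoint_sym; apply: dB.
Qed.

(** Cells are closed, so the uncovered part sees only itself and Q; if odd, it is a further cell. *)
Lemma barrier_add A Q P : barrier A Q P -> odd #|A :\: Q :\: cover P| ->
  barrier A Q ((A :\: Q :\: cover P) |: P) /\ (A :\: Q :\: cover P) \notin P.
Proof.
move=> bP oR; have /barrierP[QA tP bK] := bP.
set R := A :\: Q :\: cover P in oR *.
have dR K : K \in P -> [disjoint R & K].
  move=> PK; rewrite -setI_eq0; apply/eqP/setP=> x; rewrite !inE.
  apply/negP=> /andP[/andP[/negP nc _] Kx]; apply: nc.
  by apply/bigcupP; exists K.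
split; last first.
  apply/negP=> PR; have := dR R PR; rewrite -setI_eq0 setIid => /eqP R0.
  by rewrite R0 cards0 in oR.
apply/barrierP; split=> //; first exact: trivIsetU1s.
move=> K /setU1P[->|/bK] //; split=> //; first exact: subsetDl.
move=> x y; rewrite !inE => /and3P[nx nQx Ax] Ay exy; rewrite Ay andbT.
have [Qy|nQy] := boolP (y \in Q); first by rewrite orbT.
rewrite orbF /= andbT.
apply/negP=> /bigcupP[K' PK' Ky].
have [_ _ cl] := bK _ PK'; have := cl y x Ky Ax; rewrite e_sym exy => /(_ isT).
rewrite inE (negPf nQx) orbF => Kx; case/negP: nx.
by apply/bigcupP; exists K'.
Qed.

(* A tight barrier can be enlarged by any vertex outside it and its cells, and by a vertex of a cell together with a Tutte violation of the rest of that cell. *)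
Lemma maximal_barrier A : tutte A -> exists Q P,
  [/\ barrier A Q P, #|P| = #|Q|, cover P = A :\: Q,
      (A != set0 -> Q != set0) &
      forall K x, K \in P -> x \in K -> tutte (K :\ x)].
Proof.
move=> tA; pose ok (QP : {set T} * {set {set T}}) :=
  barrier A QP.1 QP.2 && (#|QP.2| == #|QP.1|).
have ok0 : ok (set0, set0).
  rewrite /ok /= !cards0 eqxx andbT; apply/barrierP; split; rewrite ?sub0set //.
    by apply/trivIsetP=> B C; rewrite inE.
  by move=> K; rewrite inE.
case: (arg_maxnP (fun QP : {set T} * {set {set T}} => #|QP.1|) ok0) => -[Q P] /=.
move=> /andP[/= bP /eqP cPQ] maxQ; exists Q, P.
have maxQ' Q' P' : barrier A Q' P' -> #|Q'| <= #|P'| -> #|Q'| <= #|Q|.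
  move=> b' le'; apply: (maxQ (Q', P')); rewrite /ok /= b' /=.
  by rewrite eqn_leq le' (tA _ _ b').
have /barrierP[QA tP bK] := bP; have eA := tutte_even tA.
(* By parity the uncovered part is even; moving one of its vertices [z] to Q makes it odd, hence a
   new cell, against maximality. *)
have cov : cover P = A :\: Q.
  apply/eqP; rewrite eqEsubset (barrier_cover bP) /= -setD_eq0.
  apply/negPn/negP=> /set0Pn[z Rz].
  have zA : z \in A by move: Rz; rewrite !inE => /and3P[].
  have nzQ : z \notin Q by move: Rz; rewrite !inE => /and3P[].
  have bz : barrier A (z |: Q) P.
    apply/barrierP; split=> //; first by rewrite subUset sub1set zA.
    move=> K PK; have [KA oK cl] := bK K PK; split=> //.
      apply/subsetP=> x Kx; have := subsetP KA x Kx; rewrite !inE negb_or => /andP[-> ->].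
      rewrite !andbT; apply/eqP=> xz; move: Rz; rewrite -xz !inE => /and3P[/negP nc _ _].
      by apply: nc; apply/bigcupP; exists K.
    move=> x y Kx Ay exy; have := cl x y Kx Ay exy; rewrite !inE.
    by case/orP=> ->; rewrite ?orbT.
  have R2 : A :\: (z |: Q) :\: cover P = (A :\: Q :\: cover P) :\ z.
    by apply/setP=> x; rewrite !inE; case: (x == z); case: (x \in cover P).
  have := barrier_parity bP; rewrite cPQ addbb /= (negPf eA) => oR.
  have oR2 : odd #|A :\: (z |: Q) :\: cover P|.
    by rewrite R2; move: oR; rewrite (cardsD1 z (A :\: Q :\: cover P)) Rz /=; case: odd.
  have [b2 nP] := barrier_add bz oR2.
  by have := maxQ' _ _ b2; rewrite !cardsU1 nP nzQ cPQ leqnn => /(_ isT); rewrite ltnn.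
split=> //.
  apply: contra_neq => Q0; move: cov; rewrite Q0 setD0.
  have -> : P = set0 by apply: cards0_eq; rewrite cPQ Q0 cards0.
  by rewrite /cover big_set0.
move=> K x PK Kx P1 L bL; rewrite leqNgt; apply/negP=> ltL.
have [KA oK cl] := bK K PK.
have /barrierP[P1K tL bL1] := bL.
(* [K :\ x] is even, so a violation by one leaves an odd uncovered part, which is one more cell. An
   excess of two pays for the lost cell [K] and for the new barrier vertex [x]. *)
have [L' [bL' leL']] : exists L', barrier (K :\ x) P1 L' /\ #|P1| + 2 <= #|L'|.
  have [le2|lt2] := leqP (#|P1| + 2) #|L|; first by exists L.
  have eqL : #|L| = #|P1|.+1 by move: lt2 ltL; clear; lia.
  have := barrier_parity bL; rewrite eqL /=.
  have -> : odd #|K :\ x| = false by move: oK; rewrite (cardsD1 x K) Kx /=; case: odd.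
  rewrite addbN addbb /= => /esym/negbFE oR.
  have [b2 nL] := barrier_add bL oR; exists (((K :\ x) :\: P1 :\: cover L) |: L).
  by split=> //; rewrite cardsU1 nL eqL; clear; lia.
have {bL1 tL bL ltL L} /barrierP[_ tL bL] := bL'.
have KQ y : y \in K -> (y \in A) && (y \notin Q).
  by move=> Ky; have := subsetP KA y Ky; rewrite inE andbC.
have P1Kx y : y \in P1 -> (y \in K) && (y != x).
  by move=> Py; have := subsetP P1K y Py; rewrite !inE andbC.
have LK M y : M \in L' -> y \in M -> [/\ y \in K, y != x & y \notin P1].
  by move=> LM My; have [/subsetP/(_ y My)] := bL M LM; rewrite !inE => /and3P[-> -> ->].
have dKP M : M \in P -> M != K -> [disjoint K & M].
  by move=> PM nM; apply: (trivIsetP tP) => //; rewrite eq_sym.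
have b3 : barrier A (x |: (P1 :|: Q)) ((P :\ K) :|: L').
  apply/barrierP; split.
  - rewrite !subUset sub1set QA andbT; have /andP[-> _] /= := KQ x Kx.
    by apply/subsetP=> y /P1Kx/andP[/KQ/andP[]].
  - apply/trivIsetP=> M N; rewrite !inE.
    have key M1 N1 : M1 != K -> M1 \in P -> N1 \in L' -> [disjoint M1 & N1].
      move=> nM PM LN; have dM := dKP _ PM nM; rewrite -setI_eq0; apply/eqP/setP=> y.
      rewrite !inE; apply/negP=> /andP[My Ny]; have [Ky _ _] := LK _ _ LN Ny.
      by have := disjointFr dM Ky; rewrite My.
    case/orP=> [/andP[nM PM]|LM] /orP[/andP[nN PN]|LN] neq.
    + exact: (trivIsetP tP).
    + exact: key.
    + by rewrite disjoint_sym; apply: key.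
    + exact: (trivIsetP tL).
  - move=> M; rewrite !inE => /orP[/andP[nM PM]|LM].
      have dM := dKP M PM nM; have [MA oM clM] := bK M PM; split=> //.
        apply/subsetP=> y My; have := subsetP MA y My; rewrite !inE !negb_or => /andP[-> ->].
        have nKy : y \notin K by apply/negP=> Ky; have := disjointFr dM Ky; rewrite My.
        rewrite !andbT; apply/andP; split.
          by apply: contraNneq nKy => ->.
        by apply: contra nKy => /P1Kx/andP[].
      by move=> y z My Az eyz; have := clM y z My Az eyz; rewrite !inE => /orP[]->; rewrite ?orbT.
    have [MK oM clM] := bL M LM; split=> //.
      apply/subsetP=> y My; have [Ky nx nP] := LK M y LM My.
      by have /andP[yA yQ] := KQ y Ky; rewrite !inE yA (negPf nx) (negPf nP) yQ.
    move=> y z My Az eyz; have [Ky nx nP] := LK M y LM My.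
    have := cl y z Ky Az eyz; rewrite !inE => /orP[Kz|->]; last by rewrite ?orbT.
    have [//|nzx] := eqVneq z x; first by rewrite orbT.
    have := clM y z My; rewrite !inE nzx Kz => /(_ isT eyz)/orP[]->; rewrite ?orbT //.
have cP : #|(P :\ K) :|: L'| = #|P|.-1 + #|L'|.
  rewrite cardsU (_ : (P :\ K) :&: L' = set0) ?cards0 ?subn0.
    by rewrite (cardsD1 K P) PK.
  apply/setP=> M; rewrite !inE; apply/negP=> /andP[/andP[nM PM] LM].
  have [_ oM _] := bL M LM; have /card_gt0P[y My] : 0 < #|M| by case: #|M| oM.
  have [Ky _ _] := LK M y LM My.
  by have := disjointFr (dKP M PM nM) Ky; rewrite My.
have cQ : #|x |: (P1 :|: Q)| = (#|P1| + #|Q|).+1.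
  have nx : x \notin P1 :|: Q.
    rewrite inE negb_or; have /andP[_ ->] := KQ x Kx; rewrite andbT.
    by apply/negP=> /P1Kx/andP[_]; rewrite eqxx.
  rewrite cardsU1 nx cardsU (_ : P1 :&: Q = set0) ?cards0 ?subn0 //.
  apply/setP=> y; rewrite !inE; apply/negP=> /andP[/P1Kx/andP[/KQ/andP[_ /negP nQ] _]] //.
have P0 : 0 < #|P| by apply/card_gt0P; exists K.
have := maxQ' _ _ b3; rewrite cP cQ; rewrite cPQ in P0 *.
have -> : #|P1| + #|Q| < #|Q|.-1 + #|L'|.
  by move: P0 leL'; move: #|P1| #|Q| #|L'| => a b c; clear; lia.
by move/(_ isT); clear; lia.
Qed.

(** In a maximal barrier, Hall's condition for a subfamily of cells is Tutte's condition for the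
    barrier of their neighbours in Q; the cells minus one vertex are matched by induction. *)
Lemma tutteP A : tutte A -> matchable A.
Proof.
have [n] := ubnP #|A|; elim: n => // n IHn in A *; rewrite ltnS => leAn tA.
have [Q [P [bP cPQ cov _ fcK]]] := maximal_barrier tA.
have [A0|/set0Pn[a Aa]] := eqVneq A set0.
  by exists id => x; rewrite A0 inE.
have /barrierP[QA tP bK] := bP.
pose N (K : {set T}) := [set y in Q | [exists x in K, e x y]].
have [q injq qN] : exists2 q : {set T} -> T, {in P &, injective q} &
    {in P, forall K, q K \in N K}.
  apply: (hall a) => B BP.
  apply: tA; apply/barrierP; split.
  - apply/bigcupsP=> K _; apply: subset_trans QA; apply/subsetP=> y.
    by rewrite inE => /andP[].
  - exact: trivIsetS BP tP.
  - move=> K BK; have PK := subsetP BP K BK; have [KA oK cl] := bK K PK.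
    split=> //.
      apply/subsetP=> x Kx; have := subsetP KA x Kx; rewrite !inE => /andP[nQ ->].
      rewrite andbT; apply: contra nQ => /bigcupP[L _]; by rewrite inE => /andP[].
    move=> x y Kx Ay exy; have := cl x y Kx Ay exy; rewrite !inE => /orP[->//|Qy].
    apply/orP; right; apply/bigcupP; exists K => //; rewrite inE Qy.
    by apply/existsP; exists x; rewrite Kx.
have qx K : exists x, K \in P -> [/\ x \in K, e x (q K) & q K \in Q].
  have [PK|nPK] := boolP (K \in P); last by exists a.
  have := qN K PK; rewrite inE => /andP[Qq /existsP[x /andP[Kx ex]]].
  by exists x.
have [x xP] := fin_all_exists qx.
have [|||m mP _] := matchable_cover tP cov QA _ injq _ (x := x).
- move=> K PK; have [Kx _ _] := xP K PK; split=> //.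
  apply: IHn; last exact: fcK.
  apply: leq_trans leAn; apply: proper_card.
  rewrite properE; apply/andP; split.
    apply/subsetP=> y; rewrite !inE => /andP[_ Ky].
    by have [/subsetP/(_ y Ky)] := bK K PK; rewrite inE => /andP[].
  apply/subsetPn; exists (x K); rewrite ?inE ?eqxx //.
  by have [/subsetP/(_ _ Kx)] := bK K PK; rewrite inE => /andP[].
- apply/eqP; rewrite eqEcard card_in_imset // cPQ leqnn andbT.
  by apply/subsetP=> _ /imsetP[K PK ->]; have [] := xP K PK.
- by move=> K PK; have [] := xP K PK.
by exists m.
Qed.

Hypothesis e_irr : irreflexive e.

Lemma matching_even A m : matching A m -> ~~ odd #|A|.
Proof.
have [n] := ubnP #|A|; elim: n => // n IHn in A *; rewrite ltnS => leAn mA.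
have [->|/set0Pn[x Ax]] := eqVneq A set0; first by rewrite cards0.
have [Amx mx ex] := mA x Ax; have nx : m x != x.
  by apply: contraTneq ex => ->; rewrite e_irr.
have Amx' : m x \in A :\ x by rewrite !inE nx.
rewrite (cardsD1 x) Ax (cardsD1 (m x)) Amx' /= negbK; apply: IHn.
  by move: leAn; rewrite (cardsD1 x) Ax (cardsD1 (m x)) Amx' /=; lia.
move=> y; rewrite !inE => /and3P[ymx yx Ay]; have [Amy my ey] := mA y Ay.
split=> //; rewrite Amy andbT; apply/andP; split.
  by apply: contra yx => /eqP; rewrite -mx -{2}my => /(congr1 m); rewrite my !mx => ->.
by apply: contra ymx => /eqP <-; rewrite my.
Qed.

(** An odd cell cannot be matched within itself. *)
Lemma barrier_exit A Q P m K : barrier A Q P -> matching A m -> K \in P ->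
  exists2 x, x \in K & m x \in Q.
Proof.
move=> /barrierP[QA tP bK] mA PK; have [KA oK cl] := bK K PK.
have [/exists_inP[x Kx Qx]|/exists_inPn nQ] := boolP [exists x in K, m x \in Q].
  by exists x.
have := oK; rewrite (negPf (@matching_even K m _)) // => x Kx.
have Ax : x \in A by have := subsetP KA x Kx; rewrite inE => /andP[].
have [Am mm em] := mA x Ax; split=> //.
by have := cl x (m x) Kx Am em; rewrite inE (negPf (nQ x Kx)) orbF.
Qed.

Lemma matchable_tutte A : matchable A -> tutte A.
Proof.
move=> [m mA] Q P bP; have /barrierP[QA tP bK] := bP.
have [->|/set0Pn[K0 PK0]] := eqVneq P set0; first by rewrite cards0.
have [t0 _ _] := barrier_exit bP mA PK0.
have [x xP] : exists x : {set T} -> T, forall K, K \in P -> x K \in K /\ m (x K) \in Q.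
  apply: (fin_all_exists (P := fun K x => K \in P -> x \in K /\ m x \in Q)) => K.
  have [PK|nPK] := boolP (K \in P); last by exists t0.
  by have [x Kx Qx] := barrier_exit bP mA PK; exists x.
have inA K y : K \in P -> y \in K -> y \in A.
  by move=> PK Ky; have [/subsetP/(_ y Ky)] := bK K PK; rewrite inE => /andP[].
rewrite -(card_in_imset (f := fun K => m (x K)) (D := mem P)).
  by apply/subset_leq_card/subsetP=> _ /imsetP[K PK ->]; have [] := xP K PK.
move=> K L PK PL /= eqm; have [xK _] := xP K PK; have [xL _] := xP L PL.
have [_ mK _] := mA _ (inA _ _ PK xK); have [_ mL _] := mA _ (inA _ _ PL xL).
have exx : x K = x L by rewrite -mK eqm mL.
by rewrite -(def_pblock tP PK xK) exx (def_pblock tP PL xL).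
Qed.

(* If every cell of a maximal barrier had a second edge to the barrier, following these edges would close up into an alternating cycle on the cells. *)
Lemma unique_matching_bridge A m : A != set0 -> matching A m ->
  (forall m', matching A m' -> {in A, m' =1 m}) ->
  exists K u, [/\ K \subset A, odd #|K|, u \in K, m u \in A :\: K &
    forall x y, x \in K -> y \in A :\: K -> e x y -> x = u /\ y = m u].
Proof.
move=> A0 mA mU; have tA : tutte A by apply: matchable_tutte; exists m.
have [Q [P [bP cPQ cov Q0 fcK]]] := maximal_barrier tA.
have {A0} /set0Pn[q0 Qq0] := Q0 A0; have /barrierP[QA tP bK] := bP.
have inA K y : K \in P -> y \in K -> (y \in A) && (y \notin Q).
  by move=> PK Ky; have [/subsetP/(_ y Ky)] := bK K PK; rewrite inE andbC.
have [x xP] : exists x : {set T} -> T, forall K, K \in P -> x K \in K /\ m (x K) \in Q.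
  apply: (fin_all_exists (P := fun K x => K \in P -> x \in K /\ m x \in Q)) => K.
  have [PK|nPK] := boolP (K \in P); last by exists q0.
  by have [y Ky Qy] := barrier_exit bP mA PK; exists y.
have injmx : {in P &, injective (fun K => m (x K))}.
  move=> K L PK PL /= eqm; have [xK _] := xP K PK; have [xL _] := xP L PL.
  have /andP[AK _] := inA _ _ PK xK; have /andP[AL _] := inA _ _ PL xL.
  have [_ mK _] := mA _ AK; have [_ mL _] := mA _ AL.
  have exx : x K = x L by rewrite -mK eqm mL.
  by rewrite -(def_pblock tP PK xK) exx (def_pblock tP PL xL).
have immx : [set m (x K) | K in P] = Q.
  apply/eqP; rewrite eqEcard card_in_imset // cPQ leqnn andbT.
  by apply/subsetP=> _ /imsetP[K PK ->]; have [] := xP K PK.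
have [/exists_inP[K PK /forall_inP brK]|nbr] := boolP [exists K in P,
    [forall y in K, forall z in A :\: K, e y z ==> (y == x K) && (z == m (x K))]].
  have [xK Qm] := xP K PK; have [KA oK cl] := bK K PK; exists K, (x K); split=> //.
  - by apply: subset_trans KA (subsetDl _ _).
  - rewrite inE (subsetP QA) // andbT; apply/negP=> mxK.
    by have /andP[_] := inA K _ PK mxK; rewrite Qm.
  - move=> y z Ky AKz eyz; have /forall_inP/(_ z AKz) := brK y Ky.
    by rewrite eyz => /andP[/eqP-> /eqP->].
(* The pair [(y, L)] records an edge from K to the partner of the cell L, other than the matching
   edge of K. If L is K itself, then y differs from [x K], so even a fixed point of [g] changes the
   matching. *)
have {nbr} alt K : exists yL : T * {set T}, K \in P ->
    [/\ yL.1 \in K, yL.2 \in P, e yL.1 (m (x yL.2)) & ~~ ((yL.1 == x K) && (yL.2 == K))].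
  have [PK|nPK] := boolP (K \in P); last by exists (q0, K).
  move: nbr; rewrite negb_exists => /forallP/(_ K); rewrite PK /=.
  rewrite negb_forall => /existsP[y]; rewrite negb_imply => /andP[Ky].
  rewrite negb_forall => /existsP[z]; rewrite negb_imply => /andP[].
  rewrite inE => /andP[nKz Az]; rewrite negb_imply => /andP[eyz neq].
  have [_ _ cl] := bK K PK; have := cl y z Ky Az eyz; rewrite inE (negPf nKz) /=.
  rewrite -immx => /imsetP[L PL zL]; exists (y, L) => _; split=> //=; first by rewrite -zL.
  by apply: contra neq => /andP[-> /eqP <-]; rewrite zL eqxx.
have [yL yLP] := fin_all_exists alt; pose g K := (yL K).2.
have gP K : K \in P -> g K \in P by move=> PK; have [] := yLP K PK.
have [K0 PK0] : exists K, K \in P by move: Qq0; rewrite -immx => /imsetP[K PK _]; exists K.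
have iterP n K : K \in P -> iter n g K \in P by move=> PK; elim: n => //= n; apply: gP.
(* Iterating [g] ends in a cycle, on which [g] is injective. *)
have [C0 [p [p0 PC0 pC0]]] : exists C0 p, [/\ 0 < p, C0 \in P & iter p g C0 = C0].
  have := looping_order g K0; rewrite /looping => /trajectP[i lti eqi].
  exists (iter i g K0), (fingraph.order g K0 - i); split; [lia | exact: iterP|].
  by rewrite -iterD subnK 1?ltnW.
pose C := [set K | fconnect g C0 K].
have Cg K : K \in C -> g K \in C.
  by rewrite !inE => c; apply: connect_trans c (fconnect1 _ _).
have pC K : K \in C -> iter p g K = K.
  rewrite inE => /iter_findex <-.
  by rewrite -iterD addnC iterD pC0.
have ginj : {in C &, injective g}.
  move=> K L CK CL eqg; rewrite -(pC K) // -(pC L) // -(prednK p0) !iterSr.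
  by rewrite eqg.
(* Along the cycle each cell takes the partner of its successor by its second edge; all other cells
   keep their own. *)
pose h K := if K \in C then g K else K.
pose y K := if K \in C then (yL K).1 else x K.
have hinj : {in P &, injective h}.
  move=> K L PK PL; rewrite /h; case: ifPn => CK; case: ifPn => CL //.
  - exact: ginj.
  - by move=> eqh; rewrite -eqh Cg in CL.
  - by move=> eqh; rewrite eqh Cg in CK.
have hP K : K \in P -> h K \in P by rewrite /h; case: ifP => // _; apply: gP.
have yK K : K \in P -> y K \in K.
  by move=> PK; rewrite /y; case: ifP => _; [have [] := yLP K PK | have [] := xP K PK].
have [||||m' m'A m'y] := matchable_cover (x := y) (q := fun K => m (x (h K))) tP cov QA.
- by move=> K PK; split; [exact: yK | apply/tutteP/fcK => //; exact: yK].
- by move=> K L PK PL /= /injmx; move=> /(_ (hP _ PK) (hP _ PL)); apply: hinj.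
- apply/eqP; rewrite eqEcard; apply/andP; split.
    by apply/subsetP=> _ /imsetP[K PK ->]; have [] := xP (h K) (hP K PK).
  rewrite card_in_imset ?cPQ // => K L PK PL /= /injmx.
  by move=> /(_ (hP _ PK) (hP _ PL)); apply: hinj.
- move=> K PK; rewrite /y /h; case: ifP => _; first by have [] := yLP K PK.
  have [xK _] := xP K PK; have /andP[Ax _] := inA K _ PK xK.
  by have [] := mA _ Ax.
have CC0 : C0 \in C by rewrite inE connect0.
have := m'y C0 PC0; have /andP[Ay nQy] := inA C0 _ PC0 (yK C0 PC0).
rewrite (mU m' m'A) // => eqm; have [_ myy _] := mA _ Ay.
have [xL Qm] := xP (h C0) (hP C0 PC0).
have /andP[AxL _] := inA _ _ (hP C0 PC0) xL; have [_ mxL _] := mA _ AxL.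
have eyx : y C0 = x (h C0) by rewrite -myy eqm mxL.
have ehC : h C0 = C0.
  rewrite -(def_pblock tP (hP C0 PC0) xL) -eyx.
  by rewrite (def_pblock tP PC0) // yK.
have [_ _ _] := yLP C0 PC0.
by move: eyx ehC; rewrite /y /h CC0 /g => -> ->; rewrite !eqxx.
Qed.

End Matching.

(** * Tracing faces around two adjacent pentagons *)

(* F24 around each vertex: (i, j, k, l) lists the neighbours j, k, l of i in cyclic order. *)
Definition F24_rotation : seq (nat * nat * nat * nat) :=
  [:: (0, 1, 6, 5); (1, 8, 0, 2); (2, 1, 3, 10); (3, 2, 4, 12); (4, 5, 14, 3);
      (5, 16, 4, 0); (6, 0, 7, 17); (7, 6, 8, 18); (8, 7, 1, 9); (9, 19, 8, 10);
      (10, 9, 2, 11); (11, 20, 10, 12); (12, 3, 13, 11); (13, 14, 21, 12);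
      (14, 4, 15, 13); (15, 14, 16, 22); (16, 15, 5, 17); (17, 16, 6, 23);
      (18, 23, 7, 19); (19, 18, 9, 20); (20, 19, 11, 21); (21, 13, 22, 20);
      (22, 15, 23, 21); (23, 17, 18, 22)].

Lemma F24_rotationP (i : 'I_24) : exists j k l : 'I_24,
  [/\ (i : nat, j : nat, k : nat, l : nat) \in F24_rotation, uniq [:: j; k; l] &
      forall x : 'I_24, F24_adj i x = (x \in [:: j; k; l])].
Proof.
have : all (fun i => has (fun t : nat * nat * nat * nat => let: (i', j, k, l) := t in
    [&& (i' == i) && uniq [:: j; k; l], j < 24, k < 24, l < 24 & all (fun x =>
      ((i, x) \in F24_edges) || ((x, i) \in F24_edges) == (x \in [:: j; k; l])) (iota 0 24)])
    F24_rotation) (iota 0 24) by vm_compute.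
move=> /allP/(_ i); rewrite mem_iota ltn_ord => /(_ isT)/hasP[[[[i' j] k] l] tI].
case/and5P=> /andP[/eqP ei ujkl] lj lk ll /allP aP; exists (Ordinal lj), (Ordinal lk), (Ordinal ll).
split=> [||x]; first by rewrite -ei.
  by rewrite -(map_inj_uniq val_inj).
by rewrite -(mem_map val_inj); apply/eqP/(aP x); rewrite mem_iota ltn_ord.
Qed.

(* [crn x y z] reads: a face boundary runs through x, y and z, in this direction. *)
Section Tracing.
Variables (V : Type) (crn : V -> V -> V -> Prop) (I : V -> Prop).

(** The rules up to [crn_triangle] hold in every fullerene: a face continues uniquely both ways, the
    three corners at a vertex fit together cyclically, and a face closes after five or six steps. *)
Hypothesis crn_fun : forall x y z z', crn x y z -> crn x y z' -> z = z'.
Hypothesis crn_inj : forall x x' y z, crn x y z -> crn x' y z -> x = x'.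
Hypothesis crn_third : forall x y z t, crn x y z -> crn t y x -> crn z y t.
Hypothesis crn_irr : forall x y, ~ crn x x y.
Hypothesis crn_next : forall x y z, crn x y z -> exists s, crn y z s.
Hypothesis crn_rot : forall x y z, crn x y z -> exists t, crn z y t /\ crn t y x.
Hypothesis crn_back : forall x y, ~ crn x y x.
Hypothesis crn_face : forall x y z s t, crn x y z -> crn y z s -> crn z s t ->
  crn s t x /\ crn t x y \/ exists w, [/\ crn s t w, crn t w x & crn w x y].
Hypothesis crn_triangle : forall x y z, crn x y z -> crn y z x -> crn z x y -> False.
Hypothesis I_indep : forall x y z, I y -> I z -> crn x y z -> False.
(** Neighbours of I lie in a set in which every vertex has at most one neighbour, so three of them
    never follow each other along a face. *)
Hypothesis Q_match : forall x y z i j k c c' c'', I i -> I j -> I k ->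
  crn c i x -> crn c' j y -> crn c'' k z -> crn x y z -> False.

(** Passing between the same two neighbours in both directions would leave no room for the third
    neighbour of y. *)
Let crn_conf x y z : crn x y z -> crn z y x -> False.
Proof.
move=> h1 h2; have [t [h3 h4]] := crn_rot h1.
by have e := crn_fun h2 h3; rewrite e in h4; case: (crn_back h4) => //.
Qed.

Let crn_irr2 x y : ~ crn x y y.
Proof. by case/crn_next=> t /crn_irr. Qed.

(** The face beyond the side x x' of a pentagon, entered through the outer neighbours r and r'. Its
    fifth vertex is asked to be in I, where independence can be exploited. *)
Definition face5 x r r' x' := exists i, [/\ I i, crn x r i, crn r i r' & crn i r' x'].
Definition face6 x r r' x' :=
  exists p p', [/\ crn x r p, crn r p p', crn p p' r' & crn p' r' x'].

(** Two corners at each vertex determine the third. [g] may identify vertices; its injectivity is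
    left to a counting argument. *)
Definition F24_traced :=
  exists g : nat -> V, forall i j k l, (i, j, k, l) \in F24_rotation ->
    crn (g j) (g i) (g k) /\ crn (g k) (g i) (g l).

Section TwoPentagons.
Variables u a1 a2 a3 a4 r1 r2 r3 r4 v b1 b2 b3 b4 s1 s2 s3 s4 : V.

(* Two facial pentagons u a1 a2 a3 a4 and v b4 b3 b2 b1 joined by the edge uv; the other neighbours of the a_i and b_i are r_i and s_i. *)
Definition two_pentagons :=
  [/\ crn a4 u a1 /\ crn a1 u v, crn b1 v b4 /\ crn b4 v u,
     [/\ crn u a1 a2, crn a1 a2 a3, crn a2 a3 a4 & crn a3 a4 u],
     [/\ crn a2 a1 r1, crn a3 a2 r2, crn a4 a3 r3 & crn u a4 r4] &
     [/\ crn v b4 b3, crn b4 b3 b2, crn b3 b2 b1 & crn b2 b1 v] /\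
     [/\ crn v b1 s1, crn b1 b2 s2, crn b2 b3 s3 & crn b3 b4 s4]].

Hypothesis config : two_pentagons.


(* The two faces along uv, as pentagons and as hexagons. *)
Definition side1_5 := r1 = s1 /\ crn b1 r1 a1.
Definition side1_6 := crn b1 s1 r1 /\ crn s1 r1 a1.
Definition side2_5 := r4 = s4 /\ crn a4 r4 b4.
Definition side2_6 := crn a4 r4 s4 /\ crn r4 s4 b4.

(** When the face along uv is a pentagon, [r1 = s1] has only one further neighbour, which the two
    adjacent faces must share. *)
Let join1 i j : r1 = s1 -> crn b1 r1 a1 -> crn a1 r1 i -> crn j s1 b1 -> j = i.
Proof. by move=> <- h1 h2 h3; apply: crn_fun (crn_third h1 h3) h2. Qed.

Let join4 i j : r4 = s4 -> crn a4 r4 b4 -> crn i r4 a4 -> crn b4 s4 j -> j = i.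
Proof. by move=> <- h1 h2 h3; have h4 := crn_third h1 h2; apply: crn_fun h3 h4. Qed.

(** The two remaining faces through [i23] and [j23] are not pentagons, since I is independent; as
    hexagons they share a vertex [w], which they would traverse in opposite directions. *)
Lemma no_hexagon : side1_5 -> side2_5 ->
  face5 a1 r1 r2 a2 -> face5 a2 r2 r3 a3 -> face5 a3 r3 r4 a4 ->
  face5 b2 s2 s1 b1 -> face5 b3 s3 s2 b2 -> face5 b4 s4 s3 b3 -> False.
Proof.
move=> [e1 h1] [e4 h4] [z [Iz z1 z2 z3]] [i23 [Ii i1 i2 i3]] [z' [Iz' z1' z2' z3']].
move=> [j12 [_ k1 k2 k3]] [j23 [Ij j1 j2 j3]] [j34 [_ l1 l2 l3]].
have := join1 e1 h1 z1 k3 => ez; rewrite {}ez -e1 in k1 k2 k3.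
have := join4 e4 h4 z3' l1 => ez; rewrite {}ez -e4 in l1 l2 l3.
have zr := crn_third z2 k2; have zr' := crn_third l2 z2'.
have r2z := crn_third i1 z3; have r3z := crn_third z1' i3.
have s2z := crn_third k1 j3; have s3z := crn_third j1 l3.
have [w [w1 w2]] := crn_rot i2; have [w' [w1' w2']] := crn_rot j2.
have [[p _]|[w'' [_ x2 /(crn_inj w2) ew]]] := crn_face r2z zr s2z.
  exact: I_indep p.
have [[p _]|[w3 [/(crn_fun w1) ew3 y2 _]]] := crn_face s3z zr' r3z.
  exact: I_indep p.
by rewrite -ew in x2; rewrite -ew3 in y2; apply: crn_conf x2 y2.
Qed.

(** Now [p] separates [z] from [r2]. The far face through [i23] and [j23] is again a hexagon through
    [w], and the two remaining faces at [p] cannot both close. *)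
Lemma hexagon12 : side1_5 -> side2_5 ->
  face6 a1 r1 r2 a2 -> face5 a2 r2 r3 a3 -> face5 a3 r3 r4 a4 ->
  face5 b2 s2 s1 b1 -> face5 b3 s3 s2 b2 -> face5 b4 s4 s3 b3 -> False.
Proof.
move=> [e1 h1] [e4 h4] [z [p [z1 z2 z3 z4]]] [i23 [Ii i1 i2 i3]] [z' [Iz' z1' z2' z3']].
move=> [j12 [_ k1 k2 k3]] [j23 [Ij j1 j2 j3]] [j34 [_ l1 l2 l3]].
have := join1 e1 h1 z1 k3 => ez; rewrite {}ez -e1 in k1 k2 k3.
have := join4 e4 h4 z3' l1 => ez; rewrite {}ez -e4 in l1 l2 l3.
have zp := crn_third z2 k2; have r2p := crn_third i1 z4; have s2z := crn_third k1 j3.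
have r3z := crn_third z1' i3; have s3z := crn_third j1 l3; have zr' := crn_third l2 z2'.
have [w [w1 w2]] := crn_rot i2.
have [[p5 _]|[w' [/(crn_fun w1) <- y2 y3]]] := crn_face s3z zr' r3z.
  exact: I_indep p5.
have [w3 [x1 x2]] := crn_rot y2; have jw := crn_third j2 y3.
have [t3 [p1 p2]] := crn_rot z3; have [t p3] := crn_next p1.
have F2 : t = w \/ t = w3 /\ crn t3 t w.
  have [[_ /(crn_inj w2) ->]|[w4 [q1 q2 /(crn_inj w2) e]]] := crn_face r2p p1 p3; first by left.
  by right; rewrite -e in q1 q2; rewrite (crn_inj x2 q2).
have [[/(crn_fun x1) ep q]|[w4 [/(crn_fun x1) <- q1 q2]]] := crn_face zp s2z jw.
  have et := crn_inj p2 q; case: F2 => [e|[e _]].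
    by rewrite e et in p3; apply: (crn_irr2 p3).
  by rewrite e ep in p3; apply: crn_back p3.
have et := crn_inj p2 q2; case: F2 => [e|[e _]].
  by rewrite e et in p3; apply: crn_conf p3 q1.
by rewrite e et in p3; apply: crn_irr2 p3.
Qed.

(** Mirror image of [hexagon12], argued afresh because corners are oriented and reflection reverses
    them. *)
Lemma hexagon34 : side1_5 -> side2_5 ->
  face5 a1 r1 r2 a2 -> face5 a2 r2 r3 a3 -> face6 a3 r3 r4 a4 ->
  face5 b2 s2 s1 b1 -> face5 b3 s3 s2 b2 -> face5 b4 s4 s3 b3 -> False.
Proof.
move=> [e1 h1] [e4 h4] [z [_ z1 z2 z3]] [i23 [Ii i1 i2 i3]] [p [z' [z1' z2' z3' z4']]].
move=> [j12 [_ k1 k2 k3]] [j23 [Ij j1 j2 j3]] [j34 [_ l1 l2 l3]].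
have := join1 e1 h1 z1 k3 => ez; rewrite {}ez -e1 in k1 k2 k3.
have := join4 e4 h4 z4' l1 => ez; rewrite {}ez -e4 in l1 l2 l3.
have zp := crn_third l2 z3'; have [t3 [p1 p2]] := crn_rot z2'.
have r3p := crn_third z1' i3; have s3z := crn_third j1 l3; have r2z := crn_third i1 z3.
have zr := crn_third z2 k2; have s2z := crn_third k1 j3; have [w [w1 w2]] := crn_rot i2.
have [[p5 _]|[w' [x1 x2 /(crn_inj w2) e]]] := crn_face r2z zr s2z; first exact: I_indep p5.
rewrite -{w'}e in x1 x2; have [w3 [x3 x4]] := crn_rot x2.
have [w' [/(crn_fun x1) <- jw]] := crn_rot j2.
have [[/(crn_fun p1) et q]|[w4 [/(crn_fun p1) et q1 q2]]] := crn_face jw s3z zp.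
  have ep := crn_inj x4 q.
  have [[f1 _]|[w5 [f1 f2 /(crn_inj p2) e5]]] := crn_face r3p w1 x3.
    by rewrite -ep in f1; apply: crn_irr2 f1.
  by rewrite -e5 et in f1; apply: crn_back f1.
have e3 := crn_inj x4 q2; rewrite -e3 in q1.
have [[f1 _]|[w5 [f1 f2 /(crn_inj p2) e5]]] := crn_face r3p w1 x3.
  exact: crn_conf f1 q1.
by rewrite -e5 et -e3 in f1; apply: crn_irr2 f1.
Qed.

(** The third neighbour of [j23] is equal or adjacent to each of [p] and [p']; adjacency to both
    would close a facial triangle. *)
Lemma hexagon23 : side1_5 -> side2_5 ->
  face5 a1 r1 r2 a2 -> face6 a2 r2 r3 a3 -> face5 a3 r3 r4 a4 ->
  face5 b2 s2 s1 b1 -> face5 b3 s3 s2 b2 -> face5 b4 s4 s3 b3 -> False.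
Proof.
move=> [e1 h1] [e4 h4] [z [_ z1 z2 z3]] [p [p' [i1 i2 i3 i4]]] [z' [_ z1' z2' z3']].
move=> [j12 [_ k1 k2 k3]] [j23 [Ij j1 j2 j3]] [j34 [_ l1 l2 l3]].
have := join1 e1 h1 z1 k3 => ez; rewrite {}ez -e1 in k1 k2 k3.
have := join4 e4 h4 z3' l1 => ez; rewrite {}ez -e4 in l1 l2 l3.
have r2p := crn_third i1 z3; have r3p := crn_third z1' i4.
have zr := crn_third z2 k2; have s2z := crn_third k1 j3; have s3z := crn_third j1 l3.
have zr' := crn_third l2 z2'; have [q0 [q1 q2]] := crn_rot j2.
have [[/(crn_fun q1) e f1]|[q [/(crn_fun q1) e f1 f2]]] := crn_face r2p zr s2z;
  have [[f3 /(crn_inj q2) e']|[q' [f3 f4 /(crn_inj q2) e']]] := crn_face s3z zr' r3p.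
- by rewrite -e -e' in i2; apply: crn_irr2 i2.
- by rewrite -e' e in f3; apply: crn_conf i3 f3.
- by rewrite -e e' in f1 f2; apply: crn_conf i2 f2.
rewrite -e in f1 f2; rewrite -e' in f3 f4.
exact: crn_triangle (crn_third i2 f2) (crn_third f1 f4) (crn_third f3 i3).
Qed.

(** The position that survives: the hexagon along uv becomes one of the two hexagons of F24. *)
Lemma hexagon_side2 : side1_5 -> side2_6 ->
  face5 a1 r1 r2 a2 -> face5 a2 r2 r3 a3 -> face5 a3 r3 r4 a4 ->
  face5 b2 s2 s1 b1 -> face5 b3 s3 s2 b2 -> face5 b4 s4 s3 b3 -> F24_traced.
Proof.
move=> [e1 h1] [g1 g2] [z [_ z1 z2 z3]] [i23 [Ii i1 i2 i3]] [i34 [In n1 n2 n3]].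
move=> [j12 [_ k1 k2 k3]] [j23 [Ij j1 j2 j3]] [j34 [Il l1 l2 l3]].
have := join1 e1 h1 z1 k3 => ez; rewrite {}ez -e1 in k1 k2 k3.
have r4i := crn_third g1 n3; have s4j := crn_third l1 g2; have r3i := crn_third n1 i3.
have s3j := crn_third j1 l3; have r2z := crn_third i1 z3.
have zr := crn_third z2 k2; have s2z := crn_third k1 j3; have [w [w1 w2]] := crn_rot i2.
have [y [y1 y2]] := crn_rot n2; have [t [t1 t2]] := crn_rot l2.
have [[p5 _]|[w' [x1 x2 /(crn_inj w2) e]]] := crn_face r2z zr s2z; first by case: (I_indep Ij Ii p5).
rewrite -{w'}e in x1 x2; have [w3 [x3 x4]] := crn_rot x2.
have [w' [/(crn_fun x1) <- jw]] := crn_rot j2.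
(* [F1] and [F2] each distinguish whether a further face is a pentagon or a hexagon. Here [w3], [y]
   and [t] are the third neighbours of [w], [i34] and [j34]. *)
have F1 : w3 = y \/ crn w w3 y /\ crn w3 y i34.
  have [[_ /(crn_inj y2) e]|[w5 [f1 f2 /(crn_inj y2) e]]] := crn_face r3i w1 x3; first by left.
  by right; rewrite e.
have F2 : (t = w3 /\ crn j34 t w) \/ crn j34 t w3 /\ crn t w3 w.
  have [[f1 /(crn_inj x4) e]|[w5 [f1 f2 /(crn_inj x4) e]]] := crn_face jw s3j t1; first by left.
  by right; rewrite e.
have [[f1 /(crn_inj t2) e]|[w5 [f1 f2 /(crn_inj t2) e]]] := crn_face s4j r4i y1.
  rewrite {}e in F2 t1 t2; case: F1 => [e|[f3 f4]].
    rewrite {}e in x3 x4 F2; case: F2 => [[_ f2]|[f2 _]]; last by case: (crn_irr2 f2).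
    have [[u1 u2] [v1 v2] [A1 A2 A3 A4] [E1 E2 E3 E4] [[B4 B3 B2 B1] [D1 D2 D3 D4]]] := config.
    rewrite -e1 in D1; have [t' [/(crn_fun f2) <- yw]] := crn_rot f1.
    (* Labels 0 to 5 go around the hexagon along uv, 6 to 17 around the 12-cycle, 18 to 23 around
       the opposite hexagon. *)
    exists (nth u [:: u; a4; r4; s4; b4; v; a1; a2; a3; r3; i34; y;
                      j34; s3; b3; b2; b1; r1; r2; i23; w; j23; s2; z]).
    move=> i j k l; rewrite !inE.
    by do ?[case/orP]; move=> /eqP[-> -> -> ->].
  case: F2 => [[e _]|[_ f2]]; last by case: (crn_conf f3 f2).
  by rewrite -e in f3; case: (crn_irr2 f3).
rewrite -{w5}e in f1 f2; case: F1 => [e|[f3 f4]].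
  rewrite {}e in F2; case: F2 => [[e _]|[f3 _]]; last by case: (crn_conf f2 f3).
  by rewrite e in f1; case: (crn_irr2 f1).
case: F2 => [[e _]|[f5 f6]].
  (* The consecutive vertices [w], [w3], [y] would be neighbours of [i23], [j34] and [i34]. *)
  by rewrite -e in f3; case: (Q_match Ii Il In w1 t1 y1 f3).
by case: (crn_triangle (crn_third f1 f4) (crn_third f3 f6) (crn_third f5 f2)).
Qed.

End TwoPentagons.
(** The half-turn about uv preserves orientation and halves the cases. *)
Lemma two_pentagons_sym u a1 a2 a3 a4 r1 r2 r3 r4 v b1 b2 b3 b4 s1 s2 s3 s4 :
  two_pentagons u a1 a2 a3 a4 r1 r2 r3 r4 v b1 b2 b3 b4 s1 s2 s3 s4 ->
  two_pentagons v b4 b3 b2 b1 s4 s3 s2 s1 u a4 a3 a2 a1 r4 r3 r2 r1.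
Proof.
case=> [[u1 u2] [v1 v2] [A1 A2 A3 A4] [E1 E2 E3 E4] [[B4 B3 B2 B1] [F1 F2 F3 F4]]].
have u3 := crn_third u2 u1; have v3 := crn_third v2 v1.
by split=> //; split.
Qed.

(** Indices 0 and 1 are the faces along uv, 2 to 4 those beyond sides of the first pentagon, 5 to 7
    those beyond sides of the second. *)
Lemma at_most_one_hexagon (hex : nat -> bool) u a1 a2 a3 a4 r1 r2 r3 r4 v b1 b2 b3 b4 s1 s2 s3 s4 :
  two_pentagons u a1 a2 a3 a4 r1 r2 r3 r4 v b1 b2 b3 b4 s1 s2 s3 s4 ->
  (forall j k, j < 8 -> k < 8 -> hex j -> hex k -> j = k) ->
  (if hex 0 then side1_6 a1 r1 b1 s1 else side1_5 a1 r1 b1 s1) ->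
  (if hex 1 then side2_6 a4 r4 b4 s4 else side2_5 a4 r4 b4 s4) ->
  (if hex 2 then face6 a1 r1 r2 a2 else face5 a1 r1 r2 a2) ->
  (if hex 3 then face6 a2 r2 r3 a3 else face5 a2 r2 r3 a3) ->
  (if hex 4 then face6 a3 r3 r4 a4 else face5 a3 r3 r4 a4) ->
  (if hex 5 then face6 b2 s2 s1 b1 else face5 b2 s2 s1 b1) ->
  (if hex 6 then face6 b3 s3 s2 b2 else face5 b3 s3 s2 b2) ->
  (if hex 7 then face6 b4 s4 s3 b3 else face5 b4 s4 s3 b3) -> F24_traced.
Proof.
move=> cfg uhex; have cfg' := two_pentagons_sym cfg.
have none j k : hex j -> k < 8 -> (j < 8) && (k != j) -> hex k = false.
  by move=> hj k8 /andP[j8]; apply: contraNF => hk; apply/eqP/uhex.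
have flip1 : side1_5 a1 r1 b1 s1 -> side2_5 b1 s1 a1 r1 by case=> e h; split; rewrite -?e.
have flip2 : side2_5 a4 r4 b4 s4 -> side1_5 b4 s4 a4 r4 by case=> e h; split; rewrite -?e.
case e0: (hex 0).
  rewrite !(none 0 _ e0) // => h0 h1 h2 h3 h4 h5 h6 h7.
  exact: (hexagon_side2 cfg' (flip2 h1) h0 h7 h6 h5 h4 h3 h2).
case e1: (hex 1).
  by rewrite !(none 1 _ e1) // => h0 h1 h2 h3 h4 h5 h6 h7; apply: (hexagon_side2 cfg).
case e2: (hex 2).
  by rewrite !(none 2 _ e2) // => h0 h1 h2 h3 h4 h5 h6 h7; case: (hexagon12 h0 h1 h2 h3 h4 h5 h6 h7).
case e3: (hex 3).
  by rewrite !(none 3 _ e3) // => h0 h1 h2 h3 h4 h5 h6 h7; case: (hexagon23 h0 h1 h2 h3 h4 h5 h6 h7).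
case e4: (hex 4).
  by rewrite !(none 4 _ e4) // => h0 h1 h2 h3 h4 h5 h6 h7; case: (hexagon34 h0 h1 h2 h3 h4 h5 h6 h7).
case e5: (hex 5).
  rewrite !(none 5 _ e5) // => h0 h1 h2 h3 h4 h5 h6 h7.
  by case: (hexagon34 (flip2 h1) (flip1 h0) h7 h6 h5 h4 h3 h2).
case e6: (hex 6).
  rewrite !(none 6 _ e6) // => h0 h1 h2 h3 h4 h5 h6 h7.
  by case: (hexagon23 (flip2 h1) (flip1 h0) h7 h6 h5 h4 h3 h2).
case e7: (hex 7).
  move=> h0 h1 h2 h3 h4 h5 h6 h7.
  by case: (hexagon12 (flip2 h1) (flip1 h0) h7 h6 h5 h4 h3 h2).
by move=> h0 h1 h2 h3 h4 h5 h6 h7; case: (no_hexagon h0 h1 h2 h3 h4 h5 h6 h7).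
Qed.
End Tracing.

(** * Edge cuts *)

Section Cuts.
Variable G : sgraph.
Implicit Types (A B C : {set G}) (x y z : G).

(* Edges inside the intersection of A and B are counted twice. *)
Definition dn A B := \sum_(x in A) \sum_(y in B) (adj x y : nat).
Definition cut A := dn A (~: A).

Lemma dnC A B : dn A B = dn B A.
Proof.
rewrite /dn exchange_big; apply: eq_bigr => x _; apply: eq_bigr => y _.
by rewrite adj_sym.
Qed.

Lemma dnID A B C : dn A C = dn (A :&: B) C + dn (A :\: B) C.
Proof. by rewrite /dn (big_setID B). Qed.

Lemma dnUl A B C : [disjoint A & B] -> dn (A :|: B) C = dn A C + dn B C.
Proof.
move=> dAB; rewrite (dnID _ A) setUK; congr (_ + dn _ C).
by rewrite setDUl setDv set0U; apply/setDidPl; rewrite disjoint_sym.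
Qed.

Lemma dnDl A B C : B \subset A -> dn A C = dn B C + dn (A :\: B) C.
Proof. by move=> sBA; rewrite (dnID _ B) (setIidPr sBA). Qed.

Lemma dnUr A B C : [disjoint A & B] -> dn C (A :|: B) = dn C A + dn C B.
Proof. by move=> dAB; rewrite dnC dnUl // -!(dnC C). Qed.

Lemma dnDr A B C : B \subset A -> dn C A = dn C B + dn C (A :\: B).
Proof. by move=> sBA; rewrite dnC (dnDl _ sBA) -!(dnC C). Qed.

Lemma dn0l A : dn set0 A = 0.
Proof. by rewrite /dn big_set0. Qed.

Lemma dn11 x y : dn [set x] [set y] = adj x y.
Proof. by rewrite /dn !big_set1. Qed.

Lemma dn1E x A : dn [set x] A = #|[set y in A | adj x y]|.
Proof.
rewrite /dn big_set1 -sum1_card big_mkcond [RHS]big_mkcond /=.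
by apply: eq_bigr => y _; rewrite inE; case: (y \in A); case: adj.
Qed.

Lemma dn_sumr A B : dn A B = \sum_(x in A) dn [set x] B.
Proof. by apply: eq_bigr => x _; rewrite /dn big_set1. Qed.

Lemma dn_mono A B A' B' : A \subset A' -> B \subset B' -> dn A B <= dn A' B'.
Proof.
move=> sA sB; rewrite (dnDl B' sA) (leq_trans _ (leq_addr _ _)) //.
by rewrite (dnDr A sB) leq_addr.
Qed.

Lemma dn_eq0P A B :
  reflect (forall x y, x \in A -> y \in B -> ~~ adj x y) (dn A B == 0).
Proof.
rewrite sum_nat_eq0; apply: (iffP forall_inP) => [H x y Ax By|H x Ax].
  by have := H x Ax; rewrite sum_nat_eq0 => /forall_inP/(_ y By); case: adj.
by rewrite sum_nat_eq0; apply/forall_inP=> y By; rewrite (negPf (H x y Ax By)).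
Qed.

Lemma dn_gt0P A B :
  reflect (exists x y, [/\ x \in A, y \in B & adj x y]) (0 < dn A B).
Proof.
rewrite lt0n; apply: (iffP idP) => [|[x [y [Ax By axy]]]]; last first.
  by apply/negP=> /dn_eq0P/(_ x y Ax By); rewrite axy.
have [/exists_inP[x Ax /exists_inP[y By axy]] _|nE] :=
  boolP [exists x in A, [exists y in B, adj x y]]; first by exists x, y.
case/negP; apply/dn_eq0P=> x y Ax By; apply: contra nE => axy.
by apply/exists_inP; exists x => //; apply/exists_inP; exists y.
Qed.

Lemma dn_even A : ~~ odd (dn A A).
Proof.
have [n] := ubnP #|A|; elim: n => // n IHn in A *; rewrite ltnS => leAn.
have [->|/set0Pn[x Ax]] := eqVneq A set0; first by rewrite dn0l.
have sx : [set x] \subset A by rewrite sub1set.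
rewrite (dnDl _ sx) 2!(dnDr _ sx) dn11 adj_irr add0n (dnC _ [set x]) addnA !oddD addbb /=.
by apply: IHn; move: leAn; rewrite (cardsD1 x) Ax.
Qed.

Lemma cutC A : cut (~: A) = cut A.
Proof. by rewrite /cut setCK dnC. Qed.

Hypothesis cub : cubic G.

Lemma dnT A : dn A [set: G] = 3 * #|A|.
Proof.
rewrite dn_sumr mulnC -sum_nat_const; apply: eq_bigr => x _.
by rewrite dn1E -(cub x); congr #|pred_of_set _|; apply/setP=> y; rewrite !inE.
Qed.

Lemma cut_dn A : cut A + dn A A = 3 * #|A|.
Proof. by rewrite -dnT (dnDr A (subsetT A)) addnC setTD. Qed.

Lemma cut1 x : cut [set x] = 3.
Proof. by have := cut_dn [set x]; rewrite dn11 adj_irr cards1 addn0. Qed.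

Lemma cut_odd A : odd (cut A) = odd #|A|.
Proof.
have := congr1 odd (cut_dn A); rewrite oddD (negPf (dn_even A)) addbF => ->.
by rewrite oddM.
Qed.

Hypothesis conn : k_connected 3 G.

(** If at most two edges leave A, deleting one end of each disconnects the graph. Neither side is
    used up: a single vertex has three leaving edges, so both sides have at least two vertices. *)
Lemma cut_ge3 A : A != set0 -> A != setT -> 3 <= cut A.
Proof.
move=> A0 AT; rewrite leqNgt; apply/negP; rewrite ltnS => le2.
have [x0 Ax0] := set0Pn _ A0.
have n1 x : A != [set x] by apply: contraTneq le2 => ->; rewrite cut1.
have n1C x : ~: A != [set x].
  by apply: contraTneq le2 => eqA; rewrite -cutC eqA cut1.
pose E := [set p : G * G | [&& p.1 \in A, p.2 \notin A & adj p.1 p.2]].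
have cE : #|E| <= 2.
  apply: leq_trans le2; rewrite /cut /dn pair_big /= -sum1_card big_mkcond.
  rewrite [leqRHS]big_mkcond /=; apply: leq_sum => p _; rewrite !inE.
  by case: (_ \in A); case: (_ \in A); case: adj.
have AC0 : ~: A != set0 by apply: contra AT => /eqP eqC; rewrite -(setCK A) eqC setC0.
(* The edge p loses its end in A, any other leaving edge its end outside, so each side loses at most
   one vertex. *)
pose Z (p : G * G) := p.1 |: [set q.2 | q in E :\ p].
have [p [cZ AZ ACZ hit]] : exists p, [/\ #|Z p| < 3, A :\: Z p != set0,
    ~: A :\: Z p != set0 & {in E, forall q, (q.1 \in Z p) || (q.2 \in Z p)}].
  have [p [Ap1 leEp hit]] : exists p, [/\ p.1 \in A, #|E :\ p| <= 1 &
      {in E, forall q, q == p \/ q \in E :\ p}].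
    have [E0|/set0Pn[p Ep]] := eqVneq E set0.
      exists (x0, x0); split=> //; last by move=> q; rewrite E0 inE.
      by rewrite E0 set0D cards0.
    exists p; split; first by move: Ep; rewrite inE => /and3P[].
      by move: cE; rewrite (cardsD1 p) Ep.
    by move=> q Eq; have [|nqp] := eqVneq q p; [left|right; rewrite in_setD1 nqp].
  have im1 : #|[set q.2 | q in E :\ p]| <= 1 by apply: leq_trans (leq_imset_card _ _) leEp.
  have imC : [set q.2 | q in E :\ p] \subset ~: A.
    by apply/subsetP=> _ /imsetP[q /setD1P[_ Eq] ->]; move: Eq; rewrite !inE => /and3P[].
  exists p; split.
  - by rewrite cardsU1; case: (_ \notin _); rewrite ?add0n ?add1n ltnS // (leq_trans im1).
  - apply: contra (n1 p.1); rewrite setD_eq0 eqEsubset sub1set Ap1 andbT => sA.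
    apply/subsetP=> y Ay; have := subsetP sA y Ay; rewrite !inE => /orP[] //.
    by move/(subsetP imC); rewrite inE Ay.
  - apply/negP; rewrite setD_eq0 => sC.
    have [y Cy] := set0Pn _ AC0; have := n1C y; rewrite eqEsubset sub1set Cy andbT => /negP[].
    have s2 : ~: A \subset [set q.2 | q in E :\ p].
      apply/subsetP=> z Cz; have := subsetP sC z Cz; rewrite !inE => /orP[/eqP zp|//].
      by move: Cz; rewrite inE zp Ap1.
    apply/(subset_trans s2)/subsetP=> z iz; rewrite inE.
    by apply/eqP/(card_le1_eqP im1) => //; apply: (subsetP s2).
  - move=> q /hit[/eqP->|Eq]; first by rewrite setU11.
    by apply/orP; right; rewrite inE imset_f // orbT.
have [x xAZ] := set0Pn _ AZ; have [y yAZ] := set0Pn _ ACZ.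
case: conn => _ /(_ (Z p) cZ x y).
move: xAZ yAZ; rewrite !in_setD in_setC => /andP[nx Ax] /andP[ny Ay] /(_ nx ny).
move=> /connectP[s sP ly]; move: sP Ax nx; rewrite ly in Ay.
elim: s x Ay {ly} => [x /negP nAx _ //|z s IHs x /= Az /andP[/and3P[_ nz axz] ps] Ax nx].
apply: (IHs z) => //; apply/negPn/negP=> nAz.
have := hit (x, z); rewrite inE /= Ax nAz axz => /(_ isT).
by rewrite (negPf nx) (negPf nz).
Qed.

End Cuts.

(** * Faces, small cuts and peeling *)

Section Faces.
Variables (G : sgraph) (r : {perm dart G}).
Hypothesis cub : cubic G.
Hypothesis conn : k_connected 3 G.
Hypothesis rot : rotation_system r.
Hypothesis euler : #|G| + num_faces r = #|edges G| + 2.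
Hypothesis sizes : forall d : dart G, face_length r d = 5 \/ face_length r d = 6.
Implicit Types (A B J : {set G}) (x y z : G) (d : dart G) (f E Phi : {set dart G}).

Local Notation phi := (face_step r).

(** * Darts and the rotation at a cubic vertex *)

Definition target d : G := source (flip d).

Lemma flipK : involutive (@flip G).
Proof. by move=> [[x y] axy]; apply: val_inj. Qed.

Lemma target_flip d : target (flip d) = source d.
Proof. by rewrite /target flipK. Qed.

Lemma adj_dart d : adj (source d) (target d).
Proof. by case: d. Qed.

Lemma dart_inj d d' : source d = source d' -> target d = target d' -> d = d'.
Proof. by case: d d' => [[x y] axy] [[z t] azt] /= ? ?; apply: val_inj; congr pair. Qed.

Lemma dart_exists x y : adj x y -> exists2 d : dart G, source d = x & target d = y.
Proof. by move=> axy; exists (exist (fun d : G * G => adj d.1 d.2) (x, y) axy). Qed.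

Lemma card_darts A B :
  #|[set d : dart G | (source d \in A) && (target d \in B)]| = dn A B.
Proof.
rewrite /dn pair_big /= -(card_imset _ val_inj) -sum1_card big_mkcond.
rewrite [RHS]big_mkcond; apply: eq_bigr => -[x y] _ /=.
have -> : ((x, y) \in [set val d | d in [set d : dart G | (source d \in A) && (target d \in B)]])
  = [&& adj x y, x \in A & y \in B].
  apply/imsetP/and3P=> [[d]|[axy Ax By]].
    by case: d => -[x' y'] /= axy; rewrite inE => /andP[Ad Bd] [-> ->].
  have [d dx dy] := dart_exists axy; exists d; first by rewrite inE dx dy Ax.
  by rewrite -dx -dy; case: (d) => -[].
by case: adj; case: (x \in A); case: (y \in B).
Qed.

Lemma card_source A : #|[set d : dart G | source d \in A]| = 3 * #|A|.
Proof. by rewrite -(dnT cub) -card_darts; apply: eq_card => d; rewrite !inE andbT. Qed.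

Lemma card_dart : #|{: dart G}| = 3 * #|G|.
Proof. by rewrite -cardsT -card_source; apply: eq_card => d; rewrite !inE. Qed.

Lemma source_rot d : source (r d) = source d.
Proof. by apply/eqP; rewrite -rot -{1}(expg1 r) mem_porbit. Qed.

Lemma card_rot d : #|porbit r d| = 3.
Proof.
have := card_source [set source d]; rewrite cards1 muln1 => <-.
by apply: eq_card => d'; rewrite !inE rot.
Qed.

Lemma rot3 d : r (r (r d)) = d.
Proof. by rewrite -[RHS](iter_porbit r) card_rot. Qed.

Lemma rot_neq d : r d != d.
Proof.
apply/negP=> /eqP rd; have := card_rot d.
suff -> : porbit r d = [set d] by rewrite cards1.
apply/setP=> d'; rewrite inE; apply/porbitP/eqP=> [[i ->]|->]; last by exists 0; rewrite expg0 perm1.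
by elim: i => [|i IHi]; rewrite ?expg0 ?perm1 // expgS permM rd.
Qed.

Lemma source_phi d : source (phi d) = target d.
Proof. exact: source_rot. Qed.

Lemma phi_inj : injective phi.
Proof. by move=> d d' /perm_inj /(can_inj flipK). Qed.

Lemma same_source d d' : source d = source d' -> [\/ d' = d, d' = r d | d' = r (r d)].
Proof.
move=> eqs; have : d' \in porbit r d by rewrite rot eqs.
rewrite porbit_traject card_rot /= !inE => /or3P[] /eqP->.
- exact: Or31.
- exact: Or32.
- exact: Or33.
Qed.

Lemma card_edges : 3 * #|G| = 2 * #|edges G|.
Proof.
have edgesE : edges G = [set [set source d; target d] | d : dart G].
  apply/setP=> s; apply/imsetP/imsetP=> -[d Hd ->]; last by exists (val d) => //; apply: valP d.
  have [d' ds dt] := dart_exists Hd; exists d' => //.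
  by rewrite ds dt.
rewrite -card_dart edgesE -cardsT -sum1_card.
rewrite (partition_big_imset (fun d => [set source d; target d])) /=.
rewrite mulnC -sum_nat_const; apply: eq_big => [s|_ /imsetP[d _ ->]].
  by apply/imsetP/imsetP=> -[d _ ->]; exists d.
rewrite sum1dep_card (_ : [set _ | _] = [set d; flip d]).
  rewrite cards2; case: eqVneq => // /(congr1 (@source G)) eqs.
  by have := adj_dart d; rewrite /target -eqs adj_irr.
apply/setP=> d'; rewrite !inE /=; apply/eqP/orP=> [eqd|[/eqP->|/eqP->]] //; last first.
  by rewrite /target flipK setUC.
have sd : source d' \in [set source d; target d] by rewrite -eqd !inE eqxx.
have td : target d' \in [set source d; target d] by rewrite -eqd !inE eqxx orbT.
have nst e : (source e == target e) = false.
  by apply: contraTF (adj_dart e) => /eqP <-; rewrite adj_irr.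
move: sd td; rewrite !inE => /orP[]/eqP ss /orP[]/eqP tt.
- by have := nst d'; rewrite ss tt eqxx.
- by left; apply/eqP/dart_inj.
- by right; apply/eqP/dart_inj => //; rewrite tt target_flip.
- by have := nst d'; rewrite ss tt eqxx.
Qed.

(** * Faces, Euler's formula and the twelve pentagons *)

Definition face d : {set dart G} := [set d' | fconnect phi d d'].
Definition faces : {set {set dart G}} := [set face d | d : dart G].

Lemma face_id d : d \in face d.
Proof. by rewrite inE connect0. Qed.

Lemma mem_face d d' : (d' \in face d) = (face d' == face d).
Proof.
apply/idP/eqP=> [|<-]; last exact: face_id.
rewrite inE => c; apply/setP=> e; rewrite !inE.
exact/esym/(same_connect (fconnect_sym phi_inj) c).
Qed.

Lemma face_phi d : face (phi d) = face d.
Proof. by apply/eqP; rewrite -mem_face inE fconnect1. Qed.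

Lemma card_face d : #|face d| = face_length r d.
Proof. by rewrite cardsE. Qed.

Lemma facesP f d : f \in faces -> d \in f -> f = face d.
Proof. by case/imsetP=> d' _ -> /[!mem_face]/eqP->. Qed.

Lemma face_in d : face d \in faces.
Proof. exact: imset_f. Qed.

Lemma card_faces : #|faces| = num_faces r.
Proof.
have symf := fconnect_sym phi_inj.
rewrite /num_faces /n_comp_mem -(card_in_imset (f := face)).
  apply/eq_card/setP/eqP; rewrite eqEsubset; apply/andP; split; apply/subsetP=> f.
    case/imsetP=> d _ ->; apply/imsetP; exists (froot phi d).
      by rewrite inE /= roots_root.
    by apply/esym/eqP; rewrite -mem_face inE connect_root.
  by case/imsetP=> d _ ->; apply: face_in.
move=> d d'; rewrite !inE => /andP[/eqP rd _] /andP[/eqP rd' _] /eqP.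
by rewrite -mem_face inE symf -(root_connect symf) rd rd' => /eqP.
Qed.

Lemma sum_faces (F : dart G -> nat) : \sum_d F d = \sum_(f in faces) \sum_(d in f) F d.
Proof.
rewrite (partition_big_imset face) /=; apply: eq_big => [f|f fF].
  by apply/imsetP/imsetP=> -[d _ ->]; exists d.
apply: eq_bigl => d; have /imsetP[d' _ ->] := fF.
by rewrite mem_face.
Qed.

Lemma two_faces : 2 * #|faces| = #|G| + 4.
Proof. by have := euler; rewrite -card_faces; have := card_edges; clear; lia. Qed.

Lemma face_size f : f \in faces -> #|f| = 5 \/ #|f| = 6.
Proof. by case/imsetP=> d _ ->; rewrite card_face; apply: sizes. Qed.

Lemma sum_face_size (X : {set {set dart G}}) : X \subset faces ->
  \sum_(f in X) #|f| + #|[set f in X | #|f| == 5]| = 6 * #|X|.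
Proof.
move=> /subsetP XF; rewrite mulnC -sum_nat_const -sum1dep_card big_mkcondr /= -big_split /=.
by apply: eq_bigr => f /XF/face_size[]->.
Qed.

(** By Euler's formula 6F = 3V + 12, while the face sizes add up to the 3V darts; each pentagon
    accounts for one missing dart. *)
Lemma card_pentagons : #|[set f in faces | #|f| == 5]| = 12.
Proof.
have e1 : \sum_(f in faces) #|f| = 3 * #|G|.
  rewrite -card_dart -sum1_card (sum_faces (fun=> 1)).
  by apply: eq_bigr => f _; rewrite sum1_card.
have := sum_face_size (subxx faces); rewrite e1; have := two_faces.
move: #|faces| #|[set _ in _ | _]| #|G| => a b c; clear; lia.
Qed.

Lemma card_ge20 : 20 <= #|G|.
Proof.
have : 12 <= #|faces|.
  by rewrite -card_pentagons subset_leq_card //; apply/subsetP=> f; rewrite inE => /andP[].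
by have := two_faces; clear; lia.
Qed.

(** * Two-colourings and the parity of monochromatic darts *)

Definition bad J d := (source d \in J) == (target d \in J).

(** Along a closed walk the colour changes an even number of times. *)
Lemma bad_parity J f : f \in faces -> odd #|[set d in f | bad J d]| = odd #|f|.
Proof.
move=> fF; have phif : phi @: f = f.
  apply/eqP; rewrite eqEcard card_imset ?leqnn ?andbT; last exact: phi_inj.
  apply/subsetP=> _ /imsetP[d fd ->]; rewrite (facesP fF fd).
  by rewrite mem_face face_phi.
have e1 : \sum_(d in f) (source d \in J) = \sum_(d in f) (target d \in J).
  rewrite -{1}phif big_imset /=; last by move=> d d' _ _; apply: phi_inj.
  by apply: eq_bigr => d _; rewrite source_phi.
have : \sum_(d in f) ((source d \in J) + (target d \in J) + (bad J d : nat)) =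
       \sum_(d in f) (1 + (((source d \in J) && (target d \in J)) + ((source d \in J) && (target d \in J)))).
  by apply: eq_bigr => d _; rewrite /bad; case: (_ \in J); case: (_ \in J).
rewrite !big_split /= -e1 sum1_card => /(congr1 odd).
rewrite !oddD !addbb /= addbF => <-.
by rewrite -sum1dep_card big_mkcondr.
Qed.

Lemma card_bad J : #|[set d | bad J d]| = dn J J + dn (~: J) (~: J).
Proof.
rewrite -!card_darts; set X := [set d | (source d \in J) && _]; set Y := [set d | _ && _].
have e0 : X :&: Y = set0 by apply/setP=> d; rewrite !inE; case: (source d \in J); rewrite ?andbF.
have := cardsU X Y; rewrite e0 cards0 subn0 => <-.
apply: eq_card => d; rewrite !inE /bad.
by case: (_ \in J); case: (_ \in J).
Qed.

Lemma sum_bad J : #|[set d | bad J d]| = \sum_(f in faces) #|[set d in f | bad J d]|.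
Proof.
rewrite -sum1dep_card big_mkcond (sum_faces (fun d => if bad J d then 1 else 0)).
by apply: eq_bigr => f _; rewrite -sum1dep_card big_mkcondr.
Qed.

Lemma bad_ge12 J : 12 <= dn J J + dn (~: J) (~: J).
Proof.
rewrite -card_bad sum_bad -card_pentagons -sum1dep_card big_mkcondr /=.
apply: leq_sum => f fF; case: ifP => // /eqP f5.
by have := bad_parity J fF; rewrite f5; case: #|_|.
Qed.

(** * Euler's formula for one side of a bond *)

Definition conn_set A := forall B, B \subset A -> B != set0 -> B != A -> 0 < dn B (A :\: B).

(** The parts of a separation would share out the leaving edges of A, each getting at least
    three. *)
Lemma conn_setP A : A != set0 -> A != setT -> cut A <= 5 -> conn_set A.
Proof.
move=> A0 AT c5 B BA B0 nBA; rewrite lt0n; apply/negP=> /eqP e0.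
have BT : B != setT by apply: contraNneq AT => BT; rewrite -subTset -BT.
have C0 : A :\: B != set0.
  by apply: contra nBA; rewrite setD_eq0 eqEsubset BA.
have CT : A :\: B != setT.
  by apply: contraNneq AT => CT; rewrite -subTset -CT subsetDl.
have := cut_ge3 cub conn B0 BT; have := cut_ge3 cub conn C0 CT.
have e1 : cut B = dn B (~: A).
  rewrite /cut (@dnDr _ (~: B) (~: A)) ?setCS //.
  by rewrite (_ : ~: B :\: ~: A = A :\: B) ?e0 ?addn0 // setDE setCK setIC -setDE.
have e2 : cut (A :\: B) = dn (A :\: B) (~: A).
  rewrite /cut (@dnDr _ (~: (A :\: B)) (~: A)) ?setCS ?subsetDl //.
  rewrite (_ : ~: (A :\: B) :\: ~: A = B) ?(dnC _ B) ?e0 ?addn0 //.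
  apply/setP=> x; rewrite !inE !negb_and !negbK.
  by have := subsetP BA x; case: (x \in B) => // [->|_]//; case: (x \in A).
have e3 : cut A = cut B + cut (A :\: B) by rewrite [LHS]/cut (dnDl _ BA) -e1 -e2.
by move: c5; rewrite e3; clear; lia.
Qed.

(** The edge count of a spanning tree, in darts; the tree is grown one vertex at a time. *)
Lemma conn_edges A E : A != set0 -> (forall d, d \in E -> flip d \in E) ->
  (forall B, B \subset A -> B != set0 -> B != A ->
     exists d, [/\ d \in E, source d \in B & target d \in A :\: B]) ->
  2 * #|A| <= #|E| + 2.
Proof.
move=> A0 flE cA.
suff [B [BA ->]] : exists B, [/\ B \subset A, B = A &
   2 * #|B| <= #|[set d in E | (source d \in B) && (target d \in B)]| + 2].
  move/leq_trans; apply; rewrite leq_add2r; apply: subset_leq_card.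
  by apply/subsetP=> d; rewrite inE => /andP[].
suff grow k : k < #|A| -> exists B, [/\ B \subset A, #|B| = k.+1 &
   2 * #|B| <= #|[set d in E | (source d \in B) && (target d \in B)]| + 2].
  have : 0 < #|A| by rewrite card_gt0.
  case cA': #|A| => [//|k] _; have [|B [BA cB le]] := grow k; first by rewrite cA'.
  by exists B; split=> //; apply/eqP; rewrite eqEcard BA cB cA' leqnn.
elim: k => [_|k IHk ltk].
  have [x Ax] := set0Pn _ A0; exists [set x]; rewrite sub1set cards1.
  by split=> //; rewrite muln1 leq_addl.
have [B [BA cB le]] := IHk (ltnW ltk).
have [||d [Ed Bd]] := cA B BA; first by rewrite -card_gt0 cB.
  by apply: contraTneq ltk => <-; rewrite cB ltnn.
rewrite inE => /andP[nBt At]; exists (target d |: B).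
rewrite subUset sub1set At BA cardsU1 nBt cB; split=> //.
have sub : [set d; flip d] :|: [set d in E | (source d \in B) && (target d \in B)] \subset
  [set d0 in E | (source d0 \in target d |: B) && (target d0 \in target d |: B)].
  apply/subsetP=> e; rewrite !inE => /orP[/orP[/eqP->|/eqP->]|/and3P[-> -> ->]].
  - by rewrite Ed Bd eqxx !orbT.
  - by rewrite flE // target_flip eqxx Bd !orbT.
  - by rewrite !orbT.
have e0 : [set d; flip d] :&: [set d in E | (source d \in B) && (target d \in B)] = set0.
  apply/setP=> e; rewrite !inE; apply/negP=> /andP[/orP[]/eqP-> /and3P[_]].
    by rewrite (negPf nBt).
  by rewrite -[source (flip d)]/(target d) (negPf nBt).
have := subset_leq_card sub; rewrite cardsU e0 cards0 subn0 cards2 (_ : d != flip d).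
  by move: le; rewrite cB /=; move: #|_| #|_| => a b; clear; lia.
by apply: contraNneq nBt => dd; rewrite /target -dd.
Qed.

(** Closed under [flip] as well, Phi would be closed under [r], hence contain all darts at its
    vertices, and no edge could leave these. *)
Lemma faces_boundary Phi : (forall d, d \in Phi -> phi d \in Phi) -> Phi != setT ->
  Phi != set0 -> exists2 d, d \in Phi & flip d \notin Phi.
Proof.
move=> phiP PT P0; have [/existsP[d /andP[]]|none] :=
  boolP [exists d, (d \in Phi) && (flip d \notin Phi)]; first by exists d.
have flP d : d \in Phi -> flip d \in Phi.
  by move=> Pd; apply: contraNT none => nPd; apply/existsP; exists d; rewrite Pd.
have rP d : d \in Phi -> r d \in Phi.
  by move=> /flP/phiP; rewrite /face_step flipK.
have sP d d' : source d = source d' -> d \in Phi -> d' \in Phi.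
  by move=> /same_source[]-> // Pd; rewrite ?rP.
pose A := [set source d | d in Phi].
have AP d : source d \in A -> d \in Phi.
  by case/imsetP=> d' Pd' eqs; apply: sP Pd'; rewrite eqs.
case/negP: PT; rewrite eqEsubset subsetT; apply/subsetP=> d0 _; apply: (AP).
have [d1 Pd1] := set0Pn _ P0; apply/negPn/negP=> nA.
have A0 : A != set0 by apply/set0Pn; exists (source d1); apply: imset_f.
have AT : A != setT by apply: contraNneq nA => ->.
have : 0 < cut A by apply: leq_trans (cut_ge3 cub conn A0 AT).
case/dn_gt0P=> x [y [Ax nAy axy]]; have [d dx dy] := dart_exists axy.
move: nAy; rewrite inE => /negP[]; apply/imsetP; exists (flip d) => //.
by apply/flP/AP; rewrite dx.
Qed.

(* Removing an edge between a chosen face and a face that is not chosen merges the two and keeps the graph connected. *)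
Lemma connected_faces_bound A E Phi : A != set0 ->
  (forall d, d \in E -> flip d \in E) ->
  (forall B, B \subset A -> B != set0 -> B != A ->
     exists d, [/\ d \in E, source d \in B & target d \in A :\: B]) ->
  (forall d, d \in E -> source d \in A) ->
  (forall d, d \in Phi -> phi d \in Phi) -> Phi \subset E -> Phi != setT ->
  2 * #|A| + 2 * #|face @: Phi| <= #|E| + 2.
Proof.
move=> A0; have [n] := ubnP #|Phi|; elim: n => // n IHn in E Phi *.
rewrite ltnS => lePn flE cA EA phiP PE PT.
have [->|P0] := eqVneq Phi set0.
  by rewrite imset0 cards0 muln0 addn0; apply: conn_edges flE cA.
have [d Pd nPd] := faces_boundary phiP PT P0.
have faceP e : e \in Phi -> face e \subset Phi.
  move=> Pe; apply/subsetP=> e'; rewrite inE => /iter_findex<-.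
  by elim: (findex _ _ _) => //= k; apply: phiP.
have Ed : d \in E by apply: (subsetP PE).
have nfd : flip d \notin face d by apply: contra nPd => /(subsetP (faceP d Pd)).
have ndf : d != flip d by apply: contraNneq nPd => <-.
suff: 2 * #|A| + 2 * #|face @: (Phi :\: face d)| <= #|E :\: [set d; flip d]| + 2.
  have le1 : #|face @: Phi| <= #|face @: (Phi :\: face d)|.+1.
    rewrite -add1n -(cards1 (face d)); apply: leq_trans (leq_card_setU _ _).
    apply/subset_leq_card/subsetP=> _ /imsetP[e Pe ->]; rewrite !inE orbC.
    have [fe|nfe] := boolP (e \in face d); last by rewrite imset_f // inE nfe.
    by rewrite -mem_face fe orbT.
  have le2 : #|E :\: [set d; flip d]| + 2 = #|E|.
    rewrite -[RHS](cardsID [set d; flip d]) (setIidPr _); last first.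
      by apply/subsetP=> e; rewrite !inE => /orP[]/eqP->; rewrite ?flE.
    by rewrite cards2 ndf addnC.
  by move: le1 le2; clear; lia.
apply: IHn.
- apply: leq_trans lePn; rewrite (cardsD1 d Phi) Pd add1n ltnS.
  by apply/subset_leq_card/setDS; rewrite sub1set face_id.
- move=> e; rewrite !inE !negb_or => /andP[/andP[n1 n2] Ee]; rewrite flE // andbT.
  by rewrite -(inj_eq (can_inj flipK)) flipK n2 /= (inj_eq (can_inj flipK)).
- move=> B BA B0 nBA; have [e [Ee Be Ce]] := cA B BA B0 nBA.
  have [eF|neF] := boolP (e \in [set d; flip d]); last by exists e; split=> //; apply/setDP; split.
  (* Going around the face of d returns to the other side of B without using the edge of d. *)
  have key (b : bool) : (source d \in B) = b -> (target d \in B) = ~~ b ->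
      exists2 d1, d1 \in face d & [/\ d1 != d, (source d1 \in B) = ~~ b & (target d1 \in B) = b].
    move=> sb tb; have [/existsP[d1 /and4P[f1 n1 /eqP s1 /eqP t1]]|none] := boolP
      [exists d1, [&& d1 \in face d, d1 != d, (source d1 \in B) == ~~ b & (target d1 \in B) == b]].
      by exists d1.
    have stay k : (source (iter k.+1 phi d) \in B) = ~~ b.
      elim: k => [|k IHk]; first by rewrite /= source_phi.
      rewrite iterS source_phi; set d1 := iter k.+1 phi d in IHk *.
      have [//|neq] := eqVneq (target d1 \in B) (~~ b).
      case/negP: none; apply/existsP; exists d1.
      rewrite inE fconnect_iter IHk eqxx /=; apply/andP; split.
        by apply/eqP=> d1d; move: IHk; rewrite d1d sb; case: (b).
      by move: neq; case: (b); case: (_ \in B).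
    have := stay (fingraph.order phi d).-1; rewrite orderSpred (iter_order phi_inj) sb.
    by case: (b).
  have inE' d1 : d1 \in face d -> d1 != d -> d1 \in E :\: [set d; flip d].
    move=> f1 n1; rewrite !inE negb_or n1 /= (subsetP PE) ?(subsetP (faceP d Pd)) // andbT.
    by apply: contraNneq nfd => <-.
  have inA x e1 : e1 \in E -> x = source e1 \/ x = target e1 -> x \in A.
    by move=> Ee1 [->|->]; apply: EA => //; apply: flE.
  move: eF; rewrite !inE => /orP[]/eqP eqe; move: Be Ce; rewrite eqe ?target_flip !inE.
    move=> Bs /andP[nBt At]; have [d1 f1 [n1 s1 t1]] := key true Bs (negbTE nBt).
    have := inE' d1 f1 n1; rewrite !inE => /andP[/[dup] n2 _ E1].
    exists (flip d1); rewrite !inE target_flip s1 t1 EA // flE // ?andbT.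
    split=> //; move: n2; rewrite !negb_or -!(inj_eq (can_inj flipK) _ d) flipK.
    by rewrite -(inj_eq (can_inj flipK) (flip d1)) flipK andbC.
  rewrite -/(target d) => Bt /andP[nBs As].
  have [d1 f1 [n1 s1 t1]] := key false (negbTE nBs) Bt.
  exists d1; split=> //; first exact: inE'.
  have := inE' d1 f1 n1; rewrite !inE => /andP[_ E1].
  by rewrite t1 /=; apply: (inA _ d1) => //; right.
- by move=> e; rewrite inE => /andP[_]; apply: EA.
- move=> e; rewrite inE => /andP[n1 Pe]; rewrite inE phiP // andbT.
  by rewrite mem_face face_phi -mem_face.
- apply/subsetP=> e; rewrite !inE negb_or => /andP[n1 Pe]; rewrite (subsetP PE) // andbT.
  apply/andP; split; first by apply: contraNneq n1 => ->; rewrite connect0.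
  by apply: contraNneq nPd => <-.
- by apply: contraTneq (face_id d) => PT'; have := in_setT d; rewrite -PT' inE face_id.
Qed.


Definition inside A : {set dart G} := [set d | source d \in A].
Definition full_faces A := [set f in faces | f \subset inside A].
Definition pentagons A := [set f in full_faces A | #|f| == 5].
Definition exits A : {set dart G} := [set d | (source d \in A) && (target d \notin A)].

Lemma card_exits A : #|exits A| = cut A.
Proof. by rewrite /cut -card_darts; apply: eq_card => d; rewrite !inE. Qed.

(** One half of Euler's formula for the subgraph on A, where [dn A A], twice its number of edges, is
    [3 * #|A| - cut A]. *)
Lemma full_faces_bound A : A != set0 -> A != setT -> conn_set A ->
  2 * #|full_faces A| + cut A <= #|A| + 2.
Proof.
move=> A0 AT cA; pose E := [set d : dart G | (source d \in A) && (target d \in A)].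
pose Phi := [set d | face d \subset inside A].
have -> : full_faces A = face @: Phi.
  apply/setP=> f; rewrite inE; apply/andP/imsetP=> [[/imsetP[d _ ->] fA]|[d]].
    by exists d; rewrite // inE.
  by rewrite inE => fA ->; rewrite face_in.
have phiP d : d \in Phi -> phi d \in Phi by rewrite !inE face_phi.
have PE : Phi \subset E.
  apply/subsetP=> d Pd; have srcP e : e \in Phi -> source e \in A.
    by rewrite inE => /subsetP/(_ _ (face_id e)); rewrite inE.
  by rewrite inE srcP //= -source_phi srcP // phiP.
have PT : Phi != setT.
  apply: contraNneq AT => PT; apply/eqP/setP=> x; rewrite !inE.
  have : 0 < dn [set x] setT by rewrite dnT // cards1.
  case/dn_gt0P=> x' [y [/set1P-> _ axy]]; have [d <- _] := dart_exists axy.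
  have Pd : d \in Phi by rewrite PT.
  by have := subsetP PE d Pd; rewrite inE => /andP[].
have := @connected_faces_bound A E Phi A0 _ _ _ phiP PE PT.
have -> : #|E| = dn A A by rewrite -card_darts.
move=> H; have {H} : 2 * #|A| + 2 * #|face @: Phi| <= dn A A + 2.
  apply: H => [d|B BA B0 nBA|d]; rewrite ?inE.
  - by rewrite target_flip andbC.
  - have /dn_gt0P[x [y [Bx ABy axy]]] := cA B BA B0 nBA.
    have [d dx dy] := dart_exists axy; exists d; rewrite !inE dx dy Bx (subsetP BA) //.
    by move: ABy; rewrite !inE => /andP[-> ->].
  - by case/andP.
have := cut_dn cub A; move: #|face @: Phi| (dn A A) (cut A) #|A| => a b c e.
by clear; lia.
Qed.

(* The three families of faces, inside A, outside A and crossing, attain their upper bounds simultaneously by Euler's formula. *)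
Lemma bond_faces A : A != set0 -> A != setT -> conn_set A -> conn_set (~: A) ->
  2 * #|full_faces A| + cut A = #|A| + 2 /\ {in exits A &, injective face}.
Proof.
move=> A0 AT cA cC; have b1 := full_faces_bound A0 AT cA.
have C0 : ~: A != set0 by apply: contra AT => /eqP C0; rewrite -(setCK A) C0 setC0.
have CT : ~: A != setT by apply: contra A0 => /eqP CT; rewrite -(setCK A) CT setCT.
have := full_faces_bound C0 CT cC; rewrite cutC => b2.
have b3 : #|faces| <= #|full_faces A| + #|full_faces (~: A)| + #|face @: exits A|.
  rewrite -addnA; apply: leq_trans (leq_add (leqnn _) (leq_card_setU _ _)).
  apply: leq_trans (leq_card_setU _ _); apply/subset_leq_card/subsetP=> f fF.
  rewrite !inE fF /=; have [//|/subsetPn[d1 f1 n1]] := boolP (f \subset inside A).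
  have [//|/subsetPn[d2 f2 n2]] := boolP (f \subset inside (~: A)).
  have {n1} s1 : source d1 \notin A by rewrite inE in n1.
  have {n2} s2 : source d2 \in A by move: n2; rewrite !inE negbK.
  have [/existsP[d /andP[fd ed]]|none] := boolP [exists d, (d \in f) && (d \in exits A)].
    by apply/imsetP; exists d => //; apply: facesP.
  have stay k : source (iter k phi d2) \in A.
    elim: k => //= k IHk; rewrite source_phi; apply: contraNT none => nt.
    apply/existsP; exists (iter k phi d2); rewrite inE IHk nt andbT /=.
    by rewrite (facesP fF f2) inE fconnect_iter.
  move: f1 s1; rewrite (facesP fF f2) inE => /iter_findex <-.
  by rewrite stay.
have b4 : #|face @: exits A| <= cut A by rewrite -card_exits leq_imset_card.
have := two_faces; have := cardsC A; move: b1 b2 b3 b4 => b1 b2 b3 b4 e1 e2.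
split; first by move: b1 b2 b3 b4 e1 e2; card_lia.
apply/imset_injP; rewrite eqn_leq leq_imset_card card_exits /=.
by move: b1 b2 b3 b4 e1 e2; card_lia.
Qed.

(* The arcs into which the boundary of A cuts the faces that cross it, as darts. *)
Definition arcs A := [set d in inside A | ~~ (face d \subset inside A)].

(** The full faces take up the darts of A that are not on arcs. A full hexagon has exactly the six
    darts that Euler's formula charges for a face, so only pentagons show up. *)
Lemma card_arcs A : 2 * #|full_faces A| + cut A = #|A| + 2 ->
  #|arcs A| + 6 = 3 * cut A + #|pentagons A|.
Proof.
move=> bA; have sub : full_faces A \subset faces.
  by apply/subsetP=> f; rewrite inE => /andP[].
have := sum_face_size sub; rewrite -/(pentagons A).
pose Phi := [set d | face d \subset inside A].
have -> : \sum_(f in full_faces A) #|f| = #|Phi|.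
  rewrite -sum1dep_card [RHS]big_mkcond (sum_faces (fun d => if face d \subset inside A then 1 else 0)).
  under eq_bigl do rewrite inE; rewrite big_mkcondr /=; apply: eq_bigr => f fF.
  rewrite -sum1_card; case: ifP => fA; [apply: eq_bigr | rewrite big1 //] => d fd.
    by rewrite -(facesP fF fd) fA.
  by rewrite -(facesP fF fd) fA.
have := cardsID Phi (inside A); rewrite card_source.
have -> : inside A :&: Phi = Phi.
  by apply/setIidPr/subsetP=> d; rewrite inE => /subsetP/(_ d); apply; apply: face_id.
have -> : inside A :\: Phi = arcs A by apply/setP=> d; rewrite !inE andbC.
by move: bA; move: #|full_faces A| #|Phi| #|arcs A| #|pentagons A| => a b c d; clear; lia.
Qed.

Lemma pentagonsS A B : A \subset B -> #|pentagons A| <= #|pentagons B|.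
Proof.
move=> AB; apply/subset_leq_card/subsetP=> f; rewrite !inE => /andP[/andP[-> fA] ->].
rewrite andbT /=; apply: subset_trans fA _; apply/subsetP=> d.
by rewrite !inE; apply: (subsetP AB).
Qed.

Lemma pentagonsC A : #|pentagons A| + #|pentagons (~: A)| <= 12.
Proof.
rewrite -card_pentagons -cardsUI.
have e0 : pentagons A :&: pentagons (~: A) = set0.
  apply/setP=> f; rewrite !inE; apply/negP=> /andP[/andP[/andP[fF fA] /eqP f5] /andP[/andP[_ fC] _]].
  have [d fd] : exists d, d \in f by apply/card_gt0P; rewrite f5.
  by have := subsetP fA d fd; have := subsetP fC d fd; rewrite !inE => /negP.
rewrite e0 cards0 addn0; apply/subset_leq_card/subsetP=> f; rewrite !inE.
by case/orP=> /andP[/andP[-> _] ->].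
Qed.

Lemma cutD A B : B \subset A -> cut (A :\: B) + 2 * dn B (~: A) = cut A + cut B.
Proof.
move=> BA; have e1 : cut A = dn B (~: A) + dn (A :\: B) (~: A) by rewrite /cut (dnDl _ BA).
have e2 : cut B = dn B (~: A) + dn B (A :\: B).
  rewrite /cut (@dnDr _ (~: B) (~: A)) ?setCS //.
  by rewrite (_ : ~: B :\: ~: A = A :\: B) // setDE setCK setIC -setDE.
have e3 : cut (A :\: B) = dn (A :\: B) (~: A) + dn (A :\: B) B.
  rewrite /cut (@dnDr _ (~: (A :\: B)) (~: A)) ?setCS ?subsetDl //.
  rewrite (_ : ~: (A :\: B) :\: ~: A = B) //.
  apply/setP=> x; rewrite !inE !negb_and !negbK.
  by have := subsetP BA x; case: (x \in B) => // [->|_]//; case: (x \in A).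
by rewrite e1 e2 e3 (dnC _ B); clear; lia.
Qed.

Lemma cutD1 A x : x \in A -> cut (A :\ x) + 2 * dn [set x] (~: A) = cut A + 3.
Proof. by move=> Ax; rewrite cutD ?sub1set // cut1. Qed.

Lemma dn_pair x y A : x != y -> dn [set x; y] A = dn [set x] A + dn [set y] A.
Proof. by move=> nxy; rewrite dnUl // disjoints1 inE. Qed.

Lemma cut_pair x y : adj x y -> cut [set x; y] = 4.
Proof.
move=> axy; have nxy : x != y by apply: contraTneq axy => ->; rewrite adj_irr.
have := cut_dn cub [set x; y]; rewrite cards2 nxy dn_pair // !(dnC _ [set x; y]).
by rewrite !dn_pair // !dn11 !adj_irr (adj_sym y) axy; clear; lia.
Qed.

Lemma dn1_le1 x A y z : dn [set x] A <= 1 -> y \in A -> z \in A -> adj x y -> adj x z -> y = z.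
Proof.
rewrite dn1E => le1 Ay Az axy axz.
by apply: (card_le1_eqP le1); rewrite inE ?Ay ?Az.
Qed.

(** * Boundary rings and cuts with at most five edges *)

Definition one_exit A := [forall x in A, dn [set x] (~: A) <= 1].

Lemma exit_inj A : one_exit A -> {in exits A &, injective (@source G)}.
Proof.
move=> /forall_inP P1 d d'; rewrite !inE => /andP[Ad nd] /andP[Ad' nd'] eqs.
apply: dart_inj => //; apply: (dn1_le1 (P1 _ Ad)); rewrite ?inE // ?adj_dart //.
by rewrite eqs adj_dart.
Qed.

Lemma not_one_exit A : ~~ one_exit A -> exists2 x, x \in A & cut (A :\ x) < cut A.
Proof.
rewrite negb_forall => /existsP[x]; rewrite negb_imply -ltnNge => /andP[Ax lt].
by exists x => //; have := cutD1 Ax; move: lt; clear; lia.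
Qed.

Lemma exits_arcs A e : e \in exits A -> e \in arcs A.
Proof.
rewrite !inE => /andP[-> nt]; apply/subsetPn; exists (phi e).
  by rewrite mem_face face_phi.
by rewrite inE source_phi.
Qed.

Lemma rexits_arcs A e : e \in exits A -> r e \in arcs A.
Proof.
rewrite !inE source_rot => /andP[-> nt]; apply/subsetPn; exists (flip e); last by rewrite inE.
by rewrite mem_face -face_phi /face_step flipK.
Qed.

Lemma phi_arcs A d : d \in arcs A -> target d \in A -> phi d \in arcs A.
Proof. by rewrite !inE source_phi face_phi => /andP[_ ->] ->. Qed.

Lemma rexit_exit A e : one_exit A -> e \in exits A -> r e \notin exits A.
Proof.
move=> P1 Ae; apply/negP=> Are; have := exit_inj P1 Are Ae (source_rot e).
by apply/eqP; rewrite rot_neq.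
Qed.

Lemma card_rexits A : one_exit A -> #|exits A :|: r @: exits A| = 2 * cut A.
Proof.
move=> P1; rewrite cardsU (card_imset _ perm_inj) card_exits.
have -> : exits A :&: r @: exits A = set0; last by rewrite cards0; clear; lia.
apply/setP=> d; rewrite [in RHS]inE; apply/negP=> /setIP[Ad /imsetP[e Ae de]].
by have := rexit_exit P1 Ae; rewrite -de Ad.
Qed.

(** An arc begins with the rotation of an exit and ends with an exit. *)
Lemma rexits_sub A : exits A :|: r @: exits A \subset arcs A.
Proof.
apply/subsetP=> d /setUP[/exits_arcs//|/imsetP[e Ae ->]].
exact: rexits_arcs.
Qed.

(* An arc with exactly two vertices consists of two adjacent boundary vertices. *)
Lemma arcs_two_or_three A : one_exit A ->
  (exists x y, [/\ x \in A, y \in A, adj x y, dn [set x] (~: A) = 1 & dn [set y] (~: A) = 1]) \/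
  [/\ exits A :|: r @: exits A :|: (phi \o r) @: exits A \subset arcs A,
      #|exits A :|: r @: exits A :|: (phi \o r) @: exits A| = 3 * cut A &
      forall e, e \in exits A -> target (phi (r e)) \in A].
Proof.
move=> P1; have ex1 e : e \in exits A -> dn [set source e] (~: A) = 1.
  rewrite inE => /andP[Ae nt]; apply/eqP; rewrite eqn_leq (forall_inP P1) //.
  by apply/dn_gt0P; exists (source e), (target e); rewrite !inE eqxx nt adj_dart.
have tr e : e \in exits A -> target (r e) \in A.
  move=> Ae; have := rexit_exit P1 Ae; rewrite inE source_rot negb_and negbK.
  by move: Ae; rewrite inE => /andP[->].
have [/existsP[e /andP[Ae Ae2]]|none] :=
  boolP [exists e, (e \in exits A) && (phi (r e) \in exits A)].
  left; exists (source e), (target (r e)); rewrite ex1 // -source_phi ex1 //.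
  move: (Ae) (Ae2); rewrite !inE => /andP[-> _] /andP[-> _]; split=> //.
  by rewrite source_phi -(source_rot e) adj_dart.
have tt e : e \in exits A -> target (phi (r e)) \in A.
  move=> Ae; apply: contraNT none => nt; apply/existsP; exists e.
  by rewrite Ae inE source_phi tr.
right; split=> //.
  rewrite subUset rexits_sub; apply/subsetP=> _ /imsetP[e Ae ->] /=.
  by apply: phi_arcs (tr e Ae); apply: rexits_arcs.
have inj3 : injective (phi \o r) by apply: inj_comp phi_inj perm_inj.
rewrite cardsU card_rexits // (card_imset _ inj3) card_exits.
have -> : (exits A :|: r @: exits A) :&: (phi \o r) @: exits A = set0.
  apply/setP=> d; rewrite [in RHS]inE; apply/negP=> /setIP[/setUP[Ad|/imsetP[e' Ae' ->]]].
    case/imsetP=> e Ae de; case/negP: none; apply/existsP; exists e.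
    by rewrite Ae -[phi (r e)]de.
  case/imsetP=> e Ae /perm_inj eqe; move: Ae'; rewrite eqe inE => /andP[_].
  by rewrite target_flip source_rot; move: Ae; rewrite inE => /andP[->].
by rewrite cards0; clear; lia.
Qed.

Lemma conn_set_cut A : A != set0 -> A != setT -> cut A <= 5 ->
  2 * #|full_faces A| + cut A = #|A| + 2 /\ {in exits A &, injective face}.
Proof.
move=> A0 AT c5; apply: bond_faces => //; apply: conn_setP => //.
- by apply: contra AT => /eqP C0; rewrite -(setCK A) C0 setC0.
- by apply: contra A0 => /eqP CT; rewrite -(setCK A) CT setCT.
- by rewrite cutC.
Qed.

Lemma pentagons_full A : #|pentagons A| <= #|full_faces A|.
Proof. by apply/subset_leq_card/subsetP=> f; rewrite inE => /andP[]. Qed.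

(* Minimal counterexample: moving to the other side a vertex with two exits, two adjacent boundary vertices, or else the whole ring of boundary vertices does not enlarge the cut. *)
Lemma small_cut A : A != set0 -> A != setT -> cut A <= 4 -> #|pentagons A| <= 6 ->
  #|A| < cut A.
Proof.
have [n] := ubnP #|A|; elim: n => // n IHn in A *; rewrite ltnS => leAn A0 AT c4 p6.
rewrite ltnNge; apply/negP=> leA; have c3 := cut_ge3 cub conn A0 AT.
have [bA _] := conn_set_cut A0 AT (leqW c4); have aA := card_arcs bA.
have pf := pentagons_full A.
have IH B : B \subset A -> B != A -> cut A <= #|B| -> cut B <= cut A -> False.
  move=> BA nBA leB cB.
  have lt : #|B| < #|A| by apply: proper_card; rewrite properEneq nBA.
  have B0 : B != set0 by rewrite -card_gt0; move: c3 leB; card_lia.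
  have BT : B != setT by apply: contraNneq AT => BT; rewrite -subTset -BT.
  have := IHn B (leq_trans lt leAn) B0 BT (leq_trans cB c4) (leq_trans (pentagonsS BA) p6).
  by rewrite ltnNge (leq_trans cB leB).
have P1 : one_exit A.
  apply/negPn/negP=> /not_one_exit[x Ax lt].
  have cx : #|A| = #|A :\ x|.+1 by rewrite (cardsD1 x A) Ax.
  have sx : A :\ x \subset A by apply: subsetDl.
  have B0 : A :\ x != set0 by rewrite -card_gt0; move: cx leA c3; card_lia.
  have BT : A :\ x != setT by apply: contraNneq AT => BT; rewrite -subTset -BT.
  have ltn : #|A :\ x| < n by rewrite -ltnS -cx ltnS.
  have := IHn (A :\ x) ltn B0 BT (leq_trans (ltnW lt) c4) (leq_trans (pentagonsS sx) p6).
  by move: cx lt leA; card_lia.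
have := subset_leq_card (rexits_sub A); rewrite card_rexits // => ge2.
(* At least [2 * cut A] darts on arcs require two pentagons inside A, hence two full faces. *)
have geA : cut A + 2 <= #|A| by move: bA aA ge2 c4 pf; card_lia.
have [[x [y [Ax Ay axy x1 y1]]]|[sub c3U tt]] := arcs_two_or_three P1.
  have nxy : x != y by apply: contraTneq axy => ->; rewrite adj_irr.
  have sA : [set x; y] \subset A by rewrite subUset !sub1set Ax.
  have := cutD sA; rewrite cut_pair // dn_pair // x1 y1 => e1.
  have := cardsD A [set x; y]; rewrite (setIidPr sA) cards2 nxy => e2.
  apply: (IH (A :\: [set x; y])); first exact: subsetDl.
  - by apply: contraTneq Ax => <-; rewrite !inE eqxx.
  - by move: e2 geA; card_lia.
  - by move: e1; card_lia.
have leU := subset_leq_card sub; rewrite c3U in leU.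
(* Three darts on every arc make the balance tight: exactly six pentagons, and no darts on arcs
   beyond these. *)
have p6' : #|pentagons A| = 6 by move: aA leU p6; card_lia.
have Uarcs : exits A :|: r @: exits A :|: (phi \o r) @: exits A = arcs A.
  by apply/eqP; rewrite eqEcard sub c3U; move: aA p6'; card_lia.
(* [X1] consists of the end vertices of the arcs, [X2] of their middle vertices. *)
pose X1 := @source G @: exits A; pose X2 := (fun e => target (r e)) @: exits A.
pose W := X1 :|: X2.
have WA : W \subset A.
  apply/subsetP=> x /setUP[]/imsetP[e Ae ->]; first by move: Ae; rewrite inE => /andP[].
  have := rexit_exit P1 Ae; rewrite inE source_rot negb_and negbK.
  by move: Ae; rewrite inE => /andP[->].
have arcsW d : d \in arcs A -> source d \in W.
  rewrite -Uarcs => /setUP[/setUP[Ad|/imsetP[e Ae ->]]|/imsetP[e Ae ->]]; apply/setUP.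
  - by left; apply: imset_f.
  - by left; rewrite source_rot; apply: imset_f.
  - by right; rewrite /= source_phi; apply/imsetP; exists e.
have cW : #|W| <= 2 * cut A.
  apply: leq_trans (leq_card_setU _ _) _; rewrite mul2n -addnn -card_exits.
  by rewrite leq_add // leq_imset_card.
(* An edge going inwards from the ring starts at the middle of an arc, which gives at most one per
   exit. *)
have dW : dn W (A :\: W) <= cut A.
  rewrite -card_darts -card_exits; apply: leq_trans (leq_imset_card (fun e => r (phi (r e))) _).
  apply/subset_leq_card/subsetP=> d; rewrite inE => /andP[Wd]; rewrite inE => /andP[nWt At].
  case/setUP: Wd => /imsetP[e Ae se].
    have [de|de|de] := same_source (esym se).
    - by move: Ae; rewrite -de inE At andbF.
    - by case/negP: nWt; rewrite de; apply/setUP; right; apply/imsetP; exists e.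
    - case/negP: nWt; apply: (arcsW (flip d)); rewrite !inE.
      rewrite -[source (flip d)]/(target d) At /= -face_phi /face_step flipK de rot3.
      by have := exits_arcs Ae; rewrite inE => /andP[].
  have [de|de|de] := same_source (esym se).
  - case/negP: nWt; rewrite de target_flip source_rot; apply/setUP; left.
    exact: imset_f.
  - have dA : d \in arcs A.
      rewrite de; apply: (subsetP sub); apply/setUP; right.
      by apply/imsetP; exists e.
    by case/negP: nWt; rewrite -source_phi; apply/arcsW/phi_arcs.
  - by apply/imsetP; exists e.
have W0 : W != set0.
  have /card_gt0P[e Ae] : 0 < #|exits A| by rewrite card_exits (leq_trans _ c3).
  by apply/set0Pn; exists (source e); apply/setUP; left; apply: imset_f.
have e1 : cut (A :\: W) = dn (A :\: W) W.
  rewrite /cut (@dnDr _ _ W); last by apply/subsetP=> x Wx; rewrite in_setC in_setD Wx.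
  rewrite (_ : dn (A :\: W) (~: (A :\: W) :\: W) = 0) ?addn0 //; apply/eqP/dn_eq0P=> x y.
  move=> /setDP[Ax nWx] /setDP[]; rewrite in_setC in_setD => nAy nWy.
  rewrite nWy /= in nAy.
  apply: contra nWx => axy; have [d dx dy] := dart_exists axy.
  by rewrite -dx; apply/setUP; left; apply: imset_f; rewrite inE dx dy Ax.
have e2 := cardsD A W; rewrite (setIidPr WA) in e2.
apply: (IH (A :\: W)); first exact: subsetDl.
- have [x Wx] := set0Pn _ W0; apply: contraTneq (Wx) => eqA.
  by have := subsetP WA x Wx; rewrite -eqA => /setDP[].
(* Six full faces give A at least [cut A + 10] vertices, of which the ring takes at most
   [2 * cut A]. *)
- by move: e2 bA pf p6' cW c4; card_lia.
- by rewrite e1 dnC.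
Qed.

(** One of the two sides has at most six of the twelve pentagons. *)
Lemma small_cut_either A : A != set0 -> A != setT -> cut A <= 4 ->
  #|A| < cut A \/ #|~: A| < cut A.
Proof.
move=> A0 AT c4; have [p6|p6] := leqP #|pentagons A| 6; first by left; apply: small_cut.
right; rewrite -cutC; apply: small_cut; rewrite ?cutC //.
- by apply: contra AT => /eqP C0; rewrite -(setCK A) C0 setC0.
- by apply: contra A0 => /eqP CT; rewrite -(setCK A) CT setCT.
- by have := pentagonsC A; move: p6; card_lia.
Qed.

Lemma cut_ge5 A : 4 <= #|A| -> 4 <= #|~: A| -> 5 <= cut A.
Proof.
move=> lA lC; rewrite leqNgt; apply/negP; rewrite ltnS => c4.
have A0 : A != set0 by rewrite -card_gt0 (leq_trans _ lA).
have AT : A != setT by apply: contraTneq lC => ->; rewrite setCT cards0.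
by case: (small_cut_either A0 AT c4); move: lA lC c4; card_lia.
Qed.

(** Moving out a vertex with two exits would give a cut of at most four edges with four vertices on
    either side. *)
Lemma one_exit_cut5 A : cut A = 5 -> 5 <= #|A| -> 3 <= #|~: A| -> one_exit A.
Proof.
move=> c5 lA lC; apply/negPn/negP=> /not_one_exit[x Ax]; rewrite c5 ltnNge.
rewrite cut_ge5 //; first by rewrite -ltnS; move: lA; rewrite (cardsD1 x A) Ax.
have -> : ~: (A :\ x) = x |: ~: A by apply/setP=> y; rewrite !inE; case: eqVneq.
by rewrite cardsU1 !inE Ax add1n ltnS.
Qed.

(** There is one full face, and [9 + #|pentagons A|] darts on arcs, at least ten. So the full face
    is a pentagon, and the third dart at each vertex of A, being on no arc, lies on it. *)
Lemma facial_pentagon A : cut A = 5 -> #|A| = 5 -> exists g,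
  [/\ g \in faces, #|g| = 5, g \subset inside A & forall e, e \in exits A -> r (r e) \in g].
Proof.
move=> c5 A5; have lC : 15 <= #|~: A|.
  by have := cardsC A; have := card_ge20; rewrite A5; card_lia.
have P1 : one_exit A by rewrite one_exit_cut5 ?A5 // (leq_trans _ lC).
have A0 : A != set0 by rewrite -card_gt0 A5.
have AT : A != setT by apply: contraTneq lC => ->; rewrite setCT cards0.
have [bA _] := conn_set_cut A0 AT (eq_leq c5).
have aA := card_arcs bA; have pf := pentagons_full A.
have leU := subset_leq_card (rexits_sub A); rewrite card_rexits // c5 in leU.
have /eqP/cards1P[g gE] : #|full_faces A| = 1 by move: bA; rewrite c5 A5; card_lia.
have [gF gA] : g \in faces /\ g \subset inside A.
  by have := set11 g; rewrite -gE inE => /andP[].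
have arcsE : exits A :|: r @: exits A = arcs A.
  apply/eqP; rewrite eqEcard rexits_sub card_rexits // c5.
  by move: aA pf; rewrite gE cards1 c5; card_lia.
exists g; split=> // [|e Ae].
  have /card_gt0P[f] : 0 < #|pentagons A| by move: aA leU; rewrite c5; card_lia.
  by rewrite inE gE => /andP[/set1P-> /eqP].
have : r (r e) \notin arcs A.
  rewrite -arcsE; apply/negP=> /setUP[Ar|/imsetP[e' Ae' /perm_inj re]].
    have := exit_inj P1 Ar Ae; rewrite !source_rot => /(_ erefl) rre.
    have := rexit_exit P1 Ar; rewrite rot3 Ae //.
  by have := rexit_exit P1 Ae; rewrite re Ae'.
have Ase : source e \in A by move: Ae; rewrite inE => /andP[].
rewrite !inE !source_rot Ase /= negbK => fA.
have /set1P <- : face (r (r e)) \in [set g] by rewrite -gE inE face_in.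
exact: face_id.
Qed.

(* As long as A is not a pentagon, some pair of adjacent boundary vertices can be removed; the last such step would produce two facial pentagons sharing a corner at m. *)
Lemma cut5_pentagon A : cut A = 5 -> #|pentagons A| <= 5 -> 5 <= #|A| -> 3 <= #|~: A| ->
  #|A| = 5.
Proof.
have [n] := ubnP #|A|; elim: n => // n IHn in A *; rewrite ltnS => leAn c5 p5 lA lC.
apply/eqP/negPn/negP=> n5.
have oA : odd #|A| by rewrite -(cut_odd cub) c5.
have l7 : 7 <= #|A| by move: oA lA n5; case: #|A| => [|[|[|[|[|[|[]]]]]]].
have A0 : A != set0 by rewrite -card_gt0 (leq_trans _ lA).
have AT : A != setT by apply: contraTneq lC => ->; rewrite setCT cards0.
have P1 := one_exit_cut5 c5 lA lC.
have [bA _] := conn_set_cut A0 AT (eq_leq c5); have aA := card_arcs bA.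
have [[x [y [Ax Ay axy x1 y1]]]|[sub c3U _]] := arcs_two_or_three P1; last first.
  (* Arcs of three vertices would use 15 darts, while five pentagons allow only 14. *)
  have := subset_leq_card sub; rewrite c3U.
  by move: aA p5; rewrite c5; card_lia.
have nxy : x != y by apply: contraTneq axy => ->; rewrite adj_irr.
have sA : [set x; y] \subset A by rewrite subUset !sub1set Ax.
pose B := A :\: [set x; y].
have cB : cut B = 5 by have := cutD sA; rewrite cut_pair // dn_pair // x1 y1 c5 -/B; clear; lia.
have eB : #|A| = #|B| + 2.
  by have := cardsID [set x; y] A; rewrite (setIidPr sA) cards2 nxy addnC => <-.
have BA : B \subset A by apply: subsetDl.
have B5 : #|B| = 5.
  apply: IHn => //.
  - by move: eB leAn; card_lia.
  - exact: leq_trans (pentagonsS BA) p5.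
  - by move: eB l7; card_lia.
  - by apply: leq_trans lC _; rewrite subset_leq_card // setCS.
have nG := card_ge20.
have PB : one_exit B.
  by apply: one_exit_cut5 => //; [rewrite B5 | have := cardsC B; rewrite B5; move: nG; card_lia].
(* Five leaving edges, at most one at each of the five vertices. *)
have dnB z : z \in B -> dn [set z] (~: B) = 1.
  have e5 : \sum_(z in B) (1 - dn [set z] (~: B)) = 0.
    have := cB; rewrite /cut dn_sumr => e5; have : \sum_(z in B) 1 = 5 by rewrite sum1_card.
    rewrite -e5; have le1 : forall z, z \in B -> dn [set z] (~: B) <= 1 by apply/forall_inP.
    by rewrite sumnB // => ->; rewrite subnn.
  move=> Bz; apply/eqP; rewrite eqn_leq (forall_inP PB) //=.
  by move/eqP: e5; rewrite sum_nat_eq0 => /forall_inP/(_ z Bz); case: dn.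
have dnBB z : z \in B -> dn [set z] B = 2.
  move=> Bz; have := dnT cub [set z]; rewrite cards1 (dnDr _ (subsetT B)) setTD dnB //.
  by clear; lia.
have nbr z w : z \in A -> w \in A -> dn [set z] (~: A) = 1 -> adj z w ->
    A = B :|: [set z; w] -> z \notin B -> w \notin B -> z != w ->
    dn [set z] B = 1 /\ exists2 p, p \in B & adj z p.
  move=> Az Aw z1 azw eqA nzB nwB nzw.
  have := dnT cub [set z]; rewrite cards1 (dnDr _ (subsetT A)) setTD z1 eqA.
  rewrite dnUr; last by rewrite disjoint_sym disjoints_subset subUset !sub1set !in_setC nzB.
  rewrite (dnC _ [set z; w]) dn_pair // !dn11 adj_irr (adj_sym w) azw => e3.
  have e1 : dn [set z] B = 1 by move: e3; clear; lia.
  split=> //; have /dn_gt0P[z' [p [/set1P-> Bp azp]]] : 0 < dn [set z] B by rewrite e1.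
  by exists p.
have nxB : x \notin B by rewrite !inE eqxx.
have nyB : y \notin B by rewrite !inE eqxx orbT.
have eqA : A = B :|: [set x; y].
  apply/setP=> z; rewrite in_setU in_setD; have [zS|_] := boolP (z \in [set x; y]).
    by rewrite orbT (subsetP sA).
  by rewrite orbF.
clearbody B.
have [xB1 [p Bp axp]] := nbr x y Ax Ay x1 axy eqA nxB nyB nxy.
have [yB1 [q Bq ayq]] : dn [set y] B = 1 /\ exists2 q, q \in B & adj y q.
  by apply: (nbr y x) => //; rewrite ?(adj_sym y) // 1?setUC 1?eq_sym // eqA setUC (setUC [set y]).
have npq : p != q.
  apply: contra_neq nxy => epq; have := dnB p Bp => e1.
  apply: (@dn1_le1 p (~: B)); rewrite ?e1 ?in_setC ?nxB ?nyB //; first by rewrite adj_sym.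
  by rewrite epq adj_sym.
have inB z w : z \in B -> w \notin B -> z != w by move=> Bz; apply: contraNneq => <-.
have npx := inB p x Bp nxB; have npy := inB p y Bp nyB.
have nqx := inB q x Bq nxB; have nqy := inB q y Bq nyB.
pose C4 := [set p; q] :|: [set x; y].
have d4 : [disjoint [set p; q] & [set x; y]].
  by rewrite disjoints_subset subUset !sub1set !inE !negb_or npx npy nqx nqy.
have k4 : #|C4| = 4.
  have := cardsU [set p; q] [set x; y]; rewrite -/C4 !cards2 npq nxy (disjoint_setI0 d4).
  by rewrite cards0.
have dn4 : dn C4 C4 >= 6 + 2 * adj p q.
  rewrite (dnUl _ d4) !(dnUr _ d4) !(dn_pair _ npq) !(dn_pair _ nxy).
  rewrite !(dnC _ [set p; q]) !(dnC _ [set x; y]) !(dn_pair _ npq) !(dn_pair _ nxy) !dn11.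
  rewrite !adj_irr.
  rewrite (adj_sym p x) (adj_sym q y) (adj_sym y x) (adj_sym q p) axy axp ayq.
  by clear; lia.
have big (C : {set G}) : #|C| <= 5 -> 4 <= #|~: C|.
  by have := cardsC C; move: nG; card_lia.
(* Otherwise p, x, y, q form a 4-cycle, which at most four edges leave. *)
have naqp : ~~ adj p q.
  apply/negP=> apq; have := @cut_ge5 C4; rewrite k4 big ?k4 // => /(_ isT isT).
  by have := cut_dn cub C4; rewrite k4; move: dn4; rewrite apq; clear; lia.
pose N z := [set w in B | adj z w].
have NS : N p :|: N q \subset B :\: [set p; q].
  apply/subsetP=> z /setUP[]; rewrite /N inE => /andP[Bz az]; apply/setDP; split=> //.
    rewrite !inE negb_or; apply/andP; split; first by apply: contraTneq az => ->; rewrite adj_irr.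
    by apply: contraNneq naqp => <-.
  rewrite !inE negb_or; apply/andP; split; last by apply: contraTneq az => ->; rewrite adj_irr.
  by apply: contraNneq naqp => <-; rewrite adj_sym.
(* Both [p] and [q] have two neighbours among the three other vertices of [B]. *)
have [m [Bm apm aqm]] : exists m, [/\ m \in B, adj p m & adj q m].
  have /card_gt0P[m] : 0 < #|N p :&: N q|.
    have sB : [set p; q] \subset B by rewrite subUset !sub1set Bp Bq.
    have := subset_leq_card NS; rewrite cardsU cardsD (setIidPr sB).
    by rewrite cards2 npq B5 -!dn1E !dnBB //; card_lia.
  by rewrite !inE => /andP[/andP[? ?] /andP[_ ?]]; exists m.
have nmx := inB m x Bm nxB; have nmy := inB m y Bm nyB.
have npm : p != m by apply: contraTneq apm => ->; rewrite adj_irr.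
have nqm : q != m by apply: contraTneq aqm => ->; rewrite adj_irr.
(* A second 5-cycle with five leaving edges, hence facial too; the edge leaving [B] at [m] also
   leaves [C], so both facial pentagons contain the same dart. *)
pose C := m |: C4.
have nm : m \notin C4 by rewrite !inE !negb_or ![m == _]eq_sym npm nqm ![_ == m]eq_sym nmx nmy.
have k5 : #|C| = 5 by rewrite cardsU1 nm k4.
have dmC : [disjoint [set m] & C4] by rewrite disjoints1.
have cC : cut C = 5.
  have := @cut_ge5 C; rewrite k5 big ?k5 // => /(_ isT isT).
  have := cut_dn cub C; rewrite k5 {2 3}/C (dnUl _ dmC) !(dnUr _ dmC) dn11 adj_irr.
  rewrite !(dnC [set m]) (dnUl _ d4) !(dn_pair _ npq) !dn11 apm aqm.
  by move: dn4; clear; lia.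
have [g1 [g1F g1k g1B g1e]] := facial_pentagon cB B5.
have [g2 [g2F g2k g2C g2e]] := facial_pentagon cC k5.
have exitB z : z \in B -> exists2 e, e \in exits B & source e = z.
  move=> Bz; have : 0 < dn [set z] (~: B) by rewrite dnB.
  case/dn_gt0P=> z' [t [/set1P-> nt azt]]; have [e ez et] := dart_exists azt.
  by exists e => //; rewrite in_set ez et Bz -in_setC.
have [e Be em] := exitB m Bm.
have Ce : e \in exits C.
  move: Be; rewrite !inE em eqxx => /andP[_ nt]; rewrite /= !negb_or.
  rewrite ![target e == _]eq_sym (inB m _ Bm nt) (inB p _ Bp nt) (inB q _ Bq nt) /=.
  have amt : adj m (target e) by rewrite -em adj_dart.
  apply/andP; split.
    apply: contraNneq npm => te; apply/eqP/(@dn1_le1 x B); rewrite ?xB1 // adj_sym.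
    by rewrite te.
  apply: contraNneq nqm => te; apply/eqP/(@dn1_le1 y B); rewrite ?yB1 // adj_sym.
  by rewrite te.
have g12 : g1 = g2.
  by rewrite (facesP g1F (g1e e Be)) (facesP g2F (g2e e Ce)).
have [z Bz nz] : exists2 z, z \in B & z \notin p |: [set q; m].
  have /card_gt0P[z] : 0 < #|B :\: (p |: [set q; m])|.
    have := cardsID (p |: [set q; m]) B; have := subset_leq_card (subsetIr B (p |: [set q; m])).
    by rewrite cardsU1 cards2 B5; case: (_ \notin _); case: (q != m); card_lia.
  by rewrite in_setD => /andP[]; exists z.
have [ez Bez ezz] := exitB z Bz; have := g1e ez Bez; rewrite g12 => /(subsetP g2C).
rewrite in_set !source_rot ezz !in_setU1 !in_setU !in_set1.
move: nz; rewrite !inE !negb_or => /and3P[/negPf-> /negPf-> /negPf->] /=.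
by rewrite (negPf (inB z x Bz nxB)) (negPf (inB z y Bz nyB)).
Qed.

(** * Unique matchings and the removal of leaves *)

Local Notation matching := (matching (@adj G)).

Lemma card_even : ~~ odd #|G|.
Proof. by have := congr1 odd card_edges; rewrite oddM mul2n odd_double /= => ->. Qed.

(** Petersen's argument: an odd cell sends at least three edges to Q, which receives at most three
    per vertex. *)
Lemma matching_setT : exists m, matching setT m.
Proof.
apply: (tutteP (@adj_sym G)) => Q P /barrierP[_ tP bK].
rewrite -(leq_pmul2l (isT : 0 < 3)) -(dnT cub Q) dnC.
have -> : 3 * #|P| = \sum_(K in P) 3 by rewrite sum_nat_const mulnC.
apply: leq_trans (dn_mono (subsetT (cover P)) (subxx Q)).
rewrite /dn (big_trivIset _ tP) /=; apply: leq_sum => K PK; rewrite -/(dn K Q).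
have [KQ oK cl] := bK K PK.
have K0 : K != set0 by apply: contraTneq oK => ->; rewrite cards0.
have KT : K != setT by apply: contraTneq oK => ->; rewrite cardsT card_even.
apply: leq_trans (cut_ge3 cub conn K0 KT) _.
rewrite /cut dnC (dnID _ Q) (eqP (_ : dn (~: K :\: Q) K == 0)) ?addn0.
  by rewrite dnC dn_mono // subsetIr.
apply/dn_eq0P=> y x /setDP[nKy nQy] Kx; apply: contra nQy => ayx.
have := cl x y Kx (in_setT y); rewrite adj_sym ayx => /(_ isT).
by move: nKy; rewrite !inE => /negPf->.
Qed.

Definition forced A m := matching A m /\ forall m', matching A m' -> {in A, m' =1 m}.

Lemma forcedS A B m : forced A m -> B \subset A -> (forall x, x \in B -> m x \in B) ->
  forced B m.
Proof.
move=> [mA uA] BA clB; split=> [x Bx|m' m'B x Bx].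
  by have [_ ? ?] := mA x (subsetP BA x Bx); rewrite clB.
pose m2 y := if y \in B then m' y else m y.
suff /uA/(_ x (subsetP BA x Bx)) : matching A m2 by rewrite /m2 Bx.
move=> y Ay; rewrite /m2; have [By|nBy] := boolP (y \in B).
  by have [Bm mm am] := m'B y By; rewrite Bm (subsetP BA).
have [Am mm am] := mA y Ay; rewrite (_ : m y \in B = false) //.
by apply: contraNF nBy => /clB; rewrite mm.
Qed.

Definition bridge A B u v :=
  [/\ [disjoint A & B], cut A = 5, cut B = 5 & [/\ u \in A, v \in B, adj u v & dn A B = 1]].

Lemma bridge_sym A B u v : bridge A B u v -> bridge B A v u.
Proof. by case=> d cA cB [Au Bv auv AB]; split; rewrite 1?disjoint_sym // adj_sym dnC. Qed.

Lemma dn_eq1 A B u v x y : dn A B = 1 -> u \in A -> v \in B -> adj u v ->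
  x \in A -> y \in B -> adj x y -> x = u /\ y = v.
Proof.
rewrite -card_darts => /eqP/cards1P[d dE] Au Bv auv Ax By axy.
have key s t : s \in A -> t \in B -> adj s t -> source d = s /\ target d = t.
  move=> As Bt ast; have [e es et] := dart_exists ast.
  have : e \in [set d] by rewrite -dE inE es et As.
  by move=> /set1P <-.
by have [<- <-] := key u v Au Bv auv; have [<- <-] := key x y Ax By axy.
Qed.

(** Kotzig's bridge splits X into parts whose cuts add up to at most 10. Both cuts are odd and at
    least 3; a part with cut 3 is a single vertex, hence a leaf, and otherwise both cuts are 5. *)
Lemma leaf_or_bridge X m : forced X m -> X != set0 -> cut X <= 8 -> 4 <= #|~: X| ->
  (exists2 x, x \in X & dn [set x] X = 1) \/
  (exists A B u v, [/\ X = A :|: B, bridge A B u v, m u = v & cut X = 8]).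
Proof.
move=> [mX uX] X0 c8 lC.
have [A [u [AX oA Au Bv only]]] := unique_matching_bridge (@adj_sym G) (@adj_irr G) X0 mX uX.
set B := X :\: A in Bv only; set v := m u in Bv only.
have Xu : u \in X := subsetP AX u Au.
have auv : adj u v by have [] := mX u Xu.
have AB1 : dn A B = 1.
  have su : [set u] \subset A by rewrite sub1set.
  have sv : [set v] \subset B by rewrite sub1set.
  rewrite (dnDl _ su) (dnDr _ sv) dn11 auv.
  rewrite (eqP (_ : dn (A :\: [set u]) B == 0)) ?addn0; last first.
    apply/dn_eq0P=> x y /setD1P[nx Ax] By; apply: contraNN nx => axy.
    by have [-> _] := only x y Ax By axy.
  rewrite (eqP (_ : dn [set u] (B :\: [set v]) == 0)) //.
  apply/dn_eq0P=> x y /set1P-> /setD1P[ny By]; apply: contraNN ny => axy.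
  by have [_ ->] := only u y Au By axy.
have eX : X = A :|: B by rewrite -{1}(setID X A) (setIidPr AX).
have cB : cut B + cut A = cut X + 2.
  have := cutD AX; rewrite -/B => e1.
  have e2 : cut A = dn A (~: X) + 1.
    rewrite -AB1 /cut (@dnDr _ (~: A) (~: X)) ?setCS //.
    by rewrite (_ : ~: A :\: ~: X = B) // setDE setCK setIC -setDE.
  by move: e1 e2; clear; lia.
have nvA : v \notin A by move: Bv; rewrite inE => /andP[].
have nuB : u \notin B by rewrite inE Au.
have A0 : A != set0 by apply/set0Pn; exists u.
have B0 : B != set0 by apply/set0Pn; exists v.
have AT : A != setT by apply: contraNneq nvA => ->.
have BT : B != setT by apply: contraNneq nuB => ->.
have lCA : 4 <= #|~: A| by apply: leq_trans lC _; rewrite subset_leq_card // setCS.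
have lCB : 4 <= #|~: B| by apply: leq_trans lC _; rewrite subset_leq_card // setCS subsetDl.
have dAB : [disjoint A & B] by rewrite -setI_eq0 setIDA setIC setDIl setDv setI0.
have single Y : Y != set0 -> Y != setT -> 4 <= #|~: Y| -> cut Y = 3 -> forall y, y \in Y -> Y = [set y].
  move=> Y0 YT lY c3 y Yy; apply/esym/eqP; rewrite eqEcard sub1set Yy cards1.
  have [] := small_cut_either Y0 YT; rewrite ?c3 //.
    have oY : odd #|Y| by rewrite -(cut_odd cub) c3.
    by move: oY; card_lia.
  by move: lY; card_lia.
have oB : odd #|B|.
  have := matching_even (@adj_irr G) mX; rewrite eX.
  by rewrite cardsU (disjoint_setI0 dAB) cards0 subn0 oddD oA; case: odd.
have oA' : odd (cut A) by rewrite (cut_odd cub).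
have oB' : odd (cut B) by rewrite (cut_odd cub).
have c3A := cut_ge3 cub conn A0 AT; have c3B := cut_ge3 cub conn B0 BT.
have [c3|n3A] := eqVneq (cut A) 3.
  left; exists u => //; rewrite {1}eX dnUr //.
  by have := single A A0 AT lCA c3 u Au => eA; rewrite {1}eA dn11 adj_irr -eA AB1.
have [c3|n3B] := eqVneq (cut B) 3.
  left; exists v; first by rewrite eX inE Bv orbT.
  rewrite eX dnUr //; have := single B B0 BT lCB c3 v Bv => eB.
  by rewrite {1}eB dn11 adj_irr addn0 -eB dnC AB1.
have [cA5 cB5] : cut A = 5 /\ cut B = 5.
  have n4A : cut A != 4 by apply: contraTneq oA' => ->.
  have n4B : cut B != 4 by apply: contraTneq oB' => ->.
  by move: n3A n3B n4A n4B c3A c3B cB c8; move: (cut A) (cut B) (cut X); clear; lia.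
right; exists A, B, u, v; split=> //.
by move: cB; rewrite cA5 cB5; clear; lia.
Qed.

(** Four edges leave the pair, and two of them go from [u] out of X, so the cut does not grow.
    Within X the leaf sees only its partner, so it can join any independent set found later. *)
Lemma peel_leaf X m u : forced X m -> u \in X -> dn [set u] X = 1 ->
  let Y := X :\: [set u; m u] in
  [/\ forced Y m, #|X| = #|Y| + 2, cut Y <= cut X, Y \subset X &
      forall J, J \subset Y -> dn [set u] J = 0].
Proof.
move=> [mX uX] Xu u1 Y; have [Xv mv auv] := mX u Xu.
have nuv : u != m u by apply: contraTneq auv => <-; rewrite adj_irr.
have sX : [set u; m u] \subset X by rewrite subUset !sub1set Xu Xv.
have YX : Y \subset X by apply: subsetDl.
split=> //.
- apply: (forcedS (conj mX uX)) => // x; rewrite !inE !negb_or => /andP[/andP[n1 n2] Xx].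
  have [Xm mm _] := mX x Xx; rewrite Xm andbT; apply/andP; split.
    by apply: contraNneq n2 => <-; rewrite mm.
  by apply: contraNneq n1 => e; rewrite -mm e mv.
- by have := cardsID [set u; m u] X; rewrite (setIidPr sX) cards2 nuv addnC => <-.
- have := cutD sX; rewrite cut_pair // dn_pair // -/Y.
  have := dnT cub [set u]; rewrite cards1 (dnDr _ (subsetT X)) setTD u1.
  by clear; lia.
- move=> J JY; have dJ : [disjoint [set m u] & J].
    by rewrite disjoints1; apply/negP=> /(subsetP JY); rewrite !inE eqxx orbT.
  have : dn [set u] ([set m u] :|: J) <= 1.
    by rewrite -u1 dn_mono // subUset sub1set Xv (subset_trans JY YX).
  by rewrite dnUr // dn11 auv; clear; lia.
Qed.

Lemma dn_add1 x J : x \notin J -> dn [set x] J = 0 -> dn (x |: J) (x |: J) = dn J J.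
Proof.
move=> nJ x0; rewrite dnUl ?disjoints1 // !dnUr ?disjoints1 //.
by rewrite dn11 adj_irr (dnC J) x0.
Qed.

(* The set J collects the leaves met while peeling X, and both ends of the last edge. *)
Definition nearly_independent (X : {set G}) :=
  exists J : {set G}, [/\ J \subset X, 2 * #|J| = #|X| + 2 & dn J J <= 2].

(** [A :|: B] remains when no leaf is left, and [I] collects the leaves removed before. The clause
    [8 <= cut X] excludes this outcome for smaller cuts. *)
Definition bridged (X : {set G}) m := exists I A B : {set G}, exists u v : G,
  [/\ [/\ I \subset X, A \subset X, B \subset X & [disjoint I & A :|: B]],
      bridge A B u v, m u = v, forced (A :|: B) m &
      [/\ forall x, x \in A :|: B -> 2 <= dn [set x] (A :|: B), dn I I = 0,
          dn I (A :|: B) = 0, 8 <= cut X & 2 * #|I| + #|A| + #|B| = #|X|]].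

Lemma peel X m : forced X m -> X != set0 -> cut X <= 8 -> 4 <= #|~: X| ->
  nearly_independent X \/ bridged X m.
Proof.
have [n] := ubnP #|X|; elim: n => // n IHn in X *; rewrite ltnS => leXn fX X0 c8 lC.
have [mX uX] := fX.
have [/exists_inP[u Xu /eqP u1]|nleaf] := boolP [exists u in X, dn [set u] X == 1].
  have [fY cY cutY YX uJ] := peel_leaf fX Xu u1; set Y := X :\: _ in fY cY cutY YX uJ.
  have nuY : u \notin Y by rewrite !inE eqxx.
  have [Y0|nY0] := eqVneq Y set0.
    (* Both ends of the last matching edge are kept, at the price of one edge inside J. *)
    left; exists X; rewrite cY Y0 cards0; split=> //.
    have c2 : #|X| = 2 by rewrite cY Y0 cards0.
    rewrite dn_sumr -[2]c2 -sum1_card; apply: leq_sum => x Xx; rewrite dn1E -ltnS -[2]c2.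
    apply: proper_card; rewrite properE; apply/andP; split.
      by apply/subsetP=> y; rewrite inE => /andP[].
    by apply/subsetPn; exists x; rewrite // inE adj_irr andbF.
  have ltY : #|Y| < n by move: cY leXn; card_lia.
  have lCY : 4 <= #|~: Y| by apply: leq_trans lC _; rewrite subset_leq_card // setCS.
  have [[J [JY cJ dJ]]|[I [A [B [u' [v' [[IY AY BY dI] br mu fAB [nl I0 IAB c8' cI]]]]]]]] :=
    IHn Y ltY fY nY0 (leq_trans cutY c8) lCY.
  - left; exists (u |: J); have nJ : u \notin J by apply: contra nuY => /(subsetP JY).
    split; first by rewrite subUset sub1set Xu (subset_trans JY YX).
      by rewrite cardsU1 nJ cY; move: cJ; card_lia.
    by rewrite dn_add1 // uJ.
  - right; exists (u |: I), A, B, u', v'.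
    have ABY : A :|: B \subset Y by rewrite subUset AY BY.
    have nI : u \notin I by apply: contra nuY => /(subsetP IY).
    have nAB : u \notin A :|: B by apply: contra nuY => /(subsetP ABY).
    split=> //; split=> //.
    + by rewrite subUset sub1set Xu (subset_trans IY YX).
    + exact: subset_trans AY YX.
    + exact: subset_trans BY YX.
    + move: dI; rewrite -!setI_eq0 setIUl => /eqP->; rewrite setU0.
      by rewrite setI_eq0 disjoints1.
    + by rewrite dn_add1 // uJ.
    + by rewrite dnUl ?disjoints1 // IAB uJ.
    + exact: leq_trans c8' cutY.
    + by rewrite cardsU1 nI cY; move: cI; card_lia.
have [[x Xx x1]|[A [B [u [v [eX br mu cX]]]]]] := leaf_or_bridge fX X0 c8 lC.
  by case/negP: nleaf; apply/exists_inP; exists x; rewrite ?x1.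
right; exists set0, A, B, u, v; rewrite -eX.
split=> //; first by rewrite sub0set eX subsetUl subsetUr -setI_eq0 set0I.
split; rewrite ?dn0l ?cX //.
- move=> x Xx; have [Xm mm am] := mX x Xx.
  have : 0 < dn [set x] X by apply/dn_gt0P; exists x, (m x); rewrite inE.
  rewrite leq_eqVlt => /orP[/eqP e1|//]; case/negP: nleaf; apply/exists_inP.
  by exists x; rewrite -?e1.
- have [dAB _ _ _] := br.
  by rewrite cards0 eX cardsU (disjoint_setI0 dAB) cards0 subn0.
Qed.

Lemma peel6 X m : forced X m -> X != set0 -> cut X <= 6 -> 4 <= #|~: X| ->
  nearly_independent X.
Proof.
move=> fX X0 c6 lC.
have [//|[I [A [B [u [v [_ _ _ _ [_ _ _ c8 _]]]]]]]] := peel fX X0 (leq_trans c6 (isT : 6 <= 8)) lC.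
by have := leq_trans c8 c6.
Qed.

(** A full pentagon has a bad dart, and the next dart also starts in A, so both ends of the bad dart
    are in A. *)
Lemma pentagons_bad A J : J \subset A ->
  #|pentagons A| <= dn J J + dn (A :\: J) (A :\: J).
Proof.
move=> JA; pose P d := (source d \in A) && (target d \in A) && bad J d.
have -> : dn J J + dn (A :\: J) (A :\: J) = #|[set d | P d]|.
  rewrite -!card_darts -cardsUI (_ : _ :&: _ = set0) ?cards0 ?addn0; last first.
    by apply/setP=> d; rewrite !inE; case: (source d \in J); rewrite ?andbF.
  apply: eq_card => d; rewrite !inE /P /bad.
  have := subsetP JA (source d); have := subsetP JA (target d).
  case: (source d \in J); case: (target d \in J); rewrite ?andbT ?andbF ?orbF //=.
  by move=> -> // ->.
rewrite -[leqRHS]sum1dep_card big_mkcond (sum_faces (fun d => if P d then 1 else 0)).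
have -> : pentagons A = [set f in faces | (f \subset inside A) && (#|f| == 5)].
  by apply/setP=> f; rewrite !inE andbA.
rewrite -sum1dep_card big_mkcondr; apply: leq_sum => f fF.
case: ifP => // /andP[fA /eqP f5].
have := bad_parity J fF; rewrite f5 => oB.
have : 0 < #|[set d in f | bad J d]| by case: #|_| oB.
case/card_gt0P=> d; rewrite inE => /andP[fd bd].
rewrite (bigD1 d) //= (_ : P d = true) //; rewrite /P bd andbT.
have := subsetP fA d fd; rewrite inE => -> /=.
have := subsetP fA (phi d); rewrite inE source_phi; apply.
by rewrite (facesP fF fd) mem_face face_phi.
Qed.

(** Without u, the part A keeps a unique matching and has at most six leaving edges, so it can be
    peeled completely. The resulting colouring leaves room for at most four pentagons in A, and
    [cut5_pentagon] applies. *)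
Lemma bridge_pentagon A B u v m : bridge A B u v -> m u = v -> forced (A :|: B) m ->
  (forall x, x \in A :|: B -> 2 <= dn [set x] (A :|: B)) -> 4 <= #|~: (A :|: B)| -> #|A| = 5.
Proof.
move=> [dAB cA cB [Au Bv auv AB]] mu fX nl lC.
have [mX uX] := fX; pose Y := A :\ u.
have aY : #|A| = #|Y|.+1 by rewrite (cardsD1 u A) Au.
have nvA : v \notin A by apply/negP=> Av; have := disjointFr dAB Av; rewrite Bv.
have nuB : u \notin B by have := disjointFr dAB Au => ->.
have Xx x : x \in A -> x \in A :|: B by move=> Ax; rewrite inE Ax.
have fY : forced Y m.
  apply: (forcedS fX); first by apply: subset_trans (subsetDl _ _) (subsetUl _ _).
  move=> x /setD1P[nxu Ax]; have [Xm mm am] := mX x (Xx x Ax); apply/setD1P; split.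
    by apply: contraNneq nvA => e; rewrite -mu -e mm.
  move: Xm; rewrite inE => /orP[//|Bm].
  by have [e _] := dn_eq1 AB Au Bv auv Ax Bm am; rewrite e eqxx in nxu.
have uC : 1 <= dn [set u] (~: A).
  by apply/dn_gt0P; exists u, v; rewrite !inE nvA.
have cY := cutD1 Au; rewrite cA -/Y in cY.
have nG := card_ge20.
have lCA : 4 <= #|~: A| by apply: leq_trans lC _; rewrite subset_leq_card // setCS subsetUl.
have lCY : 4 <= #|~: Y|.
  by apply: leq_trans lCA _; rewrite subset_leq_card // setCS subsetDl.
have oA : odd #|A| by rewrite -(cut_odd cub) cA.
(* A single vertex has cut 3, and three vertices with cut 5 form a path, one end of which is a leaf
   other than u. *)
have l5 : 5 <= #|A|.
  rewrite ltnNge; apply/negP=> le4.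
  have [a1|a3] : #|A| = 1 \/ #|A| = 3 by move: oA le4; case: #|A| => [|[|[|[|[]]]]] //; auto.
    have /eqP/cards1P[x eA] := a1; by move: cA; rewrite eA cut1.
  have nl' x : x \in Y -> 2 <= dn [set x] A.
    move=> /setD1P[nxu Ax]; have := nl x (Xx x Ax); rewrite dnUr //.
    rewrite (eqP (_ : dn [set x] B == 0)) ?addn0 //; apply/dn_eq0P=> x' y /set1P-> By.
    by apply: contra nxu => axy; have [-> _] := dn_eq1 AB Au Bv auv Ax By axy.
  have : 2 * #|Y| <= dn Y A.
    by rewrite dn_sumr mulnC -sum_nat_const; apply: leq_sum.
  have su : [set u] \subset A by rewrite sub1set.
  have := cut_dn cub A; rewrite cA (dnDl _ su) -/Y a3.
  have Y0 : Y != set0 by rewrite -card_gt0; move: aY; rewrite a3; card_lia.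
  have YT : Y != setT by apply: contraTneq lCY => ->; rewrite setCT cards0.
  have := cut_ge3 cub conn Y0 YT; have := dnT cub [set u].
  rewrite cards1 (dnDr _ (subsetT A)) setTD.
  move: aY cY; rewrite a3; card_lia.
have p4 : #|pentagons A| <= 4.
  have Y0 : Y != set0 by rewrite -card_gt0; move: aY l5; card_lia.
  have c6 : cut Y <= 6 by move: cY uC; clear; lia.
  have [J [JY cJ dJ]] := peel6 fY Y0 c6 lCY.
  have JA : J \subset A by apply: subset_trans JY (subsetDl _ _).
  apply: leq_trans (pentagons_bad JA) _.
  have := dnT cub J; rewrite (dnDr _ (subsetT A)) setTD (dnDr _ JA).
  have := dnT cub (A :\: J); rewrite (dnDr _ (subsetT A)) setTD (dnDr (A :\: J) JA).
  rewrite (dnC J (A :\: J)); move: cA; rewrite /cut (dnDl _ JA).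
  have := cardsD A J; rewrite (setIidPr JA).
  (* The bridge starts outside J, so at most four of the five leaving edges start in J; the degree
     count then gives four bad darts at most. *)
  have : 1 <= dn (A :\: J) (~: A).
    apply/dn_gt0P; exists u, v; rewrite !inE Au nvA auv andbT; split=> //.
    by apply/negP=> /(subsetP JY); rewrite !inE eqxx.
  have := subset_leq_card JA.
  move: aY cJ dJ; card_lia.
apply: cut5_pentagon => //; last exact: leq_trans lCA.
exact: leq_trans p4 _.
Qed.

(** * Corners of the embedding and the covering by F24 *)

Definition crn x y z :=
  exists d : dart G, [/\ source d = x, target d = y & target (phi d) = z].

Definition flen x y k :=
  exists d : dart G, [/\ source d = x, target d = y & face_length r d = k].

Lemma crn_dart d : crn (source d) (target d) (target (phi d)).
Proof. by exists d. Qed.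

Lemma crn_adj x y z : crn x y z -> adj x y /\ adj y z.
Proof.
by case=> d [<- <- <-]; rewrite adj_dart -source_phi adj_dart.
Qed.

Lemma crn_fun x y z z' : crn x y z -> crn x y z' -> z = z'.
Proof. by move=> [d [<- <- <-]] [d' [sd td <-]]; rewrite (dart_inj sd td). Qed.

Lemma crn_inj x x' y z : crn x y z -> crn x' y z -> x = x'.
Proof.
move=> [d [<- <- tz]] [d' [<- td tz']]; congr source; apply/phi_inj/dart_inj.
  by rewrite !source_phi td.
by rewrite tz tz'.
Qed.

Lemma crn_third x y z t : crn x y z -> crn t y x -> crn z y t.
Proof.
move=> [d [sx sy sz]] [d' [st sy' sx']]; exists (flip (phi d)).
rewrite target_flip source_phi -[source (flip _)]/(target (phi d)); split=> //.
have e : phi d' = flip d.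
  apply: dart_inj; first by rewrite source_phi sy' -sy.
  by rewrite sx' target_flip sx.
by rewrite {1}/face_step flipK {1}/face_step -e {1}/face_step rot3 target_flip.
Qed.

Lemma crn_irr x y : ~ crn x x y.
Proof. by move=> /crn_adj[]; rewrite adj_irr. Qed.

Lemma crn_next x y z : crn x y z -> exists s, crn y z s.
Proof.
by case=> d [_ <- <-]; exists (target (phi (phi d))); rewrite -source_phi; apply: crn_dart.
Qed.

Lemma crn_rot x y z : crn x y z -> exists t, crn z y t /\ crn t y x.
Proof.
case=> d [<- <- <-]; exists (target (r (phi d))); split.
  by exists (flip (phi d)); rewrite target_flip source_phi /face_step flipK.
exists (flip (r (phi d))); rewrite target_flip source_rot source_phi; split=> //.
by rewrite {1}/face_step flipK {1}/face_step rot3 target_flip.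
Qed.

Lemma crn_back x y : ~ crn x y x.
Proof.
case=> d [sd _ td]; have : phi d = flip d.
  by apply: dart_inj; rewrite ?source_phi // td target_flip.
by apply/eqP; rewrite rot_neq.
Qed.

Lemma flen_prev x y z k : crn x y z -> flen y z k -> flen x y k.
Proof.
move=> [d [sx sy sz]] [d' [sy' sz' lk]]; exists d; split=> //.
by rewrite -lk -!card_face -face_phi (@dart_inj (phi d) d') ?source_phi ?sy ?sz.
Qed.

Lemma crn_iter x y z s t : crn x y z -> crn y z s -> crn z s t -> exists d,
  [/\ source d = x, target d = y, source (phi (phi (phi d))) = s & source (phi (phi (phi (phi d)))) = t].
Proof.
move=> [d [sx sy sz]] [d1 [s1 t1 u1]] [d2 [s2 t2 u2]]; exists d; rewrite !source_phi.
have e1 : phi d = d1 by apply: dart_inj; rewrite ?source_phi ?s1 ?t1.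
have e2 : phi d1 = d2 by apply: dart_inj; rewrite ?source_phi ?s2 ?t2.
by rewrite e1 e2.
Qed.

Lemma crn_phi d x y z : source d = x -> target d = y -> source (phi (phi d)) = z -> crn x y z.
Proof. by move=> <- <- <-; rewrite source_phi; apply: crn_dart. Qed.

Lemma crn_face5 x y z s t : flen x y 5 -> crn x y z -> crn y z s -> crn z s t ->
  crn s t x /\ crn t x y.
Proof.
move=> [d' [sx' sy' l5]] c1 c2 c3; have [d [sx sy ss st]] := crn_iter c1 c2 c3.
have ed : d' = d by apply: dart_inj; rewrite ?sx ?sy.
have := iter_order phi_inj d; rewrite -ed [fingraph.order _ _]l5 ed /= => e5.
split; first by apply: (@crn_phi (phi (phi (phi d)))); rewrite -?source_phi ?e5.
apply: (@crn_phi (phi (phi (phi (phi d))))); rewrite -?source_phi ?e5 //.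
by rewrite source_phi.
Qed.

Lemma crn_face6 x y z s t : flen x y 6 -> crn x y z -> crn y z s -> crn z s t ->
  exists w, [/\ crn s t w, crn t w x & crn w x y].
Proof.
move=> [d' [sx' sy' l6]] c1 c2 c3; have [d [sx sy ss st]] := crn_iter c1 c2 c3.
have ed : d' = d by apply: dart_inj; rewrite ?sx ?sy.
have := iter_order phi_inj d; rewrite -ed [fingraph.order _ _]l6 ed /= => e6.
exists (target (phi (phi (phi (phi d))))); split; first by exists (phi (phi (phi d))); rewrite -source_phi.
  by apply: (@crn_phi (phi (phi (phi (phi d))))); rewrite -?source_phi ?e6.
apply: (@crn_phi (phi (phi (phi (phi (phi d)))))); rewrite -?source_phi ?e6 //.
by rewrite source_phi.
Qed.

Lemma crn_face x y z s t : crn x y z -> crn y z s -> crn z s t ->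
  crn s t x /\ crn t x y \/ exists w, [/\ crn s t w, crn t w x & crn w x y].
Proof.
move=> c1 c2 c3; have [d [sx sy _]] := c1.
have [l5|l6] := sizes d; [left|right].
  by apply: crn_face5 c1 c2 c3; exists d.
by apply: crn_face6 c1 c2 c3; exists d.
Qed.

Lemma crn_triangle x y z : crn x y z -> crn y z x -> crn z x y -> False.
Proof.
move=> c1 c2 c3; have [d [sx sy s3 s4]] := crn_iter c1 c2 c3.
have e3 : iter 3 phi d = d by apply: dart_inj; rewrite /= ?s3 ?sx // -source_phi s4 sy.
have l3 : 3 < fingraph.order phi d by case: (sizes d) => l; rewrite [fingraph.order _ _]l.
by have := findex_iter l3; rewrite e3 findex0.
Qed.

(* All fibres of the covering have the same size, which is 1 since G has more than 12 vertices. *)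
Lemma F24_covering : F24_traced crn -> isomorphic G F24.
Proof.
case=> g gP.
pose h (i : 'I_24) := g i.
have [C1 C2] : (forall i j, F24_adj i j -> adj (h i) (h j)) /\
    (forall i j k, F24_adj i j -> F24_adj i k -> h j = h k -> j = k).
  have key i : exists j k l : 'I_24, [/\ forall x : 'I_24, F24_adj i x -> x \in [:: j; k; l],
     crn (h j) (h i) (h k), crn (h k) (h i) (h l) & crn (h l) (h i) (h j)].
    have [j [k [l [tI _ tA]]]] := F24_rotationP i; exists j, k, l; have [c1 c2] := gP _ _ _ _ tI.
    split=> //; first by move=> x; rewrite tA.
    have [t [c3 c4]] := crn_rot c1.
    by rewrite (crn_fun c3 c2) in c4.
  split=> [i x|i x y]; have [j [k [l [tA c1 c2 c3]]]] := key i.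
    move=> /tA; rewrite !inE => /or3P[]/eqP->.
    - by rewrite adj_sym; have [] := crn_adj c1.
    - by rewrite adj_sym; have [] := crn_adj c2.
    - by rewrite adj_sym; have [] := crn_adj c3.
  move=> /tA + /tA; rewrite !inE => /or3P[]/eqP-> /or3P[]/eqP-> // e; exfalso.
  - by apply: (@crn_back (h j) (h i)); rewrite {2}e.
  - by apply: (@crn_back (h j) (h i)); rewrite {1}e.
  - by apply: (@crn_back (h j) (h i)); rewrite {2}(esym e).
  - by apply: (@crn_back (h k) (h i)); rewrite {2}e.
  - by apply: (@crn_back (h j) (h i)); rewrite {1}(esym e).
  - by apply: (@crn_back (h k) (h i)); rewrite {2}(esym e).
have cF24 i : #|[set x : 'I_24 | F24_adj i x]| = 3.
  have [j [k [l [_ ujkl tA]]]] := F24_rotationP i.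
  by rewrite -[RHS](card_uniqP ujkl); apply: eq_card => x; rewrite [LHS]inE tA.
(* All degrees are three, so a locally injective map is locally onto. *)
have C3 i y : adj (h i) y -> exists2 j, F24_adj i j & h j = y.
  move=> aiy; have : h @: [set x : 'I_24 | F24_adj i x] = [set y | adj (h i) y].
    apply/eqP; rewrite eqEcard cub card_in_imset ?cF24 ?andbT.
      by apply/subsetP=> _ /imsetP[x + ->]; rewrite !inE; apply: C1.
    by move=> x z; rewrite !inE; apply: C2.
  move/setP/(_ y); rewrite [in RHS]inE aiy => /imsetP[j]; rewrite inE => aij ->.
  by exists j.
have closed (A : {set G}) x : x \in A -> (forall y z, y \in A -> adj y z -> z \in A) -> A = setT.
  move=> Ax clA; have A0 : A != set0 by apply/set0Pn; exists x.
  apply/eqP/negPn/negP=> AT; have : 0 < cut A by apply: leq_trans (cut_ge3 cub conn A0 AT).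
  by case/dn_gt0P=> y [z [Ay]]; rewrite inE => nz /(clA _ _ Ay); rewrite (negPf nz).
pose N y := #|[set i | h i == y]|.
(* Lifting the edge from y to z injects the fibre over y into the fibre over z. *)
have leN y z : adj y z -> N y <= N z.
  move=> ayz; have [f fP] : exists f : 'I_24 -> 'I_24, forall i, h i = y -> F24_adj i (f i) /\ h (f i) = z.
    apply: (fin_all_exists (P := fun i j => h i = y -> F24_adj i j /\ h j = z)) => i.
    have [ei|ni] := eqVneq (h i) y; last by exists i => ei; rewrite ei eqxx in ni.
    by have [|j aij ej] := C3 i z; [rewrite ei | exists j].
  rewrite /N -(card_in_imset (f := f)).
    apply/subset_leq_card/subsetP=> _ /imsetP[i + ->]; rewrite !inE => /eqP/fP[_ ->].
    exact: eqxx.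
  move=> i j; rewrite !inE => /eqP ei /eqP ej eij.
  have [a1 _] := fP i ei; have [a2 _] := fP j ej.
  apply: (C2 (f i)); rewrite ?ei ?ej //; first by rewrite F24_sym.
  by rewrite F24_sym eij.
have eqN y : N y = N (h ord0).
  have clN : [set z | N z == N (h ord0)] = setT.
    apply: (closed _ (h ord0)); first by rewrite inE.
    by move=> z t; rewrite !inE => /eqP <- azt; rewrite eqn_leq !leN // adj_sym.
  by have := in_setT y; rewrite -clN inE => /eqP.
have sumN : #|G| * N (h ord0) = 24.
  have -> : #|G| * N (h ord0) = \sum_(y : G) N y.
    by rewrite -sum_nat_const; apply: eq_bigr => y _; rewrite eqN.
  rewrite -[RHS]card_ord -sum1_card (partition_big h xpredT) //=.
  by apply: eq_bigr => y _; rewrite /N -sum1dep_card.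
have N1 : N (h ord0) = 1.
  have := card_ge20; move: sumN; move: (N (h ord0)) #|G| => b a; clear; nia.
have hinj : injective h.
  move=> i j eij; have := eqN (h i); rewrite N1 => /eqP/cards1P[k kE].
  have /set1P-> : i \in [set k] by rewrite -kE inE.
  by apply/esym/set1P; rewrite -kE inE eij.
have cG : #|'I_24| = #|G| by move: sumN; rewrite N1 muln1 card_ord.
have [f fK hK] : bijective h by apply: inj_card_bij; rewrite ?cG.
exists f; first by exists h.
move=> x y; rewrite -{2}(hK x) -{2}(hK y).
apply/idP/idP=> [|/C3[j aj /hinj <-]] //; exact: C1.
Qed.

(** * The faces around a facial pentagon *)

Lemma exit_at A z : one_exit A -> cut A = #|A| -> z \in A ->
  exists2 e, e \in exits A & source e = z.
Proof.
move=> P1 cA; have imE : @source G @: exits A = A.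
  apply/eqP; rewrite eqEcard (card_in_imset (exit_inj P1)) card_exits cA leqnn andbT.
  by apply/subsetP=> _ /imsetP[e + ->]; rewrite inE => /andP[].
by rewrite -{1}imE => /imsetP[e Ae ->]; exists e.
Qed.

(** Rotating the leaving dart at u twice gives a dart of the face, and [phi] walks around A from
    there. The last clause counts the three sides that avoid u. *)
Lemma pentagon_names A u v : cut A = 5 -> #|A| = 5 -> u \in A -> v \notin A -> adj u v ->
  exists a1 a2 a3 a4 r1 r2 r3 r4 : G, exists g,
  [/\ crn a4 u a1 /\ crn a1 u v,
      [/\ crn u a1 a2, crn a1 a2 a3, crn a2 a3 a4 & crn a3 a4 u],
      [/\ crn a2 a1 r1, crn a3 a2 r2, crn a4 a3 r3 & crn u a4 r4],
      [/\ A =i [:: u; a1; a2; a3; a4], uniq [:: u; a1; a2; a3; a4] &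
          [/\ r1 \notin A, r2 \notin A, r3 \notin A & r4 \notin A]] &
      [/\ g \in faces, #|g| = 5, g \subset inside A &
          forall J, a1 \in J -> a2 \in J -> a3 \in J -> a4 \in J ->
            3 <= #|[set d in g | bad J d]|]].
Proof.
move=> cA A5 Au nAv auv; have lC : 3 <= #|~: A|.
  by have := cardsC A; have := card_ge20; rewrite A5; card_lia.
have P1 : one_exit A by apply: one_exit_cut5; rewrite ?A5.
have [g [gF g5 gA ge]] := facial_pentagon cA A5.
have exA z := @exit_at A z P1 (etrans cA (esym A5)).
have gE : g = (fun e => r (r e)) @: exits A.
  have inj2 : injective (fun e => r (r e)) by move=> x y /perm_inj/perm_inj.
  apply/esym/eqP; rewrite eqEcard (card_imset _ inj2) card_exits cA g5 andbT.
  by apply/subsetP=> _ /imsetP[e Ae ->]; apply: ge.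
have srcg : {in g &, injective (@source G)}.
  move=> d d'; rewrite gE => /imsetP[e Ae ->] /imsetP[e' Ae' ->].
  by rewrite !source_rot => /(exit_inj P1 Ae Ae') ->.
have [e eu ev] := dart_exists auv.
have Ae : e \in exits A by rewrite inE eu ev Au.
pose d0 := r (r e); have gd0 : d0 \in g by apply: ge.
have gphi d : d \in g -> phi d \in g.
  by move=> gd; rewrite (facesP gF gd) mem_face face_phi.
have inA d : d \in g -> source d \in A by move=> /(subsetP gA); rewrite inE.
have rexit d : d \in g -> r d \in exits A.
  move=> gd; have [e' Ae' es] := exA _ (inA d gd).
  have <- : r (r e') = d by apply: srcg; rewrite ?ge // !source_rot.
  by rewrite rot3.
have l5 : fingraph.order phi d0 = 5.
  by rewrite -g5 (facesP gF gd0) card_face.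
pose d1 := phi d0; pose d2 := phi d1; pose d3 := phi d2; pose d4 := phi d3.
have e5 : phi d4 = d0 by have := iter_order phi_inj d0; rewrite l5.
have ud : uniq [:: d0; d1; d2; d3; d4] by have := orbit_uniq phi d0; rewrite /fingraph.orbit l5.
have g1 : d1 \in g := gphi _ gd0; have g2 : d2 \in g := gphi _ g1.
have g3 : d3 \in g := gphi _ g2; have g4 : d4 \in g := gphi _ g3.
have src0 : source d0 = u by rewrite !source_rot.
have uniqs : uniq [:: u; source d1; source d2; source d3; source d4].
  rewrite -src0 -[[:: _; _; _; _; _]]/(map (@source G) [:: d0; d1; d2; d3; d4]).
  rewrite map_inj_in_uniq // => d d'.
  by rewrite !inE => /or4P[/eqP->|/eqP->|/eqP->|/orP[]/eqP->] /or4P[/eqP->|/eqP->|/eqP->|/orP[]/eqP->];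
    apply: srcg.
have eA : A =i [:: u; source d1; source d2; source d3; source d4].
  apply/fsym/subset_cardP; first by rewrite (card_uniqP uniqs) A5.
  apply/subsetP=> x; rewrite !inE.
  by move=> /or4P[/eqP->|/eqP->|/eqP->|/orP[]/eqP->] //; apply: inA.
exists (source d1), (source d2), (source d3), (source d4).
exists (target (r d1)), (target (r d2)), (target (r d3)), (target (r d4)), g.
have out d : d \in g -> target (r d) \notin A by move=> /rexit; rewrite inE => /andP[].
have crn_in d : crn (source d) (source (phi d)) (source (phi (phi d))).
  by rewrite !source_phi; apply: crn_dart.
have crn_out d : crn (source (phi (phi d))) (source (phi d)) (target (r (phi d))).
  exists (flip (phi d)); rewrite target_flip; split=> //; last by rewrite /face_step flipK.
  by rewrite source_phi.
split.
- split.
    by have := crn_in d4; rewrite e5 src0.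
  exists (flip d0); rewrite target_flip src0; split=> //; first by rewrite /d1 source_phi.
  by rewrite /face_step flipK rot3.
- split.
  + by have := crn_in d0; rewrite src0.
  + exact: crn_in.
  + exact: crn_in.
  + by have := crn_in d3; rewrite -/d4 e5 src0.
- split.
  + exact: crn_out.
  + exact: crn_out.
  + exact: crn_out.
  + by have := crn_out d3; rewrite -/d4 e5 src0.
- by split=> //; split; apply: out.
split=> // J J1 J2 J3 J4; have u3 : uniq [:: d1; d2; d3].
  by move: ud => /= /and5P[_ + + _ _]; rewrite !inE !negb_or => /and3P[-> -> _] /andP[-> _].
rewrite -[3](card_uniqP u3); apply/subset_leq_card/subsetP=> d; rewrite !inE /bad.
by case/or3P=> /eqP->; rewrite ?g1 ?g2 ?g3 /= -!source_phi ?J1 ?J2 ?J3 ?J4.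
Qed.

Lemma sum_eq_face (X : {set {set dart G}}) g : g \in X -> \sum_(f in X) (f == g) = 1.
Proof.
by move=> Xg; rewrite (bigD1 g) //= eqxx big1 // => f /andP[_ /negPf->].
Qed.

(* Counting the bad darts face by face: an odd number on a pentagon, an even one on a hexagon. *)
Lemma hexagons_bad J g1 g2 f1 f2 :
  [/\ g1 \in faces, g2 \in faces, f1 \in faces & f2 \in faces] ->
  g1 != g2 -> f1 != f2 -> #|g1| = 5 -> #|g2| = 5 -> #|f1| = 6 -> #|f2| = 6 ->
  3 <= #|[set d in g1 | bad J d]| -> 3 <= #|[set d in g2 | bad J d]| ->
  0 < #|[set d in f1 | bad J d]| -> 0 < #|[set d in f2 | bad J d]| ->
  20 <= dn J J + dn (~: J) (~: J).
Proof.
move=> [g1F g2F f1F f2F] ng nf g15 g25 f16 f26 b1 b2 b3 b4.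
rewrite -card_bad sum_bad.
have two g : g \in faces -> \sum_(f in faces) 2 * (f == g) = 2.
  by move=> gF; rewrite -big_distrr /= sum_eq_face.
(* One bad dart for each of 12 pentagons, two more on each of [g1] and [g2], and two on each of [f1]
   and [f2] by parity. *)
have -> : 20 = \sum_(f in faces) (#|f| == 5) +
    (\sum_(f in faces) 2 * (f == g1) + \sum_(f in faces) 2 * (f == g2) +
     (\sum_(f in faces) 2 * (f == f1) + \sum_(f in faces) 2 * (f == f2))).
  rewrite !two //; suff -> : \sum_(f in faces) (#|f| == 5) = 12 by [].
  by rewrite -card_pentagons -sum1dep_card big_mkcondr; apply: eq_bigr => f _; case: eqP.
rewrite -!big_split /=.
have evn f : f \in faces -> #|f| = 6 -> 0 < #|[set d in f | bad J d]| -> 2 <= #|[set d in f | bad J d]|.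
  by move=> fF f6; have := bad_parity J fF; rewrite f6; case: #|_| => [|[|]].
apply: leq_sum => f fF.
have n56 (g f' : {set dart G}) : #|g| = 5 -> #|f'| = 6 -> (g == f') = false.
  by move=> g5 f6; apply/eqP=> e; rewrite e f6 in g5.
have [->|n1] := eqVneq f g1; first by rewrite g15 (negPf ng) !n56.
have [->|n2] := eqVneq f g2; first by rewrite g25 !n56.
have [->|n3] := eqVneq f f1; first by rewrite f16 (negPf nf) evn.
have [->|n4] := eqVneq f f2; first by rewrite f26 evn.
rewrite !muln0 !addn0; case: eqP => // f5; have := bad_parity J fF; rewrite f5.
by case: #|_|.
Qed.

Lemma arc_face5 x' x x1 x2 : crn x' x x1 -> crn x2 x' x -> flen x x1 5 ->
  exists i, [/\ crn x x1 i, crn x1 i x2 & crn i x2 x'].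
Proof.
move=> c1 c2 l5; have [i c3] := crn_next c1; have [t c4] := crn_next c3.
have [c5 /(crn_inj c2) e] := crn_face5 (flen_prev c1 l5) c1 c3 c4.
by rewrite -e in c4 c5; exists i.
Qed.

Lemma arc_face6 x' x x1 x2 : crn x' x x1 -> crn x2 x' x -> flen x x1 6 ->
  face6 crn x x1 x2 x'.
Proof.
move=> c1 c2 l6; have [p c3] := crn_next c1; have [t c4] := crn_next c3.
have [w [c5 c6 /(crn_inj c2) e]] := crn_face6 (flen_prev c1 l6) c1 c3 c4.
by rewrite -e in c5 c6; exists p, t.
Qed.

(** The face runs through q, x, y, z, s, t, so having only five vertices identifies q with t. *)
Lemma side_face5 x y z s t q : crn x y z -> crn y z s -> crn z s t -> crn q x y -> flen s t 5 ->
  t = q /\ crn s t x.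
Proof.
move=> c1 c2 c3 c4 l5.
have [c5 /(crn_inj c4)] := crn_face5 (flen_prev c1 (flen_prev c2 (flen_prev c3 l5))) c1 c2 c3.
by [].
Qed.

Lemma side_face6 x y z s t q : crn x y z -> crn y z s -> crn z s t -> crn q x y -> flen s t 6 ->
  crn s t q /\ crn t q x.
Proof.
move=> c1 c2 c3 c4 l6.
have [w [c5 c6 /(crn_inj c4) e]] :=
  crn_face6 (flen_prev c1 (flen_prev c2 (flen_prev c3 l6))) c1 c2 c3.
by rewrite e.
Qed.

Definition flen6 x y := [exists d, [&& source d == x, target d == y & face_length r d == 6]].

Lemma flenP x y : adj x y -> flen x y (if flen6 x y then 6 else 5).
Proof.
move=> axy; have [d dx dy] := dart_exists axy.
case: ifP => [/existsP[d' /and3P[/eqP<- /eqP<- /eqP<-]]|]; first by exists d'.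
move/negbT; rewrite negb_exists => /forallP/(_ d); rewrite dx dy !eqxx /= => n6.
by exists d; split=> //; case: (sizes d) => // l6; rewrite l6 in n6.
Qed.

Definition has_bad J x y :=
  exists d, [/\ source d = x, target d = y & exists2 d', d' \in face d & bad J d'].

Lemma has_bad_next J x y z : crn x y z -> has_bad J x y -> has_bad J y z.
Proof.
move=> [d [sx sy sz]] [d1 [sx1 sy1 [d' fd' bd']]]; exists (phi d); rewrite source_phi.
by split=> //; exists d'; rewrite // face_phi (@dart_inj d d1) ?sx ?sy.
Qed.

Lemma has_badI J x y : adj x y -> (x \in J) == (y \in J) -> has_bad J x y.
Proof.
move=> /dart_exists[d dx dy] b; exists d; split=> //; exists d; first exact: face_id.
by rewrite /bad dx dy.
Qed.

(** * What peeling leaves: two pentagons joined by an edge *)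

Section Special.
Variables (Z I A B : {set G}) (m : G -> G) (u v : G).
Hypothesis Z4 : #|Z| = 4.
Hypothesis Zadj : forall z, z \in Z -> exists2 w, w \in Z & adj z w.
Hypothesis mT : matching setT m.
Hypothesis I_sub : I \subset ~: Z.
Hypothesis AB_sub : A :|: B \subset ~: Z.
Hypothesis dI : [disjoint I & A :|: B].
Hypothesis brAB : bridge A B u v.
Hypothesis mX : forced (A :|: B) m.
Hypothesis I_indep : dn I I = 0.
Hypothesis I_AB : dn I (A :|: B) = 0.
Hypothesis A5 : #|A| = 5.
Hypothesis B5 : #|B| = 5.
Hypothesis cardI : 2 * #|I| + 14 = #|G|.

Let X := A :|: B.
(** Contains Z and all neighbours of I, and has four vertices more than I. *)
Let Q := ~: (I :|: X).

Let dAB : [disjoint A & B]. Proof. by case: brAB. Qed.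

Let cutX : cut X = 8.
Proof.
have [_ cA cB [_ _ _ AB]] := brAB.
have cx := cut_dn cub X; have ca := cut_dn cub A; have cb := cut_dn cub B.
have : dn X X = dn A A + dn B B + 2.
  by rewrite /X (dnUl _ dAB) !(dnUr _ dAB) (dnC B A) AB; clear; lia.
have : #|X| = 10 by rewrite /X cardsU (disjoint_setI0 dAB) A5 B5 cards0.
by move: cx ca cb; rewrite cA cB A5 B5; card_lia.
Qed.

Let cardX : #|X| = 10.
Proof. by rewrite /X cardsU (disjoint_setI0 dAB) A5 B5 cards0. Qed.

Let cardQ : 2 * #|Q| + 6 = #|G|.
Proof.
have := cardsC (I :|: X); rewrite -/Q cardsU (disjoint_setI0 dI) cards0 cardX.
by have := card_ge20; move: cardI; card_lia.
Qed.

Let dnQ S : dn S setT = dn S I + dn S X + dn S Q.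
Proof. by rewrite (dnDr _ (subsetT (I :|: X))) setTD dnUr. Qed.

(** Of the [3 * #|I| + 12] edge ends at Q, I takes [3 * #|I|] and X takes 8: Q spans just two
    edges. *)
Let dnQQ : dn Q Q = 4.
Proof.
have := dnT cub I; rewrite dnQ // I_indep I_AB.
have := dnT cub Q; rewrite dnQ // (dnC Q I) (dnC Q X).
have : dn X Q = 8.
  rewrite -cutX /cut (@dnDr _ (~: X) Q); last by rewrite setCS subsetUr.
  rewrite (_ : ~: X :\: Q = I) ?(dnC X I) ?I_AB ?addn0 //.
  apply/setP=> x; rewrite /Q !inE negbK; have := disjointFr dI (x := x).
  by rewrite !inE; case: (x \in I) => [->|] //; case: (_ || _).
by move: cardQ cardI; card_lia.
Qed.

Let ZQ : Z \subset Q.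
Proof. by rewrite -setCS setCK subUset I_sub AB_sub. Qed.

(** Each of the four vertices of Z has a neighbour in Q, which uses up the total of [dnQQ]. *)
Let Q_match x y z : x \in Q -> y \in Q -> z \in Q -> adj x y -> adj x z -> y = z.
Proof.
move=> Qx Qy Qz; apply: dn1_le1 Qy Qz.
have ge1 z' : z' \in Z -> 1 <= dn [set z'] Q.
  move=> Zz; have [w Zw azw] := Zadj Zz; apply/dn_gt0P; exists z', w.
  by rewrite inE eqxx (subsetP ZQ).
have sx : [set x] \subset Q by rewrite sub1set.
have := dnQQ; rewrite (dnDl _ sx) => e4.
have : #|Z :\ x| <= dn (Q :\ x) Q.
  rewrite dn_sumr -sum1_card.
  apply: (@leq_trans (\sum_(y in Z :\ x) dn [set y] Q)).
    by apply: leq_sum => y' /setD1P[_ /ge1].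
  rewrite -!dn_sumr; apply: dn_mono => //; exact: setSD.
have : 3 <= #|Z :\ x| by have := cardsD1 x Z; rewrite Z4; case: (x \in Z); card_lia.
by move: e4; card_lia.
Qed.

Let ngbr_I i y : i \in I -> adj i y -> y \in Q.
Proof.
move=> Ii aiy; rewrite !inE; apply/negP=> /orP[Iy|Xy].
  by have /eqP/dn_eq0P/(_ i y Ii Iy) := I_indep; rewrite aiy.
have Xy' : y \in A :|: B by rewrite inE.
by have /eqP/dn_eq0P/(_ i y Ii Xy') := I_AB; rewrite aiy.
Qed.

Let closed_m x : x \notin X -> m x \notin X.
Proof.
have [mXm _] := mX; have [_ mm _] := mT (in_setT x); apply: contra => Xm.
by have [] := mXm _ Xm; rewrite mm.
Qed.

(** By [bond_faces], once both sides are connected: X is, since its two parts are and the bridge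
    joins them. *)
Let X_exits : {in exits X &, injective face}.
Proof.
have [_ cA cB [Au Bv auv AB]] := brAB.
have X0 : X != set0 by rewrite -card_gt0 cardX.
have nG := card_ge20; have cX' := cardsC X; rewrite cardX in cX'.
have XT : X != setT by apply: contraTneq nG => XT; rewrite -cardsT -XT cardX.
have [] := bond_faces X0 XT; last by [].
  move=> S SX S0 nSX; rewrite lt0n; apply/negP=> /eqP e0.
  have part Y : conn_set Y -> Y \subset X -> S :&: Y = set0 \/ S :&: Y = Y.
    move=> cY YX; have [|n0] := eqVneq (S :&: Y) set0; first by left.
    have [|nY] := eqVneq (S :&: Y) Y; first by right.
    have : 0 < dn (S :&: Y) (Y :\: (S :&: Y)) by apply: cY => //; apply: subsetIr.
    rewrite lt0n; case/negP; rewrite -leqn0 -e0; apply: dn_mono; first exact: subsetIl.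
    apply/subsetP=> x /setDP[Yx nSY]; apply/setDP; split; first exact: (subsetP YX).
    by apply: contra nSY => Sx; apply/setIP.
  have cAs : conn_set A.
    apply: conn_setP; rewrite ?cA // -?card_gt0 ?A5 //.
    by apply: contraTneq nG => AT; rewrite -cardsT -AT A5.
  have cBs : conn_set B.
    apply: conn_setP; rewrite ?cB // -?card_gt0 ?B5 //.
    by apply: contraTneq nG => BT; rewrite -cardsT -BT B5.
  have no x y : x \in S -> y \in X -> y \notin S -> ~~ adj x y.
    move=> Sx Xy nSy; have /eqP/dn_eq0P/(_ x y Sx) := e0; apply.
    by rewrite inE nSy.
  have Xu : u \in X by rewrite inE Au. have Xv : v \in X by rewrite inE Bv orbT.
  have Su : u \in S = (v \in S).
    apply/idP/idP=> [Su|Sv]; apply/negPn/negP=> nS.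
      by have := no u v Su Xv nS; rewrite auv.
    by have := no v u Sv Xu nS; rewrite adj_sym auv.
  have eA := part A cAs (subsetUl _ _); have eB := part B cBs (subsetUr _ _).
  have eS : S = (S :&: A) :|: (S :&: B) by rewrite -setIUr; apply/esym/setIidPl.
  have inU (Y : {set G}) w : w \in Y -> S :&: Y = set0 \/ S :&: Y = Y ->
      if w \in S then S :&: Y = Y else S :&: Y = set0.
    move=> Yw [] e; case: ifP => // Sw.
      have Sw' : w \in S :&: Y by rewrite inE Sw.
      by rewrite e inE in Sw'.
    by move: Yw; rewrite -{1}e inE Sw.
  have := inU A u Au eA; have := inU B v Bv eB; rewrite Su.
  case: ifP => _ e1 e2; first by case/negP: nSX; rewrite eS e1 e2.
  by case/negP: S0; rewrite eS e1 e2 setU0.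
(* A separation of the complement respects [m], so both parts have even cuts, at least 4, with sum
   8. Then each has at most three vertices, but the complement has at least ten. *)
move=> S SX S0 nSX; rewrite lt0n; apply/negP=> /eqP e0.
have clm (Y : {set G}) : Y \subset ~: X -> dn Y (~: X :\: Y) = 0 -> matching Y m.
  move=> YX eY x Yx; have [_ mm am] := mT (in_setT x); split=> //.
  have nX := subsetP YX x Yx; rewrite inE in nX.
  apply/negPn/negP=> nYm; have /eqP/dn_eq0P/(_ x (m x) Yx) := eY.
  by rewrite in_setD nYm in_setC closed_m // am => /(_ isT).
have two (Y : {set G}) : Y \subset ~: X -> Y != set0 -> dn Y (~: X :\: Y) = 0 ->
    4 <= cut Y /\ (cut Y <= 4 -> #|Y| <= 3).
  move=> YX Y0 eY; have YT : Y != setT.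
    apply: contraNneq X0 => YT; move: YX; rewrite YT subTset => /eqP eX.
    by rewrite -(setCK X) eX setCT.
  have c3 := cut_ge3 cub conn Y0 YT.
  have := matching_even (@adj_irr G) (clm Y YX eY); rewrite -(cut_odd cub) => ev.
  split; first by move: c3 ev; case: (cut Y) => [|[|[|[]]]].
  move=> c4; rewrite leqNgt; apply/negP=> l4.
  suff /(cut_ge5 l4) : 4 <= #|~: Y| by rewrite ltnNge c4.
  have XY : X \subset ~: Y by rewrite -setCS setCK.
  by have := subset_leq_card XY; rewrite cardX; apply: leq_trans.
have eC : ~: X :\: (~: X :\: S) = S by rewrite setDDr setDv set0U; apply/setIidPr.
have [s4 s3] := two S SX S0 e0.
have C0 : ~: X :\: S != set0.
  by apply: contra nSX; rewrite setD_eq0 eqEsubset SX.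
have [t4 t3] := two (~: X :\: S) (subsetDl _ _) C0 (eq_trans (congr1 (dn _) eC) (eq_trans (dnC _ _) e0)).
have : cut S + cut (~: X :\: S) = 8.
  have := cutD SX; rewrite cutC cutX setCK => e1.
  have e2 : cut S = dn S X.
    rewrite /cut (@dnDr _ (~: S) X); last by rewrite -setCS setCK.
    by rewrite (_ : ~: S :\: X = ~: X :\: S) ?e0 ?addn0 // !setDE setIC.
  by move: e1 e2; clear; lia.
have := cardsD (~: X) S; rewrite (setIidPr SX).
have := subset_leq_card SX.
move=> l1 l2 l3; have {}s3 : #|S| <= 3 by apply: s3; move: t4 l3; clear; lia.
have {}t3 : #|~: X :\: S| <= 3 by apply: t3; move: s4 l3; clear; lia.
by move: cX' nG l1 l2 s3 t3; card_lia.
Qed.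

(** For this colouring the bad edges are the three sides of each pentagon that avoid the bridge, the
    bridge itself and the two edges inside Q: 18 darts. *)
Let J := I :|: ((A :\ u) :|: (B :\ v)).

Let end_dn (Y : {set G}) x y : cut Y = 5 -> #|Y| = 5 -> x \in Y -> y \notin Y -> adj x y ->
  dn (Y :\ x) (Y :\ x) = 6 /\ forall w, w \notin Y -> adj x w -> w = y.
Proof.
move=> cY Y5 Yx nYy axy; have lC : 3 <= #|~: Y|.
  by have := cardsC Y; have := card_ge20; rewrite Y5; card_lia.
have P1 : one_exit Y by apply: one_exit_cut5; rewrite ?Y5.
have le1 := forall_inP P1 x Yx.
split; last by move=> w nYw axw; apply: (dn1_le1 le1); rewrite ?inE.
have : 1 <= dn [set x] (~: Y) by apply/dn_gt0P; exists x, y; rewrite !inE.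
have sx : [set x] \subset Y by rewrite sub1set.
have := cut_dn cub Y; rewrite cY Y5 (dnDl _ sx) !(dnDr _ sx) dn11 adj_irr (dnC _ [set x]).
have := dnT cub [set x]; rewrite cards1 (dnDr _ (subsetT Y)) setTD (dnDr _ sx) dn11 adj_irr.
by move: le1; clear; lia.
Qed.

Let bad18 : dn J J + dn (~: J) (~: J) <= 18.
Proof.
have [_ cA cB [Au Bv auv AB]] := brAB.
have nvA : v \notin A by have := disjointFl dAB Bv => ->.
have nuB : u \notin B by have := disjointFr dAB Au => ->.
have [A6 uN] := end_dn cA A5 Au nvA auv.
have [B6 vN] : dn (B :\ v) (B :\ v) = 6 /\ forall w, w \notin B -> adj v w -> w = u.
  by apply: end_dn => //; rewrite adj_sym.
have sub0 (S T S' T' : {set G}) : dn S T = 0 -> S' \subset S -> T' \subset T -> dn S' T' = 0.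
  by move=> e sS sT; apply/eqP; rewrite -leqn0 -e dn_mono.
have AX : (A :\ u) :|: (B :\ v) \subset X by apply: setUSS; apply: subsetDl.
have d1 : [disjoint I & (A :\ u) :|: (B :\ v)].
  by apply: disjointWr dI.
have d2 : [disjoint A :\ u & B :\ v].
  apply: disjointW dAB; apply: subsetDl.
have e1 : dn (A :\ u) (B :\ v) = 0.
  apply/eqP/dn_eq0P=> x y /setD1P[nx Ax] /setD1P[_ By].
  by apply: contra nx => axy; have [-> _] := dn_eq1 AB Au Bv auv Ax By axy.
have -> : dn J J = 12.
  rewrite /J (dnUl _ d1) !(dnUr _ d1) I_indep (dnC _ I).
  rewrite (sub0 I X I) // (dnUl _ d2) !(dnUr _ d2) A6 B6 (dnC (B :\ v)) e1.
  by [].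
have nuv : u != v by apply: contraNneq nvA => <-.
have eJ : ~: J = Q :|: [set u; v].
  apply/setP=> x; rewrite /J /Q !inE; case: (eqVneq x u) => [->|nu].
    by rewrite (negPf nuv) (negPf nuB) /= !orbF orbT; have := disjointFl dI (x := u); rewrite inE Au => ->.
  case: (eqVneq x v) => [->|nv] /=; last by rewrite orbF.
  by rewrite (negPf nvA) Bv !orbF orbT; have := disjointFl dI (x := v); rewrite inE Bv orbT => ->.
have d3 : [disjoint Q & [set u; v]].
  rewrite disjoint_sym disjoints_subset subUset !sub1set /Q !inE Au Bv.
  by rewrite !orbT.
have uQ : dn [set u] Q = 0.
  apply/eqP/dn_eq0P=> x y /set1P-> Qy; apply/negP=> auy.
  have nAy : y \notin A by move: Qy; rewrite !inE !negb_or => /and3P[].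
  by move: Qy; rewrite (uN y nAy auy) !inE Bv !orbT.
have vQ : dn [set v] Q = 0.
  apply/eqP/dn_eq0P=> x y /set1P-> Qy; apply/negP=> avy.
  have nBy : y \notin B by move: Qy; rewrite !inE !negb_or => /and3P[].
  by move: Qy; rewrite (vN y nBy avy) !inE Au !orbT.
rewrite eJ (dnUl _ d3) !(dnUr _ d3) dnQQ (dnC Q) !dn_pair // uQ vQ !(dnC _ [set u; v]) !dn_pair //.
by rewrite !dn11 !adj_irr (adj_sym v) auv.
Qed.

Let end_Q (Y : {set G}) w x y : Y \subset X -> (forall a, a \in Y -> a != w -> forall b, b \in X -> b \notin Y -> ~~ adj a b) ->
  x \in Y -> x != w -> y \notin Y -> adj x y -> y \in Q.
Proof.
move=> YX out Yx nxw nYy axy; rewrite in_setC in_setU negb_or; apply/andP; split.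
  apply/negP=> Iy; have := @ngbr_I y x Iy; rewrite adj_sym axy => /(_ isT).
  by rewrite in_setC in_setU (subsetP YX x Yx) orbT.
by apply/negP=> Xy; have := out x Yx nxw y Xy nYy; rewrite axy.
Qed.

(** In X, the vertex would make the face leave X twice, against [X_exits]; in Q, it would have two
    neighbours there. *)
Let mid_I x x1 i x2 : x \in X -> x1 \in Q -> x2 \in Q -> crn x x1 i -> crn x1 i x2 -> i \in I.
Proof.
move=> Xx Q1 Q2 c1 c2; have [ax1 a1i] := crn_adj c1; have [_ ai2] := crn_adj c2.
have nX z : z \in Q -> z \notin X by rewrite in_setC in_setU negb_or => /andP[].
have nXi : i \notin X.
  apply/negP=> Xi; have [d [sx sx1 si]] := c1; have [d' [sx1' si' sx2]] := c2.
  have e : phi d = d' by apply: dart_inj; rewrite ?source_phi ?sx1 ?si.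
  have : d = phi d'.
    apply: X_exits; last by rewrite face_phi -e face_phi.
      by rewrite inE sx sx1 Xx nX.
    by rewrite inE source_phi si' sx2 Xi nX.
  move=> ed; have := c1; rewrite -sx ed source_phi si' => c.
  by apply: (crn_back c).
apply/negPn/negP=> nI; have Qi : i \in Q by rewrite in_setC in_setU negb_or nI.
have e := Q_match Qi Q1 Q2; rewrite adj_sym in a1i.
by move: c2; rewrite -(e a1i ai2) => /crn_back.
Qed.

Lemma special_F24 : isomorphic G F24.
Proof.
apply: F24_covering; have [_ cA cB [Au Bv auv AB]] := brAB.
have nvA : v \notin A by have := disjointFl dAB Bv => ->.
have nuB : u \notin B by have := disjointFr dAB Au => ->.
have avu : adj v u by rewrite adj_sym.
have [a1 [a2 [a3 [a4 [r1 [r2 [r3 [r4 [gA [[u1 u2] [A1 A2 A3 A4] [E1 E2 E3 E4]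
  [eA uA [nr1 nr2 nr3 nr4]] [gAF gA5 gAs gAb]]]]]]]]]]] := pentagon_names cA A5 Au nvA auv.
have [b4 [b3 [b2 [b1 [s4 [s3 [s2 [s1 [gB [[v1 v2] [B4 B3 B2 B1] [F4 F3 F2 F1]
  [eB uB [ns4 ns3 ns2 ns1]] [gBF gB5 gBs gBb]]]]]]]]]]] := pentagon_names cB B5 Bv nuB avu.
have config : two_pentagons crn u a1 a2 a3 a4 r1 r2 r3 r4 v b1 b2 b3 b4 s1 s2 s3 s4.
  by do ?split.
have u3 := crn_third u2 u1; have v3 := crn_third v2 v1.
have [ba1 ba2 ba3 ba4] : [/\ crn r1 a1 u, crn r2 a2 a1, crn r3 a3 a2 & crn r4 a4 a3].
  by split; [apply: crn_third E1 A1 | apply: crn_third E2 A2 | apply: crn_third E3 A3 | apply: crn_third E4 A4].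
have [bb1 bb2 bb3 bb4] : [/\ crn s1 b1 b2, crn s2 b2 b3, crn s3 b3 b4 & crn s4 b4 v].
  by split; [apply: crn_third F1 B1 | apply: crn_third F2 B2 | apply: crn_third F3 B3 | apply: crn_third F4 B4].
have [Aa1 Aa2 Aa3 Aa4] : [/\ a1 \in A, a2 \in A, a3 \in A & a4 \in A].
  by rewrite !eA !inE !eqxx !orbT.
have [Bb1 Bb2 Bb3 Bb4] : [/\ b1 \in B, b2 \in B, b3 \in B & b4 \in B].
  by rewrite !eB !inE !eqxx !orbT.
have [nu1 nu2 nu3 nu4] : [/\ a1 != u, a2 != u, a3 != u & a4 != u].
  move: uA; rewrite [uniq _]/= !inE !negb_or ![u == _]eq_sym.
  by case/andP=> /and4P[].
have [nv1 nv2 nv3 nv4] : [/\ b1 != v, b2 != v, b3 != v & b4 != v].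
  move: uB; rewrite [uniq _]/= !inE !negb_or ![v == _]eq_sym.
  by case/andP=> /and4P[].
have QA x y : x \in A -> x != u -> y \notin A -> adj x y -> y \in Q.
  apply: end_Q (subsetUl _ _) _ => a Aa nau b Xb nAb; apply: contra nau => aab.
  move: Xb; rewrite inE (negPf nAb) /= => Bb.
  by have [-> _] := dn_eq1 AB Au Bv auv Aa Bb aab.
have QB x y : x \in B -> x != v -> y \notin B -> adj x y -> y \in Q.
  apply: end_Q (subsetUr _ _) _ => b Bb nbv a Xa nBa; apply: contra nbv => aba.
  move: Xa; rewrite inE (negPf nBa) orbF => Aa; rewrite adj_sym in aba.
  by have [_ ->] := dn_eq1 AB Au Bv auv Aa Bb aba.
have [Q1 Q2 Q3 Q4] : [/\ r1 \in Q, r2 \in Q, r3 \in Q & r4 \in Q].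
  by split; [apply: QA Aa1 nu1 nr1 _ | apply: QA Aa2 nu2 nr2 _ | apply: QA Aa3 nu3 nr3 _ |
    apply: QA Aa4 nu4 nr4 _]; [have [] := crn_adj E1 | have [] := crn_adj E2 |
    have [] := crn_adj E3 | have [] := crn_adj E4].
have [P1 P2 P3 P4] : [/\ s1 \in Q, s2 \in Q, s3 \in Q & s4 \in Q].
  by split; [apply: QB Bb1 nv1 ns1 _ | apply: QB Bb2 nv2 ns2 _ | apply: QB Bb3 nv3 ns3 _ |
    apply: QB Bb4 nv4 ns4 _]; [have [] := crn_adj F1 | have [] := crn_adj F2 |
    have [] := crn_adj F3 | have [] := crn_adj F4].
have XA x : x \in A -> x \in X by move=> Ax; rewrite inE Ax.
have XB x : x \in B -> x \in X by move=> Bx; rewrite inE Bx orbT.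
(* One leaving edge for each crossing face, numbered as in [at_most_one_hexagon]. *)
pose out k := nth (u, u) [:: (b1, s1); (a4, r4); (a1, r1); (a2, r2); (a3, r3);
                             (b2, s2); (b3, s3); (b4, s4)] k.
have adj_out k : k < 8 -> adj (out k).1 (out k).2.
  case: k => [_|[_|[_|[_|[_|[_|[_|[_|//]]]]]]]] /=.
  - by have [] := crn_adj F1.
  - by have [] := crn_adj E4.
  - by have [] := crn_adj E1.
  - by have [] := crn_adj E2.
  - by have [] := crn_adj E3.
  - by have [] := crn_adj F2.
  - by have [] := crn_adj F3.
  - by have [] := crn_adj F4.
pose hex k := flen6 (out k).1 (out k).2.
have len k : k < 8 -> flen (out k).1 (out k).2 (if hex k then 6 else 5).
  by move=> /adj_out /flenP.
have JA x : x \in A -> x != u -> x \in J by move=> Ax nx; rewrite !inE Ax nx orbT.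
have JB x : x \in B -> x != v -> x \in J by move=> Bx nx; rewrite !inE Bx nx !orbT.
have nJ x : x \in X -> x \notin (A :\ u) :|: (B :\ v) -> x \notin J.
  by move=> Xx nx; rewrite in_setU (negPf nx) orbF (disjointFl dI).
have nJu : u \notin J by apply: nJ; [exact: XA | rewrite !inE eqxx (negPf nuB) andbF].
have nJv : v \notin J by apply: nJ; [exact: XB | rewrite !inE eqxx (negPf nvA) andbF].
(* The faces along uv contain the bridge, the other crossing faces a pentagon side avoiding u and v;
   all these edges are bad. *)
have bad_out k : k < 8 -> has_bad J (out k).1 (out k).2.
  have in_bad x y : adj x y -> x \in J -> y \in J -> has_bad J x y.
    by move=> axy Jx Jy; apply: has_badI; rewrite ?Jx ?Jy.
  case: k => [_|[_|[_|[_|[_|[_|[_|[_|//]]]]]]]] /=.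
  - apply: has_bad_next F1 (has_bad_next v3 (has_badI auv _)).
    by rewrite (negPf nJu) (negPf nJv).
  - apply: has_bad_next E4 (has_bad_next u3 (has_badI avu _)).
    by rewrite (negPf nJu) (negPf nJv).
  - by have [c _] := crn_adj E1; apply: has_bad_next E1 (in_bad _ _ c _ _); apply: JA.
  - by have [c _] := crn_adj E2; apply: has_bad_next E2 (in_bad _ _ c _ _); apply: JA.
  - by have [c _] := crn_adj E3; apply: has_bad_next E3 (in_bad _ _ c _ _); apply: JA.
  - by have [c _] := crn_adj F2; apply: has_bad_next F2 (in_bad _ _ c _ _); apply: JB.
  - by have [c _] := crn_adj F3; apply: has_bad_next F3 (in_bad _ _ c _ _); apply: JB.
  - by have [c _] := crn_adj F4; apply: has_bad_next F4 (in_bad _ _ c _ _); apply: JB.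
have out_exit k : k < 8 -> ((out k).1 \in X) && ((out k).2 \notin X).
  have nX z : z \in Q -> z \notin X by rewrite in_setC in_setU negb_or => /andP[].
  by case: k => [_|[_|[_|[_|[_|[_|[_|[_|//]]]]]]]] /=;
    rewrite nX // andbT; do [exact: XA | exact: XB].
have out_inj j k : j < 8 -> k < 8 -> (out j).1 = (out k).1 -> j = k.
  have uout : uniq [:: b1; a4; a1; a2; a3; b2; b3; b4].
    have sep x y : x \in A -> y \in B -> (x == y) = false.
      by move=> Ax By; apply: contraTF (Ax) => /eqP->; have := disjointFl dAB By => ->.
    move: uA uB; rewrite /= !inE !negb_or => /and5P[_ /and3P[? ? ?] /andP[? ?] ? _].
    move=> /and5P[_ /and3P[? ? ?] /andP[? ?] ? _].
    by do ?[apply/andP; split]; first [done | by rewrite eq_sym | by rewrite sep | by rewrite eq_sym sep].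
  have e l : l < 8 -> (out l).1 = nth u [:: b1; a4; a1; a2; a3; b2; b3; b4] l.
    by case: l => [_|[_|[_|[_|[_|[_|[_|[_|//]]]]]]]].
  by move=> j8 k8; rewrite !e // => /eqP; rewrite nth_uniq // => /eqP.
(* Two crossing hexagons would raise the number of bad darts to 20, above the bound [bad18]. *)
have uhex j k : j < 8 -> k < 8 -> hex j -> hex k -> j = k.
  move=> j8 k8 hj hk; apply: (out_inj) => //; apply/eqP/negPn/negP=> nout.
  have faceX l : l < 8 -> hex l -> exists d, [/\ source d = (out l).1, d \in exits X,
      #|face d| = 6 & 0 < #|[set d' in face d | bad J d']|].
    move=> l8 hl; have [d [sd td [d' fd' bd']]] := bad_out l l8; exists d; split=> //.
    - by rewrite inE sd td out_exit.
    - have [d1 [sd1 td1]] := len l l8; rewrite hl card_face => <-.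
      by congr (face_length r _); apply: dart_inj; rewrite ?sd ?td.
    - by apply/card_gt0P; exists d'; rewrite inE fd'.
  have [dj [sj ej lj bj]] := faceX j j8 hj; have [dk [sk ek lk bk]] := faceX k k8 hk.
  have nf : face dj != face dk.
    by apply: contraNneq nout => /(X_exits ej ek) e; rewrite -sj -sk e.
  have ng : gA != gB.
    have [d fd] : exists d, d \in gA by apply/card_gt0P; rewrite gA5.
    apply: contraTneq (fd) => eg; apply/negP=> _; have := subsetP gAs d fd.
    rewrite eg in fd; have := subsetP gBs d fd; rewrite !inE => Bd Ad.
    by have := disjointFr dAB Ad; rewrite Bd.
  suff : 20 <= dn J J + dn (~: J) (~: J) by move=> le20; have := leq_trans le20 bad18.
  apply: (@hexagons_bad J gA gB (face dj) (face dk)) => //.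
  - by split=> //; apply: face_in.
  - by apply: gAb; apply: JA.
  - by apply: gBb; apply: JB.
apply: (at_most_one_hexagon crn_fun crn_inj crn_third crn_irr crn_next crn_rot crn_back
  crn_face crn_triangle (I := fun x => x \in I) _ _ config uhex).
- move=> x y z Iy Iz /crn_adj[_ ayz].
  by have /eqP/dn_eq0P/(_ y z Iy Iz) := I_indep; rewrite ayz.
- move=> x y z i j k c c' c'' Ii Ij Ik /crn_adj[_ aix] /crn_adj[_ ajy] /crn_adj[_ akz] cxyz.
  have [axy ayz] := crn_adj cxyz; rewrite adj_sym in axy.
  have e := Q_match (ngbr_I Ij ajy) (ngbr_I Ii aix) (ngbr_I Ik akz) axy ayz.
  by rewrite e in cxyz; apply: crn_back cxyz.
- have := len 0 isT; case: (hex 0) => l; first exact: side_face6 u2 v3 F1 ba1 l.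
  by have [e c] := side_face5 u2 v3 F1 ba1 l; rewrite /side1_5 -e.
- have := len 1 isT; case: (hex 1) => l; first exact: side_face6 v2 u3 E4 bb4 l.
  by have [e c] := side_face5 v2 u3 E4 bb4 l; rewrite /side2_5 -e.
- have := len 2 isT; case: (hex 2) => l; first exact: arc_face6 E1 ba2 l.
  have [i [c1 c2 c3]] := arc_face5 E1 ba2 l.
  by exists i; split=> //; apply: mid_I c1 c2 => //; apply: XA.
- have := len 3 isT; case: (hex 3) => l; first exact: arc_face6 E2 ba3 l.
  have [i [c1 c2 c3]] := arc_face5 E2 ba3 l.
  by exists i; split=> //; apply: mid_I c1 c2 => //; apply: XA.
- have := len 4 isT; case: (hex 4) => l; first exact: arc_face6 E3 ba4 l.
  have [i [c1 c2 c3]] := arc_face5 E3 ba4 l.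
  by exists i; split=> //; apply: mid_I c1 c2 => //; apply: XA.
- have := len 5 isT; case: (hex 5) => l; first exact: arc_face6 F2 bb1 l.
  have [i [c1 c2 c3]] := arc_face5 F2 bb1 l.
  by exists i; split=> //; apply: mid_I c1 c2 => //; apply: XB.
- have := len 6 isT; case: (hex 6) => l; first exact: arc_face6 F3 bb2 l.
  have [i [c1 c2 c3]] := arc_face5 F3 bb2 l.
  by exists i; split=> //; apply: mid_I c1 c2 => //; apply: XB.
- have := len 7 isT; case: (hex 7) => l; first exact: arc_face6 F4 bb3 l.
  have [i [c1 c2 c3]] := arc_face5 F4 bb3 l.
  by exists i; split=> //; apply: mid_I c1 c2 => //; apply: XB.
Qed.

End Special.

Lemma forced_complement_F24 (Z : {set G}) m : #|Z| = 4 -> matching setT m ->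
  (forall z, z \in Z -> m z \in Z) -> forced (~: Z) m -> isomorphic G F24.
Proof.
move=> Z4 mT clZ fX; have nG := card_ge20; have cX := cardsC Z; rewrite Z4 in cX.
have Zadj z : z \in Z -> exists2 w, w \in Z & adj z w.
  by move=> Zz; exists (m z); [apply: clZ | have [] := mT z (in_setT z)].
have c8 : cut (~: Z) <= 8.
  have : 4 <= dn Z Z.
    rewrite dn_sumr -{1}Z4 -sum1_card; apply: leq_sum => z Zz.
    by have [w Zw azw] := Zadj z Zz; apply/dn_gt0P; exists z, w; rewrite inE.
  by have := cut_dn cub Z; rewrite cutC Z4; clear; lia.
have X0 : ~: Z != set0 by rewrite -card_gt0; move: cX nG; card_lia.
have lZ : 4 <= #|~: ~: Z| by rewrite setCK Z4.
have [[J [JX cJ dJ]]|] := peel fX X0 c8 lZ.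
  (* J has two vertices fewer than its complement, which therefore spans three edges more than J;
     with at most one edge in J, this makes at most 10 bad darts. *)
  have cJC := cardsC J; have := bad_ge12 J.
  have := cut_dn cub J; have := cut_dn cub (~: J); rewrite cutC.
  by move: cJ cJC cX dJ; move: #|_| #|_| #|_| #|_| => a b c d; clear; lia.
move=> [I [A [B [u [v [[IX AX BX dI] br mu fAB [nl I0 IAB _ cI]]]]]]].
have ABX : A :|: B \subset ~: Z by rewrite subUset AX BX.
have lC : 4 <= #|~: (A :|: B)|.
  by rewrite -{1}Z4 subset_leq_card // -setCS setCK.
have A5 := bridge_pentagon br mu fAB nl lC.
have mv : m v = u by rewrite -mu; have [_ ->] := mT u (in_setT u).
have B5 : #|B| = 5.
  by apply: (bridge_pentagon (bridge_sym br) mv); rewrite setUC.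
have cI14 : 2 * #|I| + 14 = #|G|.
  by move: cI cX; rewrite A5 B5; card_lia.
exact: (special_F24 Z4 Zadj mT IX ABX dI br fAB I0 IAB A5 B5 cI14).
Qed.

End Faces.

(** * Forcing sets *)

Section PerfectMatchings.
Variable G : sgraph.
Implicit Types (M S : {set {set G}}) (m : G -> G).

Definition pairs m : {set {set G}} := [set [set x; m x] | x : G].

Lemma perfect_matching_pairs m : matching (@adj G) setT m -> perfect_matching (pairs m).
Proof.
move=> mT; have mm x : m (m x) = x by have [] := mT x (in_setT x).
have am x : adj x (m x) by have [] := mT x (in_setT x).
have pairE x y : y \in [set x; m x] -> [set x; m x] = [set y; m y].
  by case/set2P=> ->; rewrite ?mm // setUC.
apply/andP; split.
  apply/subsetP=> _ /imsetP[x _ ->]; apply/imsetP.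
  by exists (x, m x); rewrite // inE /=.
apply/and3P; split.
- rewrite eqEsubset subsetT; apply/subsetP=> x _; apply/bigcupP.
  by exists [set x; m x]; [apply: imset_f | rewrite set21].
- apply/trivIsetP=> _ _ /imsetP[x _ ->] /imsetP[y _ ->]; apply: contraR.
  by rewrite -setI_eq0 => /set0Pn[z /setIP[/pairE-> /pairE->]].
- by apply/negP=> /imsetP[x _ /setP/(_ x)]; rewrite !inE eqxx.
Qed.

Lemma perfect_matchingP M : perfect_matching M ->
  exists2 m, matching (@adj G) setT m & M = pairs m.
Proof.
case/andP=> /subsetP Medges /and3P[/eqP cM tM M0].
have [m mP] : exists m : G -> G, forall x, [set x; m x] \in M /\ adj x (m x).
  apply: (fin_all_exists (P := fun x y => [set x; y] \in M /\ adj x y)) => x.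
  have Mx : x \in cover M by rewrite cM.
  have MB : pblock M x \in M by rewrite pblock_mem.
  have xB : x \in pblock M x by rewrite mem_pblock.
  have /imsetP[[a b] /= aab eB] := Medges _ MB; rewrite inE /= in aab.
  move: xB MB; rewrite eB => /set2P[]->; first by exists b.
  by exists a; rewrite setUC adj_sym.
have blk B x : B \in M -> x \in B -> B = [set x; m x].
  move=> MB xB; have [Mx _] := mP x.
  by rewrite -(def_pblock tM MB xB) (def_pblock tM Mx) ?set21.
exists m.
  move=> x _; have [Mx ax] := mP x; split=> //; have [_ amm] := mP (m x).
  have : m (m x) \in [set x; m x] by rewrite (blk _ (m x) Mx) ?set22.
  case/set2P=> // e; by rewrite e adj_irr in amm.
apply/setP=> B; apply/idP/imsetP=> [MB|[x _ ->]]; last by have [] := mP x.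
have /set0Pn[x xB] : B != set0 by apply: contraNneq M0 => <-.
by exists x => //; apply: blk.
Qed.

Lemma card_pairs m : matching (@adj G) setT m -> 2 * #|pairs m| = #|G|.
Proof.
move=> mT; have /andP[_ pP] := perfect_matching_pairs mT.
have two B : B \in pairs m -> #|B| = 2.
  case/imsetP=> x _ ->; rewrite cards2; have [_ _ am] := mT x (in_setT x).
  by case: eqVneq am => // <-; rewrite adj_irr.
by rewrite -cardsT mulnC; have := card_uniform_partition two pP => <-.
Qed.

Lemma subset_between M S k : S \subset M -> #|S| <= k -> k <= #|M| ->
  exists S', [/\ S \subset S', S' \subset M & #|S'| = k].
Proof.
move=> SM; elim: k => [|k IHk] leS lek.
  by exists S; split=> //; apply/eqP; rewrite -leqn0.
move: leS; rewrite leq_eqVlt => /orP[/eqP eS|]; first by exists S.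
rewrite ltnS => leS; have [S' [SS' S'M cS']] := IHk leS (ltnW lek).
have /card_gt0P[B] : 0 < #|M :\: S'|.
  by have := cardsD M S'; rewrite (setIidPr S'M) cS'; move: lek; card_lia.
case/setDP=> MB nB; exists (B |: S'); split.
- exact: subset_trans SS' (subsetUr _ _).
- by rewrite subUset sub1set MB.
- by rewrite cardsU1 nB cS'.
Qed.

End PerfectMatchings.

Lemma forcing_set_ge3 (G : sgraph) (M S : {set {set G}}) : fullerene G ->
  ~ isomorphic G F24 -> perfect_matching M -> forcing_set M S -> 3 <= #|S|.
Proof.
move=> [cub conn [r [rot euler] sizes]] nF24 pM /andP[SM /forallP forces].
rewrite leqNgt; apply/negP; rewrite ltnS => S2; apply: nF24.
have [m mT eM] := perfect_matchingP pM.
have nG := card_ge20 cub euler sizes.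
have cM : 2 * #|M| = #|G| by rewrite eM card_pairs.
have M2 : 2 <= #|M| by move: cM nG; card_lia.
have [S' [SS' S'M cS']] := subset_between SM S2 M2.
have /cards2P[e1 [e2 [ne eS]]] : #|S'| == 2 by apply/eqP.
have mm x : m (m x) = x by have [] := mT x (in_setT x).
have am x : adj x (m x) by have [] := mT x (in_setT x).
have blk e x : e \in M -> x \in e -> e = [set x; m x].
  by rewrite eM => /imsetP[y _ ->] /set2P[]->; rewrite ?mm // setUC.
have [M1 M2'] : e1 \in M /\ e2 \in M.
  by rewrite !(subsetP S'M) // eS !inE eqxx ?orbT.
have card2 e : e \in M -> #|e| = 2.
  rewrite eM => /imsetP[x _ ->]; rewrite cards2; have := am x.
  by case: eqVneq => // <-; rewrite adj_irr.
have d12 : [disjoint e1 & e2].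
  have /andP[_ /and3P[_ /trivIsetP tM _]] := pM.
  exact: tM.
pose Z := e1 :|: e2; have Z4 : #|Z| = 4.
  by rewrite cardsU (disjoint_setI0 d12) cards0 !card2.
have clZ z : z \in Z -> m z \in Z.
  rewrite !inE => /orP[]ze; apply/orP; [left|right]; rewrite (blk _ _ _ ze) ?set22 //.
apply: (forced_complement_F24 cub conn rot euler sizes Z4 mT clZ).
have clC x : x \notin Z -> m x \notin Z by apply: contra => /clZ; rewrite mm.
split=> [x|m' m'C x].
  by rewrite !in_setC => nx; rewrite clC.
(* Completed by [m] on Z, another matching of the complement still contains S, so that S forces it
   to agree with M. *)
rewrite in_setC => nxZ; pose m2 y := if y \in Z then m y else m' y.
have m2T : matching (@adj G) setT m2.
  move=> y _; rewrite /m2; have [yZ|nyZ] := boolP (y \in Z); first by rewrite clZ.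
  have [] := m'C y; rewrite ?in_setC // => /negPf nm' mm' am'.
  by rewrite nm'.
have sub2 : S \subset pairs m2.
  apply: subset_trans SS' _; apply/subsetP=> e Se; have Me := subsetP S'M e Se.
  have /card_gt0P[y ye] : 0 < #|e| by rewrite card2.
  have yZ : y \in Z by move: Se; rewrite eS !inE => /orP[]/eqP<-; rewrite ye ?orbT.
  by rewrite (blk e y Me ye); apply/imsetP; exists y; rewrite // /m2 yZ.
have := forces (pairs m2); rewrite perfect_matching_pairs // sub2 => /eqP eM2.
have : [set x; m2 x] \in M by rewrite -eM2; apply: imset_f.
move/blk => /(_ x (set21 _ _)) /setP/(_ (m2 x)); rewrite set22 /m2 (negPf nxZ).
move/esym/set2P; case=> // e; have := m'C x; rewrite in_setC => /(_ nxZ)[_ _].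
by rewrite e adj_irr.
Qed.

Theorem theorem1p1 (F : sgraph) :
  fullerene F -> ~ isomorphic F F24 -> 3 <= min_forcing_number F.
Proof.
move=> fF nF; have [cub conn [r [rot euler] sizes]] := fF.
(* [min_forcing_number] is 0 by convention without a perfect matching, so one has to exist. *)
have [m mT] := matching_setT cub conn.
rewrite /min_forcing_number; case: pickP => [M0 pM0|/(_ (pairs m))]; last first.
  by rewrite perfect_matching_pairs.
case: arg_minnP => // M pM _; rewrite /forcing_number.
(* The default of the minimum must qualify: a perfect matching containing M has as many edges as M,
   hence equals it. *)
have fM : forcing_set M M.
  rewrite /forcing_set subxx; apply/forallP=> M'; apply/implyP=> /andP[pM' sM].
  have [[m1 m1T eM] [m2 m2T eM']] := (perfect_matchingP pM, perfect_matchingP pM').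
  rewrite eq_sym eqEcard sM -(leq_pmul2l (isT : 0 < 2)).
  by rewrite eM' (card_pairs m2T) eM (card_pairs m1T) leqnn.
case: arg_minnP => // S fS _; exact: forcing_set_ge3 fF nF pM fS.
Qed.
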